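(* Let $d\ge 3$ and let $b\colon[-1,1]\to[0,+\infty]$ be a measurable function such that for all $\sigma\in S^{d-1}$, $$\int_{S^{d-1}}\big(1-(\sigma\cdot\sigma')^2\big)\,b(\sigma\cdot\sigma')\,d\sigma'<+\infty .$$ Then the largest constant $\Lambda_b$ for which the inequality $$\int_{S^{d-1}}\Gamma^2_{\mathcal{B},\Delta}(\log f,\log f)\,f\,d\sigma\ \ge\ \Lambda_b\iint_{S^{d-1}\times S^{d-1}}\frac{(f(\sigma')-f(\sigma))^2}{f(\sigma')+f(\sigma)}\,b(\sigma'\cdot\sigma)\,d\sigma'\,d\sigma$$ holds for all smooth functions $f\colon S^{d-1}\to(0,+\infty)$ with $f(-\sigma)=f(\sigma)$ satisfies $\Lambda_b\ge d-2$; that is, the inequality holds for all such $f$ with $\Lambda_b$ replaced by $d-2$.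
   Context: On the unit sphere $S^{d-1}$ of $\mathbb{R}^d$, $\nabla_\sigma$ is the Riemannian gradient, $d\sigma$ the surface measure, and $$\mathcal{B}f(\sigma)=\int_{S^{d-1}}(f(\sigma')-f(\sigma))\,b(\sigma'\cdot\sigma)\,d\sigma',\qquad \Gamma_\Delta(f,g)=\nabla_\sigma f\cdot\nabla_\sigma g,$$ $$\Gamma^2_{\mathcal{B},\Delta}(f,g)=\tfrac12\big(\mathcal{B}(\Gamma_\Delta(f,g))-\Gamma_\Delta(\mathcal{B}f,g)-\Gamma_\Delta(f,\mathcal{B}g)\big).$$ When $b$ is not integrable on the sphere, the integral defining $\mathcal{B}f(\sigma)$ is understood in the principal value sense (removing symmetric neighbourhoods of $\pm\sigma$ and passing to the limit). *)

(* Defs.v *)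
From HB Require Import structures.
From mathcomp Require Import all_boot all_order all_algebra.
From mathcomp Require Import all_classical all_reals all_analysis.
From mathcomp Require Import measurable_realfun.
Set Implicit Arguments.
Unset Strict Implicit.
Unset Printing Implicit Defensive.
Import Order.TTheory GRing.Theory Num.Theory.
Import numFieldNormedType.Exports.
Local Open Scope classical_set_scope.
Local Open Scope ring_scope.

Definition measure_rV_display : measure_display -> measure_display.
Proof. exact. Qed.

Section measurable_rV.
Context {d} {T : measurableType d}.
Variable n : nat.

Let coord : 'I_n -> 'rV[T]_n -> T := fun i x => x ord0 i.

Let rV_set0 : g_sigma_preimage coord set0.
Proof. exact: sigma_algebra0. Qed.

Let rV_setC A : g_sigma_preimage coord A -> g_sigma_preimage coord (~` A).
Proof. exact: sigma_algebraC. Qed.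

Let rV_bigcup (F : _^nat) : (forall i, g_sigma_preimage coord (F i)) ->
  g_sigma_preimage coord (\bigcup_i (F i)).
Proof. exact: sigma_algebra_bigcup. Qed.

(* The sigma-algebra generated by the coordinates; for T = R it is the Borel
   sigma-algebra of R^n. *)
HB.instance Definition _ := @isMeasurable.Build (measure_rV_display d)
  'rV[T]_n (g_sigma_preimage coord) rV_set0 rV_setC rV_bigcup.

End measurable_rV.

Lemma measurable_coord d (T : measurableType d) n (i : 'I_n) :
  measurable_fun [set: 'rV[T]_n] (fun x : 'rV[T]_n => x ord0 i).
Proof.
move=> _ Y mY; rewrite setTI; apply: sub_sigma_algebra => /=.
rewrite -bigcup_seq/=; exists i => /=; first by rewrite mem_index_enum.
by exists Y => //; rewrite setTI.
Qed.

Lemma measurable_fun_rVP d1 d2 (T1 : measurableType d1) (T2 : measurableType d2)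
    n (f : T1 -> 'rV[T2]_n) :
  measurable_fun [set: T1] f <->
  forall i, measurable_fun [set: T1] (fun x => f x ord0 i).
Proof.
split=> [mf i|mf].
  exact: (measurableT_comp (measurable_coord i) mf).
move=> _ A mA; rewrite setTI; move: A mA.
suff: g_sigma_preimage (fun (i : 'I_n) (x : 'rV[T2]_n) => x ord0 i) `<=`
    [set A | measurable (f @^-1` A)] by [].
apply: smallest_sub.
  split => /=; first by rewrite preimage_set0.
    by move=> A mA; rewrite setTD preimage_setC; exact: measurableC.
  by move=> F mF; rewrite preimage_bigcup; exact: bigcup_measurable.
rewrite -bigcup_seq => A [i _] [B mB <-] /=.
by rewrite setTI -[X in measurable X]setTI; exact: mf.
Qed.

Definition cons_rV (R : realType) n (p : measurableTypeR R * 'rV[R]_n) : 'rV[R]_n.+1 :=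
  row_mx (\row_(_ < 1) p.1) p.2.

(* Lebesgue measure on R^n, the n-fold product of the one on R. *)
Fixpoint lebesgue_rV (R : realType) n : set 'rV[R]_n -> \bar R :=
  if n is n'.+1 then
    pushforward (lebesgue_measure \x @lebesgue_rV R n')%E (@cons_rV R n')
  else \d_(0 : 'rV[R]_0).

Section lebesgue_rV_measure.
Variable R : realType.

Lemma cons_rV0 n (p : measurableTypeR R * 'rV[R]_n) : cons_rV p ord0 ord0 = p.1.
Proof.
have -> : ord0 = lshift n (ord0 : 'I_1) by exact: val_inj.
by rewrite [LHS]row_mxEl mxE.
Qed.

Lemma cons_rVS n (p : measurableTypeR R * 'rV[R]_n) i :
  cons_rV p ord0 (lift ord0 i) = p.2 ord0 i.
Proof.
have -> : lift ord0 i = rshift 1 i by exact: val_inj.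
exact: row_mxEr.
Qed.

Lemma measurable_cons_rV n : measurable_fun setT (@cons_rV R n).
Proof.
apply/measurable_fun_rVP => i; have [j ->|->] := unliftP ord0 i.
  under eq_fun do rewrite cons_rVS.
  exact: (measurableT_comp (measurable_coord j) measurable_snd).
under eq_fun do rewrite cons_rV0.
exact: measurable_fst.
Qed.

Lemma sigma_finite_product d1 d2 (T1 : measurableType d1)
    (T2 : measurableType d2) (m1 : {sigma_finite_measure set T1 -> \bar R})
    (m2 : {sigma_finite_measure set T2 -> \bar R}) :
  sigma_finite setT (m1 \x m2)%E.
Proof.
have /sigma_finiteP[F [TF ndF mF]] := sigma_finiteT m1.
have /sigma_finiteP[G [TG ndG mG]] := sigma_finiteT m2.
exists (fun n => F n `*` G n).
  apply/esym; rewrite -subTset => -[x y] _.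
  have [i _ Fix] : (\bigcup_i F i) x by rewrite -TF.
  have [j _ Gjy] : (\bigcup_i G i) y by rewrite -TG.
  exists (maxn i j) => //; split => /=.
    by move: x Fix; apply/subsetPset/ndF/leq_maxl.
  by move: y Gjy; apply/subsetPset/ndG/leq_maxr.
move=> i; have [mFi Foo] := mF i; have [mGi Goo] := mG i; split.
  exact: measurableX.
by rewrite product_measure1E// lte_mul_pinfty// ge0_fin_numE.
Qed.

Lemma measure_sigma_finite_ex d (T : measurableType d)
    (mu : {measure set T -> \bar R}) : sigma_finite setT mu ->
  exists m : {sigma_finite_measure set T -> \bar R}, mu = m :> (set T -> \bar R).
Proof.
move=> smu; pose H1 := @isSFinite.Build _ _ _ _ (sfinite_measure_sigma_finite smu).
pose H2 := @isSigmaFinite.Build _ _ _ _ smu.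
by exists (HB.pack_for (SigmaFiniteMeasure.type T R) (Measure.sort mu) H1 H2).
Qed.

Lemma lebesgue_rV_ind n : exists m : {sigma_finite_measure set 'rV[R]_n -> \bar R},
  lebesgue_rV (n := n) = m.
Proof.
elim: n => [|n [m mE]].
  by exists (dirac (0 : 'rV[R]_0)).
have mc := @measurable_cons_rV n.
pose M : {measure set 'rV[R]_n.+1 -> \bar R} :=
  pushforward (lebesgue_measure \x m)%E (@cons_rV R n).
have sM : sigma_finite setT (M mc).
  have [F TF mF] := sigma_finite_product (@lebesgue_measure R) m.
  pose uncons (v : 'rV[R]_n.+1) : R * 'rV[R]_n :=
    (v ord0 ord0, \row_i v ord0 (lift ord0 i)).
  have consK : cancel (@cons_rV R n) uncons.
    move=> [x v]; congr (_, _); first exact: cons_rV0.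
    by apply/rowP => i; rewrite mxE cons_rVS.
  have muncons : measurable_fun setT uncons.
    apply/measurable_fun_pairP; split; first exact: measurable_coord.
    apply/measurable_fun_rVP => i.
    have := @measurable_coord _ R _ (lift ord0 i).
    by apply: eq_measurable_fun => x _; rewrite /= mxE.
  exists (fun i => uncons @^-1` F i).
    by rewrite -preimage_bigcup -TF preimage_setT.
  move=> i; split.
    by rewrite -[X in measurable X]setTI; apply: muncons => //; exact: (mF i).1.
  rewrite /M/= /pushforward -comp_preimage.
  have -> : (uncons \o @cons_rV R n) @^-1` F i = F i.
    by apply/seteqP; split => p; rewrite /preimage/= consK.
  exact: (mF i).2.
have [m' m'E] := measure_sigma_finite_ex sM.
by exists m'; rewrite -m'E /= mE.
Qed.

Variable n : nat.

Let lebesgue_rV0 : lebesgue_rV (set0 : set 'rV[R]_n) = 0%E.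
Proof. by have [m ->] := lebesgue_rV_ind n; rewrite measure0. Qed.

Let lebesgue_rV_ge0 (A : set 'rV[R]_n) : (0 <= lebesgue_rV A)%E.
Proof. by have [m ->] := lebesgue_rV_ind n. Qed.

Let lebesgue_rV_additive : semi_sigma_additive (@lebesgue_rV R n).
Proof.
by have [m ->] := lebesgue_rV_ind n; exact: measure_semi_sigma_additive.
Qed.

HB.instance Definition _ := isMeasure.Build _ _ _ (@lebesgue_rV R n)
  lebesgue_rV0 lebesgue_rV_ge0 lebesgue_rV_additive.

Let lebesgue_rV_sigma_finite : sigma_finite setT (@lebesgue_rV R n).
Proof. by have [m ->] := lebesgue_rV_ind n; exact: sigma_finiteT. Qed.

HB.instance Definition _ := Measure_isSigmaFinite.Build _ _ _ (@lebesgue_rV R n)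
  lebesgue_rV_sigma_finite.

End lebesgue_rV_measure.

Section cube.
Variable R : realType.

Local Notation cube n := [set x : 'rV[R]_n | forall i, `|x ord0 i| <= 1].

Lemma measurable_cube n : measurable (cube n).
Proof.
have -> : cube n = \bigcap_(i in [set: 'I_n])
    ((fun x : 'rV[R]_n => x ord0 i) @^-1` `[-1, 1]).
  apply/seteqP; split => x /= h i; first by move=> _; rewrite /= in_itv/= -ler_norml.
  by have := h i Logic.I; rewrite /= in_itv/= -ler_norml.
apply: fin_bigcap_measurable => // i _.
by rewrite -[X in measurable X]setTI; exact: measurable_coord.
Qed.

Lemma lebesgue_rV_cube n : (lebesgue_rV (cube n) < +oo)%E.
Proof.
elim: n => [|n IHn].
  by rewrite /= diracE; case: (_ \in _); rewrite ltry.
have [m mE] := lebesgue_rV_ind R n.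
rewrite /= /pushforward mE.
have -> : @cons_rV R n @^-1` cube n.+1 = `[-1, 1]%classic `*` cube n.
  apply/seteqP; split => -[x v] /= h.
    split; first by have := h ord0; rewrite cons_rV0 /= in_itv/= -ler_norml.
    by move=> i; have := h (lift ord0 i); rewrite cons_rVS.
  case: h; rewrite /= in_itv/= -ler_norml => hx hv i.
  by have [j ->|->] := unliftP ord0 i; rewrite ?cons_rVS ?cons_rV0.
rewrite product_measure1E//; last exact: measurable_cube.
have I1 : (lebesgue_measure (`[(-1 : R)%R, 1%R]%classic) < +oo)%E.
  by rewrite lebesgue_measure_itv/=; case: ifP => _; rewrite ?ltry// -EFinB ltry.
by rewrite -mE lte_mul_pinfty// ge0_fin_numE.
Qed.

End cube.

Section sphere.
Variables (R : realType) (d : nat).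
Implicit Types x y : 'rV[R]_d.

Definition dotv x y : R := \sum_(i < d) x ord0 i * y ord0 i.

(* The Euclidean norm; the library's norm on row vectors is the sup norm. *)
Definition enorm x : R := Num.sqrt (dotv x x).

Definition sphere : set 'rV[R]_d := [set x | enorm x = 1].

Definition sproj x : 'rV[R]_d := (enorm x)^-1 *: x.

Definition unit_ball : set 'rV[R]_d := [set x | enorm x <= 1].

(* The surface measure of A is d times the volume of the part of the unit ball
   lying over A (the two measures are related by dx = r^(d-1) dr dsigma). It is
   carried by the sphere. *)
Definition surface_measure (A : set 'rV[R]_d) : \bar R :=
  (d%:R%:E * lebesgue_rV (sproj @^-1` A `&` unit_ball))%E.

Lemma enorm_ge0 x : 0 <= enorm x. Proof. exact: sqrtr_ge0. Qed.

Lemma measurable_enorm : measurable_fun setT enorm.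
Proof.
apply: (measurableT_comp (continuous_measurable_fun (@sqrt_continuous R))).
apply: (@measurable_sum _ _ _ setT _ _ (fun i x => x ord0 i * x ord0 i)) => i.
by apply: measurable_funM; exact: measurable_coord.
Qed.

Lemma measurable_sproj : measurable_fun setT sproj.
Proof.
apply/measurable_fun_rVP => i.
have -> : (fun x => sproj x ord0 i) = (fun x => enorm x `^ (-1) * x ord0 i).
  by apply/funext => x; rewrite mxE powR_inv1 ?enorm_ge0.
apply: measurable_funM; last exact: measurable_coord.
exact: (measurableT_comp (measurable_powR (-1)) measurable_enorm).
Qed.

Lemma measurable_unit_ball : measurable unit_ball.
Proof.
have -> : unit_ball = enorm @^-1` `]-oo, 1].
  by apply/seteqP; split => x; rewrite /= in_itv.
by rewrite -[X in measurable X]setTI; exact: measurable_enorm.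
Qed.

Let surface0 : surface_measure set0 = 0%E.
Proof. by rewrite /surface_measure preimage_set0 set0I measure0 mule0. Qed.

Let surface_ge0 A : (0 <= surface_measure A)%E.
Proof. by rewrite mule_ge0// lee_fin. Qed.

Let surface_additive : semi_sigma_additive surface_measure.
Proof.
pose P : {measure set 'rV[R]_d -> \bar R} :=
  pushforward (mrestr (@lebesgue_rV R d) measurable_unit_ball) sproj.
pose k : {nonneg R} := NngNum (ler0n R d).
have -> : surface_measure = mscale k (P measurable_sproj) by [].
exact: measure_semi_sigma_additive.
Qed.

HB.instance Definition _ := isMeasure.Build _ _ _ surface_measure
  surface0 surface_ge0 surface_additive.

Let surface_fin : fin_num_fun surface_measure.
Proof.
apply: lty_fin_num_fun; rewrite lte_mul_pinfty ?lee_fin//.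
apply: le_lt_trans (lebesgue_rV_cube R d).
apply: le_measure; rewrite ?inE.
- by rewrite preimage_setT setTI; exact: measurable_unit_ball.
- exact: measurable_cube.
move=> x [_ x1] i; rewrite -sqrtr_sqr (le_trans _ x1)// ler_wsqrtr//.
rewrite expr2 /dotv (bigD1 i)//= lerDl sumr_ge0// => j _; exact: sqr_ge0.
Qed.

HB.instance Definition _ := Measure_isFinite.Build _ _ _ surface_measure
  surface_fin.

End sphere.

Arguments surface_measure {R d}.
Arguments sproj {R d}.
Arguments sphere R d : clear implicits.

Section dissipation.
Variables (R : realType) (d : nat).
Implicit Types (f g : 'rV[R]_d -> R) (b : R -> \bar R) (s x : 'rV[R]_d).

(* Functions on the sphere are represented by functions on R^d of which only
   the values on the sphere matter; [f \o sproj] is the extension of f to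
   R^d \ {0} that is constant along rays. *)

Definition iter_partial (l : seq 'I_d) (F : 'rV[R]_d -> R) : 'rV[R]_d -> R :=
  foldr (fun i G x => 'D_(delta_mx 0 i) G x) F l.

(* f is C^oo on the sphere iff its extension constant along rays has continuous
   partial derivatives of all orders on R^d \ {0}. *)
Definition sphere_smooth f : Prop :=
  forall (l : seq 'I_d) x, x != 0 ->
    {for x, continuous (iter_partial l (f \o sproj))} /\
    forall i, derivable (iter_partial l (f \o sproj)) x (delta_mx 0 i).

(* The Riemannian gradient at a point of the sphere, as a vector of R^d: since
   the radial derivative of [f \o sproj] vanishes, its Euclidean gradient is
   tangent to the sphere. *)
Definition sphere_grad f s : 'rV[R]_d :=
  \row_i 'D_(delta_mx 0 i) (f \o sproj) s.

Definition Gamma_Delta f g s : R := dotv (sphere_grad f s) (sphere_grad g s).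

Definition off_caps (e : R) s : set 'rV[R]_d :=
  sphere R d `&` [set s' | `|dotv s' s| < 1 - e].

(* Principal value: the caps of s' with |s' . s| >= 1 - e, around s and -s, are
   removed. When b is integrable on the sphere, this is the plain integral. *)
Definition Bop b f s : R :=
  lim (fine (\int[surface_measure]_(s' in off_caps e s)
               ((f s' - f s)%:E * b (dotv s' s)))%E @[e --> 0^'+]).

Definition Gamma2_B_Delta b f g s : R :=
  2^-1 * (Bop b (Gamma_Delta f g) s
          - Gamma_Delta (Bop b f) g s - Gamma_Delta f (Bop b g) s).

Definition dissipation_ineq b (L : R) : Prop :=
  forall f, sphere_smooth f ->
    (forall s, sphere R d s -> 0 < f s) ->
    (forall s, sphere R d s -> f (- s) = f s) ->
  (L%:E * \int[surface_measure]_(s in sphere R d)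
            \int[surface_measure]_(s' in sphere R d)
              (((f s' - f s) ^+ 2 / (f s' + f s))%:E * b (dotv s' s))
   <= \int[surface_measure]_(s in sphere R d)
        (Gamma2_B_Delta b (@ln R \o f) (@ln R \o f) s * f s)%:E)%E.

(* The largest L for which the inequality holds, +oo if it holds for all L. *)
Definition best_constant b : \bar R :=
  ereal_sup [set L%:E | L in [set L | dissipation_ineq b L]].

End dissipation.

(* Main.v *)
(* Let h = ln f, t = s . s' and K the integral of (1 - t^2) b. For even functions
   B commutes with rotations, and Gamma^2(h, h)(s) becomes the integral against b
   of half of (1 - t^2) |q|^2 - (s' . q)^2 plus a square, where q is the gradient
   of h at s; since the mean of (s' . q)^2 is K |q|^2 / (d - 1), this gives
   Gamma^2(h, h) >= (K / 2) ((d - 2) / (d - 1)) |q|^2.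

   On the other side (f' - f)^2 / (f' + f) <= (F' - F)^2 with F = sqrt (2 f), and
   |grad F|^2 = f |q|^2 / 2, so that what remains is the spectral gap
   inequality: the integral of b (F' - F)^2 is at most K / (d - 1) times that of
   |grad F|^2, for even F. By invariance F may be composed with a random rotation,
   and it suffices to bound the mean square of F' - F for a fixed pair (s, s').
   Rotate the pair in the plane of s' - s (or of s' + s) and of a direction
   orthogonal to s and s': the difference is then a stationary process in the
   angle which changes sign after a half-turn, so its mean square is at most that
   of its derivative. The two bounds obtained, with factors (1 - t) / 2 and
   (1 + t) / 2, combine to (1 - t^2) / (d - 1) times the mean of |grad F|^2. *)

From HB Require Import structures.
Require Import Defs.
From mathcomp Require Import all_boot all_order all_algebra.
From mathcomp Require Import all_classical all_reals all_analysis.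
From mathcomp Require Import measurable_realfun.
From mathcomp Require Import ring lra.
Import Order.TTheory GRing.Theory Num.Theory.
Import numFieldNormedType.Exports.
Local Open Scope classical_set_scope.
Local Open Scope ring_scope.

Set Implicit Arguments.
Unset Strict Implicit.
Unset Printing Implicit Defensive.

(** * Lebesgue measure and linear isometries *)

(** The constant d - 2 is an exact quotient: the curvature bound carries K (d - 2) / (2 (d - 1)) per
    unit of f |q|^2, the spectral gap K / (d - 1) per unit of |grad F|^2 = f |q|^2 / 2. Each 1 / (d
    - 1) comes from sharing a squared norm among the d - 1 tangent directions. The kernel may be
    singular, so b is never differentiated: to differentiate B h, the variable of integration is
    rotated together with the point, which freezes b (s' . s) and moves the derivative onto h.
    Tangential derivatives of B h are thus B applied to derivatives of h along infinitesimal
    rotations. For the process in the angle, the correlation vanishes at pi / 2; halving the angle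
    repeatedly gives C(t) <= cos(t) C(0) at t = pi / 2^k, and letting t tend to 0 yields the
    inequality. The bounds from s' - s and s' + s involve the sum and the difference of the same two
    slopes; weighted by (1 + t) / 2 and (1 - t) / 2 they get a common factor, and the cross terms
    cancel. The random rotation is the Gram-Schmidt frame of a random matrix, which is why
    invariance of Lebesgue measure under linear isometries comes at the start. *)

Section lebesgue_shift.
Context (R : realType).

Lemma lebesgue_measure_shift (a : R) (A : set R) : measurable A ->
  pushforward lebesgue_measure (fun x : R => (x + a : measurableTypeR R)) A
  = lebesgue_measure A.
Proof.
move=> mA.
have mf : measurable_fun setT (fun x : R => (x + a : measurableTypeR R)).
  by apply: measurable_funD => //; exact: measurable_cst.
pose M : {measure set (measurableTypeR R) -> \bar R} :=
  pushforward (@lebesgue_measure R) (fun x : R => (x + a : measurableTypeR R)).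
apply/esym/(@lebesgue_measure_unique _ (M mf)) => //= _ [[u v]] _ <-.
rewrite /M/= /pushforward.
have -> : (fun x : R => x + a) @^-1` `]u, v] = `]u - a, v - a]%classic.
  by apply/seteqP; split=> x /=; rewrite !in_itv/= => /andP[h1 h2];
    apply/andP; split; lra.
rewrite !lebesgue_measure_itv/= !lte_fin ltrD2r; case: ifP => // _.
by rewrite -!EFinB; congr EFin; lra.
Qed.

Lemma measurable_shift n (a : 'rV[R]_n) : measurable_fun setT (fun x : 'rV[R]_n => x + a).
Proof.
apply/measurable_fun_rVP => i; under eq_fun do rewrite mxE.
by apply: measurable_funD; [exact: measurable_coord|exact: measurable_cst].
Qed.

(** Induction on the dimension: the measure is the integral over the first coordinate of the measure
    of sections; the induction hypothesis moves each section, and the one-dimensional invariance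
    moves the outer variable. *)
Lemma lebesgue_rV_shift n (a : 'rV[R]_n) (A : set 'rV[R]_n) : measurable A ->
  lebesgue_rV ((fun x : 'rV[R]_n => x + a) @^-1` A) = lebesgue_rV A.
Proof.
elim: n a A => [|n IH] a A mA.
  by congr lebesgue_rV; apply/seteqP; split=> x; rewrite /preimage/= (thinmx0 a) addr0.
rewrite /= /pushforward /product_measure1/=.
set B := @cons_rV R n @^-1` A.
have mB : measurable B.
  by have := @measurable_cons_rV R n measurableT A mA; rewrite setTI.
pose a0 := a ord0 ord0; pose a1 : 'rV[R]_n := \row_i a ord0 (lift ord0 i).
have aE x v : cons_rV (x, v) + a = cons_rV (x + a0, v + a1).
  apply/rowP => i; rewrite mxE.
  by have [j ->|->] := unliftP ord0 i; rewrite ?cons_rVS ?cons_rV0/= ?mxE.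
transitivity (\int[@lebesgue_measure R]_x lebesgue_rV (xsection B (x + a0)%R))%E.
  apply: eq_integral => x _ /=.
  rewrite -(IH a1 (xsection B (x + a0))); last exact: (measurable_xsection _ mB).
  congr lebesgue_rV; apply/seteqP; split => v;
    by rewrite /xsection/B/= !inE/= aE.
have mf : measurable_fun setT (fun x : R => (x + a0 : measurableTypeR R)).
  by apply: measurable_funD => //; exact: measurable_cst.
pose M : {measure set (measurableTypeR R) -> \bar R} :=
  pushforward (@lebesgue_measure R) (fun x : R => (x + a0 : measurableTypeR R)).
have mphi : measurable_fun [set: measurableTypeR R]
    (fun x : measurableTypeR R => lebesgue_rV (xsection B x)).
  exact: (measurable_fun_xsection _ mB).
have := @ge0_integral_pushforward _ _ (measurableTypeR R) (measurableTypeR R) R _ mf lebesgue_measure setT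
  (fun x => lebesgue_rV (xsection B x)) measurableT mphi (fun _ _ => measure_ge0 _ _).
rewrite preimage_setT => <-.
apply: (@eq_measure_integral _ _ _ _ (@lebesgue_measure R) (M mf)) => X mX _.
exact: lebesgue_measure_shift.
Qed.

End lebesgue_shift.

(** * Uniqueness of translation-invariant measures *)

Section shift_invariant.
Context (R : realType) (n : nat).
Local Open Scope ereal_scope.
Variables (m1 m2 : {sigma_finite_measure set 'rV[R]_n -> \bar R}).
Hypothesis shift1 : forall a A, measurable A -> m1 ((fun x : 'rV[R]_n => x + a)%R @^-1` A) = m1 A.
Hypothesis shift2 : forall a A, measurable A -> m2 ((fun x : 'rV[R]_n => x + a)%R @^-1` A) = m2 A.
Variable B : set 'rV[R]_n.
Hypothesis mB : measurable B.
Hypothesis symB : forall x, B x -> B (- x)%R.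
Hypothesis B12 : m1 B = m2 B.
Hypothesis B0 : 0 < m2 B.
Hypothesis Boo : m2 B < +oo.

Lemma measurable_addrV : measurable_fun setT (fun p : 'rV[R]_n * 'rV[R]_n => p.1 + p.2)%R.
Proof.
apply/measurable_fun_rVP => i; under eq_fun do rewrite mxE.
apply: measurable_funD.
  exact: (measurableT_comp (measurable_coord i) measurable_fst).
exact: (measurableT_comp (measurable_coord i) measurable_snd).
Qed.

Lemma measurable_subrV : measurable_fun setT (fun p : 'rV[R]_n * 'rV[R]_n => p.2 - p.1)%R.
Proof.
apply/measurable_fun_rVP => i; under eq_fun do rewrite !mxE.
apply: measurable_funB.
  exact: (measurableT_comp (measurable_coord i) measurable_snd).
exact: (measurableT_comp (measurable_coord i) measurable_fst).
Qed.

(** The uniqueness argument for Haar measure. The product measure of [P], the pairs with y in B and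
    x + y in E, is m1 E * m2 B. Shifting y by x turns [P] into [Q], the pairs with y in E and y - x
    in B, whose measure is m2 E * m1 B by the symmetry of B. Since m1 B = m2 B is positive and
    finite, it cancels. *)
Lemma shift_invariant_unique E : measurable E -> m1 E = m2 E.
Proof.
move=> mE.
have indE (T : Type) (P Q : set T) x : \1_(P `&` Q) x = (\1_P x * \1_Q x)%R :> R.
  by rewrite indicI.
have mi (P : set ('rV[R]_n * 'rV[R]_n)) : measurable P ->
    measurable_fun setT (fun p => (\1_P p : R)%:E).
  by move=> mP; apply/measurable_EFinP; exact: measurable_indic.
have mp (f : 'rV[R]_n * 'rV[R]_n -> 'rV[R]_n) A :
    measurable_fun setT f -> measurable A -> measurable (f @^-1` A).
  by move=> mf mA; rewrite -[X in measurable X]setTI; exact: mf.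
pose P := (snd @^-1` B `&` (fun p => p.1 + p.2)%R @^-1` E : set ('rV[R]_n * 'rV[R]_n)).
pose Q := (snd @^-1` E `&` (fun p => p.2 - p.1)%R @^-1` B : set ('rV[R]_n * 'rV[R]_n)).
have mP : measurable P.
  by apply: measurableI; apply: mp => //; exact: measurable_addrV.
have mQ : measurable Q.
  by apply: measurableI; apply: mp => //; exact: measurable_subrV.
have sec1 (m : {sigma_finite_measure set 'rV[R]_n -> \bar R}) (S : set ('rV[R]_n * 'rV[R]_n)) (y : 'rV[R]_n) : measurable S ->
    \int[m]_x (\1_S (x, y) : R)%:E = m (ysection S y).
  move=> mS; have -> : (fun x => (\1_S (x, y) : R)%:E) = (fun x => (\1_(ysection S y) x)%:E).
    by apply/funext => x; rewrite !indicE mem_ysection.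
  by rewrite integral_indic ?setIT//; exact: (measurable_ysection _ mS).
have sec2 (m : {sigma_finite_measure set 'rV[R]_n -> \bar R}) (S : set ('rV[R]_n * 'rV[R]_n)) (y : 'rV[R]_n) : measurable S ->
    \int[m]_x (\1_S (y, x) : R)%:E = m (xsection S y).
  move=> mS; have -> : (fun x => (\1_S (y, x) : R)%:E) = (fun x => (\1_(xsection S y) x)%:E).
    by apply/funext => x; rewrite !indicE mem_xsection.
  by rewrite integral_indic ?setIT//; exact: (measurable_xsection _ mS).
have e1 : \int[m2]_y \int[m1]_x (\1_P (x, y) : R)%:E = m1 E * m2 B.
  transitivity (\int[m2]_y (m1 E * (\1_B y)%:E)).
    apply: eq_integral => y _; rewrite sec1// indicE.
    have [yB|yB] := boolP (y \in B).
      rewrite mule1 -(shift1 y mE); congr (m1 _).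
      apply/seteqP; split => x; rewrite /ysection/P/= inE/=; first by case.
      by split => //; rewrite inE in yB.
    rewrite mule0 (_ : ysection _ _ = set0) ?measure0//.
    by apply/seteqP; split => x //; rewrite /ysection/P/= inE/= => -[]/mem_set; rewrite (negPf yB).
  rewrite ge0_integralZl//.
  - by rewrite integral_indic// setIT.
  - by apply/measurable_EFinP; exact: measurable_indic.
have e2 : \int[m1]_x \int[m2]_y (\1_P (x, y) : R)%:E = \int[m1]_x \int[m2]_y (\1_Q (x, y) : R)%:E.
  apply: eq_integral => x _; rewrite !sec2//.
  have mQx := measurable_xsection x mQ.
  rewrite -(shift2 x mQx); congr (m2 _).
  apply/seteqP; split => y; rewrite /xsection/P/Q/= !inE/= addrK addrC;
   by case=> ? ?; split=> //; rewrite addrC.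
have e3 : \int[m2]_y \int[m1]_x (\1_Q (x, y) : R)%:E = m2 E * m1 B.
  transitivity (\int[m2]_y (m1 B * (\1_E y)%:E)).
    apply: eq_integral => y _; rewrite sec1// indicE.
    have [yB|yB] := boolP (y \in E).
      rewrite mule1 -(shift1 (- y) mB); congr (m1 _).
      apply/seteqP; split => x; rewrite /ysection/Q/= inE/=.
        by case=> _ /symB; rewrite opprB.
      by move=> /symB; rewrite opprB => h; split => //; rewrite inE in yB.
    rewrite mule0 (_ : ysection _ _ = set0) ?measure0//.
    by apply/seteqP; split => x //; rewrite /ysection/Q/= inE/= => -[]/mem_set; rewrite (negPf yB).
  rewrite ge0_integralZl//.
  - by rewrite integral_indic// setIT muleC.
  - by apply/measurable_EFinP; exact: measurable_indic.
have : m1 E * m2 B = m2 E * m2 B.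
  rewrite -e1 -B12 -e3.
  rewrite -(@fubini_tonelli _ _ _ _ _ m1 m2 (fun p => (\1_P p : R)%:E)) ?e2//;
    last exact: mi.
  rewrite (@fubini_tonelli _ _ _ _ _ m1 m2 (fun p => (\1_Q p : R)%:E))//; exact: mi.
have fB : m2 B \is a fin_num by rewrite ge0_fin_numE// ltW.
move=> e; apply/eqP; rewrite eq_le -(lee_pmul2r fB B0) -[X in _ && X](lee_pmul2r fB B0).
by rewrite e lexx.
Qed.

End shift_invariant.

Section lebesgue_isometry.
Context (R : realType).

Lemma dotvN n (x y : 'rV[R]_n) : dotv (- x) (- y) = dotv x y.
Proof. by apply: eq_bigr => i _; rewrite !mxE mulrNN. Qed.

Lemma measurable_box n (r : R) :
  measurable [set x : 'rV[R]_n | forall i, `|x ord0 i| <= r].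
Proof.
have -> : [set x : 'rV[R]_n | forall i, `|x ord0 i| <= r] = \bigcap_(i in [set: 'I_n])
    ((fun x : 'rV[R]_n => x ord0 i) @^-1` `[- r, r]).
  apply/seteqP; split => x /= h i; first by move=> _; rewrite /= in_itv/= -ler_norml.
  by have := h i Logic.I; rewrite /= in_itv/= -ler_norml.
apply: fin_bigcap_measurable => // i _.
by rewrite -[X in measurable X]setTI; exact: measurable_coord.
Qed.

Lemma lebesgue_rV_box_gt0 n (r : R) : 0 < r ->
  (0 < lebesgue_rV [set x : 'rV[R]_n | forall i, `|x ord0 i| <= r]%R)%E.
Proof.
move=> r0; elim: n => [|n IH].
  rewrite /= diracE mem_set ?lte01//= => -[].
  by move=> ? /=.
rewrite /= /pushforward.
have -> : @cons_rV R n @^-1` [set x | forall i, `|x ord0 i| <= r] =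
    `[- r, r]%classic `*` [set x : 'rV[R]_n | forall i, `|x ord0 i| <= r].
  apply/seteqP; split => -[x v] /= h.
    split; first by have := h ord0; rewrite cons_rV0 /= in_itv/= -ler_norml.
    by move=> i; have := h (lift ord0 i); rewrite cons_rVS.
  case: h; rewrite /= in_itv/= -ler_norml => hx hv i.
  by have [j ->|->] := unliftP ord0 i; rewrite ?cons_rVS ?cons_rV0.
have := @product_measure1E _ _ (measurableTypeR R) 'rV[R]_n R (@lebesgue_measure R) (@lebesgue_rV R n)
  `[- r, r]%classic _ (measurable_itv _) (measurable_box r).
move=> /= ->; rewrite mule_gt0//.
by rewrite lebesgue_measure_itv/= lte_fin gt0_cp// -EFinB lte_fin; lra.
Qed.

Lemma unit_ball_sub_cube n : @unit_ball R n `<=` [set x | forall i, `|x ord0 i| <= 1].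
Proof.
move=> x x1 i /=; rewrite -sqrtr_sqr (le_trans _ x1)// ler_wsqrtr//.
rewrite expr2 /dotv (bigD1 i)//= lerDl sumr_ge0// => j _; exact: sqr_ge0.
Qed.

Lemma lebesgue_unit_ball_lty n : (lebesgue_rV (@unit_ball R n) < +oo)%E.
Proof.
apply: le_lt_trans (lebesgue_rV_cube R n).
apply: le_measure; rewrite ?inE; last exact: unit_ball_sub_cube.
- exact: measurable_unit_ball.
- exact: measurable_cube.
Qed.

(** The n squared coordinates are each at most 1 / (n + 1), so their sum is below 1; n + 1 instead
    of n keeps the box defined in dimension 0. *)
Lemma box_sub_unit_ball n :
  [set x : 'rV[R]_n | forall i, `|x ord0 i| <= n.+1%:R^-1] `<=` @unit_ball R n.
Proof.
move=> x h; rewrite /unit_ball/= /enorm -sqrtr1 ler_wsqrtr//.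
apply: (@le_trans _ _ (\sum_(i < n) n.+1%:R^-1 )).
  apply: ler_sum => i _; rewrite -expr2 -real_normK ?num_real// expr2.
  rewrite -[leRHS]mulr1 ler_pM// (le_trans (h i))// invf_le1// ler1n//.
rewrite sumr_const card_ord -[leLHS]mulr_natl ler_pdivrMr// mul1r ler_nat//.
Qed.

Lemma lebesgue_unit_ball_gt0 n : (0 < lebesgue_rV (@unit_ball R n))%E.
Proof.
have r0 : 0 < n.+1%:R^-1 :> R by rewrite invr_gt0.
apply: lt_le_trans (lebesgue_rV_box_gt0 n r0) _.
apply: le_measure; rewrite ?inE; last exact: box_sub_unit_ball.
- exact: measurable_box.
- exact: measurable_unit_ball.
Qed.

(** Additivity of f makes the pushforward translation-invariant, and f preserves the unit ball;
    uniqueness then applies with the unit ball as the set of common, positive and finite measure. *)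
Lemma lebesgue_rV_isometry n (f g : 'rV[R]_n -> 'rV[R]_n) A :
  measurable_fun setT f -> measurable_fun setT g ->
  {morph f : x y / x + y} -> cancel f g -> cancel g f ->
  (forall x, enorm (f x) = enorm x) -> measurable A ->
  lebesgue_rV (f @^-1` A) = lebesgue_rV A.
Proof.
move=> mf mg fD fK gK fe mA.
have mfp B : measurable B -> measurable (f @^-1` B).
  by move=> mB; rewrite -[X in measurable X]setTI; exact: mf.
pose M : {measure set 'rV[R]_n -> \bar R} := pushforward (@lebesgue_rV R n) f.
have fball k : f @^-1` [set x | enorm x <= k] = [set x | enorm x <= k].
  by apply/seteqP; split => x /=; rewrite fe.
have [F FT Foo] := sigma_finiteT (@lebesgue_rV R n).
have sM : sigma_finite setT (M mf).
  exists (fun i => g @^-1` F i); first by rewrite -preimage_bigcup -FT preimage_setT.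
  move=> i; have [mF Fi] := Foo i; split.
    by rewrite -[X in measurable X]setTI; exact: mg.
  rewrite /M/= /pushforward -comp_preimage (_ : g \o f = id) //.
  by apply/funext => x /=; rewrite fK.
have [m' m'E] := measure_sigma_finite_ex sM.
have -> : lebesgue_rV (f @^-1` A) = m' A by rewrite -m'E.
apply: (@shift_invariant_unique R n m' (@lebesgue_rV R n) _ _ (@unit_ball R n)) => //.
- move=> a B mB; rewrite -m'E /M/= /pushforward.
  rewrite -[RHS](lebesgue_rV_shift (g a)); last exact: mfp.
  by congr lebesgue_rV; apply/seteqP; split => x; rewrite /preimage/= fD gK.
- exact: lebesgue_rV_shift.
- exact: measurable_unit_ball.
- by move=> x; rewrite /unit_ball/= /enorm dotvN.
- by rewrite -m'E /M/= /pushforward fball.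
- exact: lebesgue_unit_ball_gt0.
- exact: lebesgue_unit_ball_lty.
Qed.

End lebesgue_isometry.

Section borel_rV.
Context (R : realType).

(** Every open set is the union of the boxes with rational centre and half-width 1 / (k + 1) that it
    contains; [pickle] enumerates these countably many boxes. *)
Lemma open_measurable_rV n (A : set 'rV[R]_n) : open A -> measurable A.
Proof.
move=> oA.
pose box (p : 'rV[rat]_n * nat) := (fun x : 'rV[R]_n => x + - map_mx ratr p.1) @^-1`
  [set x : 'rV[R]_n | forall i, `|x ord0 i| <= p.2.+1%:R^-1].
pose F (k : nat) := if unpickle k is Some p then if `[< box p `<=` A >] then box p else set0
  else set0.
suff -> : A = \bigcup_k F k.
  apply: bigcupT_measurable => k; rewrite /F; case: unpickle => // p; case: ifP => // _.
  rewrite -[X in measurable X]setTI; apply: measurable_shift => //; exact: measurable_box.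
apply/seteqP; split => x; last first.
  by move=> [k _]; rewrite /F; case: unpickle => // p; case: asboolP => // pA; exact: pA.
move=> Ax; have : nbhs x A by exact: open_nbhs_nbhs.
move=> /nbhs_ballP[e /= e0 xe].
(* Two points of a box of half-width 1 / (k + 1) are at sup-distance at most 2 / (k + 1), so the box
   around x stays in the ball of radius e. *)
have [k ke] : exists k : nat, 2 * k.+1%:R^-1 < e.
  have [k /= _ hk] := (near_infty_natSinv_lt (PosNum (divr_gt0 e0 (ltr0n R 2)))).
  exists k; have /= := hk k (leqnn k); rewrite ltr_pdivlMr// mulrC; exact.
have k0 : 0 < k.+1%:R^-1 :> R by rewrite invr_gt0.
have /choice[q hq] : forall i : 'I_n, exists q : rat, `|x ord0 i - ratr q| <= k.+1%:R^-1.
  move=> i; have : x ord0 i - k.+1%:R^-1 < x ord0 i + k.+1%:R^-1.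
    by rewrite ltrBlDr -addrA ltrDl addr_gt0.
  move=> /rat_in_itvoo[q]; rewrite inE/= => /andP[h1 h2].
  by exists q; rewrite ler_distlC (ltW h1) (ltW h2).
exists (pickle (\row_i q i, k)) => //; rewrite /F pickleK.
have xb : box (\row_i q i, k) x by move=> i /=; rewrite !mxE.
rewrite asboolT// => y yb; apply: xe; split => // i j.
rewrite (ord1 i); have := yb j; have := xb j; rewrite /= !mxE => h1 h2.
rewrite /ball/= (_ : _ - _ = (x ord0 j - ratr (q j)) - (y ord0 j - ratr (q j))); last by ring.
apply: le_lt_trans (ler_normB _ _) _; apply: le_lt_trans (lerD h1 h2) _.
by rewrite -mulr2n -[X in X < _]mulr_natl.
Qed.

Lemma continuous_neq0_measurable n (F : 'rV[R]_n -> R) :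
  (forall x, x != 0 -> {for x, continuous F}) ->
  measurable_fun [set x : 'rV[R]_n | x != 0] F.
Proof.
move=> cF; apply: (measurability _ (RGenOpens.measurableE R)) => _ /= [_ [a [b ->]] <-].
apply: open_measurable_rV.
rewrite openE => x [/= x0 Fx].
apply: filterI.
  apply: open_nbhs_nbhs; split => //.
  have -> : [set x : 'rV[R]_n | x != 0] = ~` [set 0].
    by apply/seteqP; split => y /= /eqP.
  by apply: closed_openC; apply: accessible_closed_set1; apply: hausdorff_accessible; exact: norm_hausdorff.
by apply: (cF x x0); apply: open_nbhs_nbhs; split.
Qed.

End borel_rV.

(** * Inner product, unit sphere and radial projection *)

Section dotv_theory.
Context (R : realType) (d : nat).
Implicit Types x y z : 'rV[R]_d.

Lemma dotvE x y : dotv x y = (x *m y^T) ord0 ord0.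
Proof. by rewrite mxE; apply: eq_bigr => i _; rewrite mxE. Qed.

Lemma dotvC x y : dotv x y = dotv y x.
Proof. by apply: eq_bigr => i _; rewrite mulrC. Qed.

Lemma dotvDl x y z : dotv (x + y) z = dotv x z + dotv y z.
Proof. by rewrite /dotv -big_split/=; apply: eq_bigr => i _; rewrite mxE mulrDl. Qed.

Lemma dotvDr x y z : dotv z (x + y) = dotv z x + dotv z y.
Proof. by rewrite dotvC dotvDl !(dotvC z). Qed.

Lemma dotvZl a x y : dotv (a *: x) y = a * dotv x y.
Proof. by rewrite /dotv mulr_sumr; apply: eq_bigr => i _; rewrite mxE mulrA. Qed.

Lemma dotvZr a x y : dotv x (a *: y) = a * dotv x y.
Proof. by rewrite dotvC dotvZl dotvC. Qed.

Lemma dotvNl x y : dotv (- x) y = - dotv x y.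
Proof. by rewrite -scaleN1r dotvZl mulN1r. Qed.

Lemma dotvNr x y : dotv x (- y) = - dotv x y.
Proof. by rewrite dotvC dotvNl dotvC. Qed.

Lemma dotv0l x : dotv 0 x = 0.
Proof. by rewrite -(scale0r 0) dotvZl mul0r. Qed.

Lemma dotv_ge0 x : 0 <= dotv x x.
Proof. by apply: sumr_ge0 => i _; rewrite -expr2 sqr_ge0. Qed.

Lemma dotv_eq0 x : (dotv x x == 0) = (x == 0).
Proof.
apply/eqP/eqP => [/psumr_eq0P h|->]; last exact: dotv0l.
apply/rowP => i; rewrite mxE.
have /eqP := h (fun i _ => sqr_ge0 (x ord0 i)) i isT.
by rewrite mulf_eq0 orbb => /eqP.
Qed.

Lemma sphereP x : sphere R d x <-> dotv x x = 1.
Proof.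
rewrite /sphere/= /enorm; split => [h|->]; last exact: sqrtr1.
by rewrite -(sqr_sqrtr (dotv_ge0 x)) h expr1n.
Qed.

Lemma enorm_eq0 x : (enorm x == 0) = (x == 0).
Proof. by rewrite /enorm sqrtr_eq0 -dotv_eq0 eq_le dotv_ge0 andbT. Qed.

Lemma sqr_enorm x : enorm x ^+ 2 = dotv x x.
Proof. by rewrite sqr_sqrtr ?dotv_ge0. Qed.

Lemma sphere_neq0 x : sphere R d x -> x != 0.
Proof.
move=> /sphereP h; rewrite -dotv_eq0 h; exact: oner_neq0.
Qed.

Lemma sproj_sphere x : x != 0 -> sphere R d (sproj x).
Proof.
move=> x0; apply/sphereP; rewrite dotvZl dotvZr -sqr_enorm expr2.
by field; rewrite enorm_eq0.
Qed.

Lemma sproj_id x : sphere R d x -> sproj x = x.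
Proof. by rewrite /sphere /sproj/= => ->; rewrite invr1 scale1r. Qed.

Lemma enormZ a x : enorm (a *: x) = `|a| * enorm x.
Proof. by rewrite /enorm dotvZl dotvZr mulrA -expr2 sqrtrM ?sqr_ge0// sqrtr_sqr. Qed.

Lemma sprojZ a x : 0 < a -> sproj (a *: x) = sproj x.
Proof.
move=> a0; by rewrite /sproj enormZ gtr0_norm// scalerA invfM mulrAC mulVf ?mul1r ?gt_eqF.
Qed.

Lemma sprojN x : sproj (- x) = - sproj x.
Proof. by rewrite /sproj /enorm dotvN scalerN. Qed.

Lemma cauchy_schwarz x y : dotv x y ^+ 2 <= dotv x x * dotv y y.
Proof.
have [->|x0] := eqVneq x 0; first by rewrite !dotv0l expr0n mul0r.
have xx : 0 < dotv x x by rewrite lt0r dotv_eq0 x0 dotv_ge0.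
have := dotv_ge0 (dotv x x *: y - dotv x y *: x).
rewrite dotvDl !dotvDr !dotvNl !dotvNr !dotvZl !dotvZr (dotvC y x).
set a := dotv x x in xx *; set b := dotv x y; set c := dotv y y.
rewrite (_ : _ + _ = a * (a * c - b ^+ 2)); last by ring.
by rewrite pmulr_rge0// subr_ge0.
Qed.

Lemma sphere_dotv_le1 x y : sphere R d x -> sphere R d y -> dotv x y ^+ 2 <= 1.
Proof.
by move=> /sphereP hx /sphereP hy; have := cauchy_schwarz x y; rewrite hx hy mulr1.
Qed.

Lemma sphereN x : sphere R d x -> sphere R d (- x).
Proof. by rewrite !sphereP dotvN. Qed.

Lemma measurable_sphere : measurable (sphere R d).
Proof.
have -> : sphere R d = @enorm R d @^-1` [set 1] by [].
rewrite -[X in measurable X]setTI; apply: measurable_enorm => //; exact: measurable_set1.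
Qed.

Lemma measurable_dotv e (T : measurableType e) (D : set T) (f g : T -> 'rV[R]_d) :
  (forall i, measurable_fun D (fun t => f t ord0 i)) ->
  (forall i, measurable_fun D (fun t => g t ord0 i)) ->
  measurable_fun D (fun t => dotv (f t) (g t)).
Proof.
move=> mf mg; apply: measurable_sum => i; exact: measurable_funM.
Qed.

End dotv_theory.

(** * Change of variables under measure-preserving maps and isometries *)

Section invariant_integral.
Context d (T : measurableType d) (R : realType) (mu : {measure set T -> \bar R}).
Context (f : T -> T) (D : set T).
Hypothesis mf : measurable_fun setT f.
Hypothesis muf : forall A, measurable A -> mu (f @^-1` A) = mu A.
Hypothesis mD : measurable D.
Hypothesis fD : f @^-1` D = D.
Local Open Scope ereal_scope.

Lemma ge0_invariant_integral (F : T -> \bar R) :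
  measurable_fun D F -> (forall x, D x -> 0 <= F x) ->
  \int[mu]_(x in D) F (f x) = \int[mu]_(x in D) F x.
Proof.
move=> mF F0.
have := @ge0_integral_pushforward _ _ _ _ R _ mf mu _ F mD mF.
rewrite fD => <-; last by move=> x; rewrite inE; exact: F0.
pose M : {measure set T -> \bar R} := pushforward mu f.
apply: (@eq_measure_integral _ _ _ _ mu (M mf)) => X mX _.
exact: muf.
Qed.

Lemma invariant_integral (F : T -> \bar R) : measurable_fun D F ->
  \int[mu]_(x in D) F (f x) = \int[mu]_(x in D) F x.
Proof.
move=> mF; rewrite integralE [RHS]integralE.
congr (_ - _).
  transitivity (\int[mu]_(x in D) F^\+ (f x)).
    by apply: eq_integral => x _; rewrite ?funeposE.
  by apply: ge0_invariant_integral => //; exact: measurable_funepos.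
transitivity (\int[mu]_(x in D) F^\- (f x)).
  by apply: eq_integral => x _; rewrite ?funenegE.
by apply: ge0_invariant_integral => //; exact: measurable_funeneg.
Qed.

End invariant_integral.

Section isometry.
Context (R : realType) (d : nat).
Implicit Types (x y : 'rV[R]_d) (f : 'rV[R]_d -> 'rV[R]_d).

Definition isometry f := linear f /\ forall x y, dotv (f x) (f y) = dotv x y.

Lemma mulmx_isometry (A : 'M[R]_d) : A *m A^T = 1%:M -> isometry (mulmx^~ A).
Proof.
move=> AA; split=> [a x y|x y]; first by rewrite mulmxDl scalemxAl.
by rewrite !dotvE trmx_mul mulmxA -(mulmxA x) AA mulmx1.
Qed.

Lemma isometryD f : isometry f -> {morph f : x y / x + y}.
Proof. by move=> [fl _] x y; have := fl 1 x y; rewrite !scale1r. Qed.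

Lemma isometry0 f : isometry f -> f 0 = 0.
Proof.
by move=> fi; apply: (addrI (f 0)); rewrite -isometryD// !addr0.
Qed.

Lemma isometryZ f a x : isometry f -> f (a *: x) = a *: f x.
Proof. by move=> fi; have := fi.1 a x 0; rewrite !addr0 isometry0// addr0. Qed.

Lemma isometryN f x : isometry f -> f (- x) = - f x.
Proof. by move=> fi; rewrite -scaleN1r isometryZ// scaleN1r. Qed.

Lemma isometry_enorm f x : isometry f -> enorm (f x) = enorm x.
Proof. by rewrite /enorm => -[_ ->]. Qed.

Lemma isometry_sproj f x : isometry f -> sproj (f x) = f (sproj x).
Proof. by move=> fi; rewrite /sproj isometry_enorm// isometryZ. Qed.

Lemma isometry_sphere f x : isometry f -> sphere R d (f x) <-> sphere R d x.
Proof. by move=> fi; rewrite /sphere/= isometry_enorm. Qed.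

Lemma isometry_mx f : isometry f ->
  exists A : 'M[R]_d, A *m A^T = 1%:M /\ f = mulmx^~ A.
Proof.
move=> [fl fi]; pose A : 'M[R]_d := \matrix_i f (delta_mx 0 i).
exists A; split.
  apply/matrixP => i j; rewrite !mxE.
  transitivity (dotv (f (delta_mx 0 i)) (f (delta_mx 0 j))).
    by apply: eq_bigr => k _; rewrite !mxE.
  rewrite fi /dotv (bigD1 i)//= big1 ?addr0.
    by rewrite !mxE !eqxx/= mul1r eq_sym.
  by move=> k ki; rewrite !mxE (negPf ki) mul0r.
apply/funext => x; rewrite [in LHS](row_sum_delta x).
have fsum (I : Type) (s : seq I) (F : I -> 'rV[R]_d) : f (\sum_(i <- s) F i) = \sum_(i <- s) f (F i).
  by apply: big_morph; [exact: isometryD|exact: isometry0].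
rewrite fsum mulmx_sum_row; apply: eq_bigr => i _.
by rewrite isometryZ// rowK.
Qed.

Lemma measurable_mulmx (A : 'M[R]_d) :
  measurable_fun setT (fun x : 'rV[R]_d => x *m A).
Proof.
apply/measurable_fun_rVP => i; under eq_fun do rewrite mxE.
apply: measurable_sum => j; apply: measurable_funM; first exact: measurable_coord.
exact: measurable_cst.
Qed.

Lemma measurable_isometry f : isometry f -> measurable_fun setT f.
Proof. by move=> /isometry_mx[A [_ ->]]; exact: measurable_mulmx. Qed.

Lemma isometry_inv f : isometry f -> exists g, [/\ isometry g, cancel f g & cancel g f].
Proof.
move=> /isometry_mx[A [AA ->]]; have AA' := mulmx1C AA.
exists (mulmx^~ A^T); split.
- by apply: mulmx_isometry; rewrite trmxK.
- by move=> x; rewrite -mulmxA AA mulmx1.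
- by move=> x; rewrite -mulmxA AA' mulmx1.
Qed.

Lemma lebesgue_isometry f (A : set 'rV[R]_d) : isometry f -> measurable A ->
  lebesgue_rV (f @^-1` A) = lebesgue_rV A.
Proof.
move=> fi; have [g [gi fK gK]] := isometry_inv fi.
apply: (@lebesgue_rV_isometry _ _ f g) => //.
- exact: measurable_isometry.
- exact: measurable_isometry.
- exact: isometryD.
- by move=> x; exact: isometry_enorm.
Qed.

Lemma surface_isometry f (A : set 'rV[R]_d) : isometry f -> measurable A ->
  surface_measure (f @^-1` A) = surface_measure A.
Proof.
move=> fi mA; rewrite /surface_measure; congr (_ * _)%E.
have mB : measurable (@sproj R d @^-1` A `&` @unit_ball R d).
  apply: measurableI; last exact: measurable_unit_ball.
  by rewrite -[X in measurable X]setTI; exact: measurable_sproj.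
rewrite -(lebesgue_isometry fi mB); congr lebesgue_rV.
by apply/seteqP; split => x; rewrite /unit_ball/= isometry_sproj// isometry_enorm.
Qed.

Local Open Scope ereal_scope.

Lemma surface_integral_isometry_on (D : set 'rV[R]_d) f (F : 'rV[R]_d -> \bar R) :
  isometry f -> measurable D -> f @^-1` D = D -> measurable_fun D F ->
  \int[surface_measure]_(x in D) F (f x) = \int[surface_measure]_(x in D) F x.
Proof.
move=> fi mD fD mF; apply: invariant_integral => //; first exact: measurable_isometry.
by move=> A mA; exact: surface_isometry.
Qed.

Lemma isometry_preimage_sphere f : isometry f -> f @^-1` sphere R d = sphere R d.
Proof. by move=> fi; apply/seteqP; split => x /(isometry_sphere x fi). Qed.

Lemma ge0_surface_integral_isometry f (F : 'rV[R]_d -> \bar R) :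
  isometry f -> measurable_fun (sphere R d) F ->
  (forall x, sphere R d x -> 0 <= F x) ->
  \int[surface_measure]_(x in sphere R d) F (f x) =
  \int[surface_measure]_(x in sphere R d) F x.
Proof.
move=> fi mF F0; apply: ge0_invariant_integral => //.
- exact: measurable_isometry.
- by move=> A mA; exact: surface_isometry.
- exact: measurable_sphere.
- exact: isometry_preimage_sphere.
Qed.

Lemma surface_integral_isometry f (F : 'rV[R]_d -> \bar R) :
  isometry f -> measurable_fun (sphere R d) F ->
  \int[surface_measure]_(x in sphere R d) F (f x) =
  \int[surface_measure]_(x in sphere R d) F x.
Proof.
move=> fi; apply: surface_integral_isometry_on => //; first exact: measurable_sphere.
exact: isometry_preimage_sphere.
Qed.

End isometry.

Section special_isometries.
Context (R : realType) (d : nat).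
Implicit Types (x y s a v : 'rV[R]_d).

(** The reflection in the hyperplane orthogonal to a. For a = 0 it is the identity, so
    [reflection (x - y)] exchanges vectors of equal norm even when x = y. *)
Definition reflection a x := x - (2 * dotv x a / dotv a a) *: a.

Lemma reflection_isometry a : isometry (reflection a).
Proof.
split=> [k x y|x y].
  rewrite /reflection dotvDl dotvZl scalerBr addrACA -opprD scalerA -scalerDl.
  by congr (_ - _ *: _); ring.
rewrite /reflection; have [->|a0] := eqVneq a 0; first by rewrite !scaler0 !subr0.
rewrite !dotvDl !dotvDr !dotvNl !dotvNr !dotvZl !dotvZr (dotvC a y).
by field; rewrite dotv_eq0.
Qed.

Lemma reflection_swap x y : dotv x x = dotv y y -> reflection (x - y) x = y.
Proof.
move=> xy; rewrite /reflection; have [/subr0_eq->|a0] := eqVneq (x - y) 0.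
  by rewrite subrr scaler0 subr0.
rewrite (_ : 2 * _ / _ = 1) ?scale1r ?subKr//.
rewrite (_ : 2 * dotv x (x - y) = dotv (x - y) (x - y)) ?divff ?dotv_eq0//.
rewrite !dotvDl !dotvDr !dotvNl !dotvNr (dotvC y x) -xy; ring.
Qed.

Lemma reflection_id a x : dotv x a = 0 -> reflection a x = x.
Proof. by move=> xa; rewrite /reflection xa mulr0 mul0r scale0r subr0. Qed.

Definition half_turn s x := (2 * dotv x s) *: s - x.

Lemma half_turn_isometry s : dotv s s = 1 -> isometry (half_turn s).
Proof.
move=> ss; split=> [k x y|x y]; rewrite /half_turn.
  by apply/rowP => i; rewrite !mxE dotvDl dotvZl; ring.
rewrite !dotvDl !dotvDr !dotvNl !dotvNr !dotvZl !dotvZr (dotvC s y) ss; ring.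
Qed.

Lemma dotv_half_turn s x : dotv s s = 1 -> dotv (half_turn s x) s = dotv x s.
Proof. by move=> ss; rewrite /half_turn dotvDl dotvNl dotvZl ss; ring. Qed.

Lemma isometry_half_turn f s x : isometry f -> half_turn (f s) (f x) = f (half_turn s x).
Proof.
by move=> fi; rewrite /half_turn (isometryD fi) (isometryN x fi) (isometryZ _ _ fi) fi.2.
Qed.

(* For c^2 + w^2 = 1, the rotation with cosine c and sine w in the oriented
   plane of the orthonormal vectors s, v. *)
Definition rotation s v (c w : R) x :=
  x + ((c - 1) * dotv x s - w * dotv x v) *: s
    + (w * dotv x s + (c - 1) * dotv x v) *: v.

Lemma rotation_isometry s v c w : dotv s s = 1 -> dotv v v = 1 -> dotv s v = 0 ->
  c ^+ 2 + w ^+ 2 = 1 -> isometry (rotation s v c w).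
Proof.
move=> ss vv sv cw; split=> [k x y|x y]; rewrite /rotation.
  apply/rowP => i; rewrite !mxE !dotvDl !dotvZl; ring.
rewrite !dotvDl !dotvDr !dotvZl !dotvZr (dotvC s y) (dotvC v y) (dotvC v s) ss vv sv.
set xs := dotv x s; set xv := dotv x v; set ys := dotv y s; set yv := dotv y v.
(* The two sides differ by exactly this multiple of c^2 + w^2 - 1. *)
have e0 : (xs * ys + xv * yv) * (c ^+ 2 + w ^+ 2 - 1) = 0 by rewrite cw subrr mulr0.
rewrite -[RHS]addr0 -[X in _ = _ + X]e0; ring.
Qed.

End special_isometries.

(** * Smooth functions off the origin *)

Lemma cvg_sumr (R : realType) (T : Type) (F : set_system T) (I : Type)
    (s : seq I) (f : I -> T -> R) (l : I -> R) {FF : Filter F} :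
  (forall i, f i x @[x --> F] --> l i) ->
  \sum_(i <- s) f i x @[x --> F] --> \sum_(i <- s) l i.
Proof.
move=> fl; elim: s => [|i s IH].
  by rewrite big_nil; under eq_fun do rewrite big_nil; exact: cvg_cst.
rewrite big_cons; under eq_fun do rewrite big_cons.
by apply: cvgD.
Qed.

Lemma differentiable_estimate (R : realType) (V W : normedModType R) (f : V -> W)
    (L : {linear V -> W}) x : continuous L ->
  (forall e : R, 0 < e -> \forall h \near (0 : V), `|f (h + x) - f x - L h| <= e * `|h|) ->
  differentiable f x /\ 'd f x = L :> (V -> W).
Proof.
move=> cL est.
have exp : f \o shift x = cst (f x) + (L : _ -> _) +o_ 0 id.
  apply/eqaddoP => e e0 /=; have := est e e0; apply: filterS => h.
  by rewrite -[(_ - _) h]/(f (h + x) - (f x + L h)) opprD addrA.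
have dE : 'd f x = L :> (_ -> _) by exact: diff_unique.
by split => //; apply/diff_locallyP; rewrite dE.
Qed.

Section chain_rule.
Context (R : realType) (d : nat).
Implicit Types (F : 'rV[R]_d -> R) (x y v : 'rV[R]_d).
Local Notation e_ i := (delta_mx (0 : 'I_1) i : 'rV[R]_d).

Lemma is_derive_line F x v (t : R) : derivable F (x + t *: v) v ->
  is_derive t 1 (fun u : R => F (x + u *: v)) ('D_v F (x + t *: v)).
Proof.
move=> dF.
have E : (fun h : R => h^-1 *: (((fun u : R => F (x + u *: v)) \o shift t) (h *: 1) - F (x + t *: v)))
   = (fun h : R => h^-1 *: ((F \o shift (x + t *: v)) (h *: v) - F (x + t *: v))).
  apply/funext => h /=; congr (_ *: (F _ - _)).
  by rewrite [_%:A]mulr1 scalerDl addrCA.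
by split; rewrite /derivable /derive E.
Qed.

Lemma axis_MVT F x i (a : R) :
  (forall u : R, `|u| <= `|a| -> derivable F (x + u *: e_ i) (e_ i)) ->
  exists u : R, `|u| <= `|a| /\
    F (x + a *: e_ i) - F x = a * 'D_(e_ i) F (x + u *: e_ i).
Proof.
move=> dF; pose f (u : R) := F (x + u *: e_ i).
have df (u : R) : `|u| <= `|a| -> is_derive u 1 f ('D_(e_ i) F (x + u *: e_ i)).
  by move=> /dF; exact: is_derive_line.
have f0 : f 0 = F x by rewrite /f scale0r addr0.
rewrite -f0 -[F _]/(f a).
have [a0|a0] := leP 0 a.
  have dom (u : R) : u \in `[0, a] -> `|u| <= `|a|.
    by rewrite in_itv/= => /andP[u0 ua]; rewrite !ger0_norm.
  have [||c ca ->] := @MVT_segment R f (fun u : R => 'D_(e_ i) F (x + u *: e_ i)) 0 a a0.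
  - by move=> u ua; apply/df/dom/subset_itv_oo_cc.
  - apply: derivable_within_continuous => u /dom ua; exact: (df u ua).(ex_derive).
  - by exists c; rewrite subr0 mulrC; split => //; exact: dom.
have dom (u : R) : u \in `[a, 0] -> `|u| <= `|a|.
  by rewrite in_itv/= => /andP[au u0]; rewrite !ler0_norm ?(ltW a0)// lerN2.
have [||c ca E] := @MVT_segment R f (fun u : R => 'D_(e_ i) F (x + u *: e_ i)) a 0 (ltW a0).
- by move=> u ua; apply/df/dom/subset_itv_oo_cc.
- apply: derivable_within_continuous => u /dom ua; exact: (df u ua).(ex_derive).
- exists c; split; first exact: dom.
  by rewrite -[LHS]opprB E sub0r mulrN opprK mulrC.
Qed.

(** The increment from x to x + h is made one coordinate at a time through the partial vectors
    [P k]; the mean value theorem on each axis-parallel step compares it with the partial derivative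
    at x. *)
Lemma C1_estimate F x : (\forall y \near x, forall i, derivable F y (e_ i)) ->
  (forall i, {for x, continuous ('D_(e_ i) F)}) ->
  forall e : R, 0 < e -> \forall h \near (0 : 'rV[R]_d),
    `|F (h + x) - F x - \sum_i h ord0 i * 'D_(e_ i) F x| <= e * `|h|.
Proof.
move=> dF cD e e0.
(* The d steps each contribute an error of at most e' |h|; d + 1 avoids a division by 0. *)
pose e' := e / d.+1%:R.
have e'0 : 0 < e' by rewrite divr_gt0.
have : \forall y \near x, forall i, derivable F y (e_ i) /\ `|'D_(e_ i) F x - 'D_(e_ i) F y| <= e'.
  have h2 : \forall y \near x, forall i, `|'D_(e_ i) F x - 'D_(e_ i) F y| <= e'.
    have := @filter_forall _ _ (fun (i : 'I_d) (y : 'rV[R]_d) => `|'D_(e_ i) F x - 'D_(e_ i) F y| <= e') (nbhs x) (nbhs_filter x); apply => i.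
    by have /cvgrPdist_le/(_ _ e'0) := cD i.
  by apply: filterS2 dF h2 => y h1 h2 i; split.
move=> /nbhs_ballP[r /= r0 xr].
apply/nbhs_ballP; exists r => //= h; rewrite -ball_normE/= sub0r normrN => hr.
pose P (k : nat) : 'rV[R]_d := \row_i (if (i < k)%N then h ord0 i else 0).
have coordh i : `|h ord0 i| <= `|h|.
  rewrite [leRHS]/Num.Def.normr/= mx_normrE.
  by apply: le_trans; last exact: (le_bigmax _ _ (ord0, i)).
have near_x y : (forall i, `|y ord0 i| <= `|h|) -> ball x r (x + y).
  move=> yh; rewrite -ball_normE/= opprD addrA subrr sub0r normrN.
  apply: le_lt_trans hr; rewrite [leLHS]/Num.Def.normr/= mx_normrE.
  apply: bigmax_le => // -[i j] _ /=; rewrite (ord1 i); exact: yh.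
have P0 : P 0%N = 0 by apply/rowP => i; rewrite !mxE.
have Pd : P d = h by apply/rowP => i; rewrite !mxE ltn_ord.
have PS (i : 'I_d) : P i.+1 = P i + h ord0 i *: e_ i.
  apply/rowP => j; rewrite !mxE eqxx/= ltnS leq_eqVlt.
  have [/val_inj ->|ji] := eqVneq (j : nat) i; first by rewrite eqxx ltnn mulr1 add0r.
  by rewrite (_ : j == i = false) ?mulr0 ?addr0//; apply: contra_neqF ji => /eqP ->.
have step (i : 'I_d) : `|F (x + P i.+1) - F (x + P i) - h ord0 i * 'D_(e_ i) F x| <= e' * `|h|.
  have nx (u : R) : `|u| <= `|h ord0 i| -> ball x r (x + P i + u *: e_ i).
    move=> uh; rewrite -addrA; apply: near_x => j; rewrite !mxE eqxx/=.
    case: ifPn => [ji|ji].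
      rewrite (_ : j == i = false) ?mulr0 ?addr0//.
      by apply/eqP => jiE; move: ji; rewrite jiE ltnn.
    case: eqP => _; rewrite ?mulr0 ?mulr1 ?add0r ?normr0//.
    by apply: le_trans uh _.
  have [u uh|u [uh E]] := @axis_MVT F (x + P i) i (h ord0 i).
    by have [] := xr _ (nx u uh) i.
  rewrite PS addrA E -mulrBr normrM mulrC ler_pM//.
  by have [_] := xr _ (nx u uh) i; rewrite distrC.
have tele : F (h + x) - F x = \sum_(i < d) (F (x + P i.+1) - F (x + P i)).
  rewrite -(big_mkord xpredT (fun i => F (x + P i.+1) - F (x + P i))).
  by rewrite (telescope_sumr (fun i => F (x + P i)))// P0 Pd addr0 (addrC h).
rewrite tele -sumrB; apply: le_trans (ler_norm_sum _ _ _) _.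
apply: le_trans (ler_sum _ (fun i _ => step i)) _.
rewrite sumr_const card_ord -[leLHS]mulr_natl mulrA ler_wpM2r//.
by rewrite /e' mulrA ler_pdivrMr// mulrC ler_wpM2l ?ltW// ltr_nat.
Qed.

Lemma C1_differentiable F x : (\forall y \near x, forall i, derivable F y (e_ i)) ->
  (forall i, {for x, continuous ('D_(e_ i) F)}) ->
  differentiable F x /\
  forall v, 'd F x v = \sum_i v ord0 i * 'D_(e_ i) F x.
Proof.
move=> dF cD.
pose L (h : 'rV[R]_d) : R := \sum_i h ord0 i * 'D_(e_ i) F x.
have lin : linear L.
  move=> a h k; rewrite /L scaler_sumr -big_split/=; apply: eq_bigr => i _.
  by rewrite !mxE mulrDl -mulrA.
pose linM := GRing.isLinear.Build _ _ _ _ _ lin.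
pose linL : {linear _ -> _} := HB.pack L linM.
have cL : continuous linL.
  move=> h; apply: (@cvg_sumr R _ (nbhs h) _ _ (fun i (x : 'rV[R]_d) => _) _ (nbhs_filter h)) => i.
  by apply: cvgM; [exact: coord_continuous|exact: cvg_cst].
have [|? dE] := @differentiable_estimate R _ _ F linL x cL; last by split => // v; rewrite dE.
exact: C1_estimate.
Qed.

Lemma is_derive_comp_curve F (c : R -> 'rV[R]_d) (c' : 'rV[R]_d) (t : R) :
  (\forall y \near c t, forall i, derivable F y (e_ i)) ->
  (forall i, {for c t, continuous ('D_(e_ i) F)}) ->
  (forall i, is_derive t 1 (fun u => c u ord0 i) (c' ord0 i)) ->
  is_derive t 1 (F \o c) (\sum_i c' ord0 i * 'D_(e_ i) F (c t)).
Proof.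
move=> dF cD dc; have [difF dE] := C1_differentiable dF cD.
have dct : derivable c t 1 by apply/derivable_mxP => i j; rewrite (ord1 i).
have difc : differentiable c t by apply/derivable1_diffP.
split; first by apply/derivable1_diffP; exact: differentiable_comp.
rewrite deriveE; last exact: differentiable_comp.
rewrite diff_comp//= dE -(deriveE _ difc) derive_mx//; apply: eq_bigr => i _.
by rewrite !mxE (@derive_val _ _ _ _ _ _ _ (dc i)).
Qed.

End chain_rule.

Section smooth_away_from_0.
Context (R : realType) (d : nat).
Implicit Types (F G : 'rV[R]_d -> R) (x y v : 'rV[R]_d).
Local Notation e_ i := (delta_mx (0 : 'I_1) i : 'rV[R]_d).

(** Class C^k on the complement of the origin, by recursion on the partial derivatives. Values at
    the origin do not count ([Ck_eq]), so a derivative may be replaced by any formula valid off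
    0. *)
Fixpoint Ck k F : Prop :=
  (forall x, x != 0 -> {for x, continuous F}) /\
  if k is k'.+1 then
    (forall x i, x != 0 -> derivable F x (e_ i)) /\ forall i, Ck k' ('D_(e_ i) F)
  else True.

Lemma near_neq0 x : x != 0 -> \forall y \near x, y != 0.
Proof.
move=> /eqP x0; have : nbhs x (~` [set 0]).
  apply: open_nbhs_nbhs; split => //; apply: closed_openC.
  by apply: accessible_closed_set1; apply: hausdorff_accessible; exact: norm_hausdorff.
by apply: filterS => y /= /eqP.
Qed.

Lemma Ck_continuous k F x : Ck k F -> x != 0 -> {for x, continuous F}.
Proof. by case: k => [|k] [+ _]; exact. Qed.

Lemma Ck_derivable k F x i : Ck k.+1 F -> x != 0 -> derivable F x (e_ i).
Proof. by move=> [_ [+ _]]; exact. Qed.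

Lemma Ck_derive k F i : Ck k.+1 F -> Ck k ('D_(e_ i) F).
Proof. by move=> [_ [_ +]]; exact. Qed.

Lemma CkW k F : Ck k.+1 F -> Ck k F.
Proof.
elim: k F => [|k IH] F [cF [dF DF]]; first by [].
by split => //; split => // i; apply: IH; exact: DF.
Qed.

Lemma Ck_eq k F G : (forall x, x != 0 -> F x = G x) -> Ck k F -> Ck k G.
Proof.
elim: k F G => [|k IH] F G FG;
  have nFG x : x != 0 -> \forall y \near x, F y = G y by
    (move=> x0; have := near_neq0 x0; apply: filterS => y /FG).
  move=> [cF _]; split => // x x0; rewrite /prop_for /continuous_at -FG//.
  by apply: cvg_trans (cF x x0); apply: (@near_eq_cvg _ _ (nbhs x) _ F G); exact: nFG.
move=> [cF [dF DF]]; split; last split.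
- move=> x x0; rewrite /prop_for /continuous_at -FG//.
  by apply: cvg_trans (cF x x0); apply: (@near_eq_cvg _ _ (nbhs x) _ F G); exact: nFG.
- by move=> x i x0; apply: near_eq_derivable (dF x i x0); exact: nFG.
- move=> i; apply: IH (DF i) => x x0; apply: near_eq_derive; exact: nFG.
Qed.

Lemma Ck_cst k (a : R) : Ck k (fun=> a).
Proof.
elim: k a => [|k IH] a; first by split => // x _; apply: cst_continuous.
split; first by move=> x _; apply: cst_continuous.
split; first by move=> x i _; exact: derivable_cst.
by move=> i; apply: Ck_eq (IH 0) => x _; rewrite derive_cst.
Qed.

Lemma is_derive_coord i j x : is_derive x (e_ i) (fun y : 'rV[R]_d => y ord0 j) ((j == i)%:R).
Proof.
have E : (fun h : R => h^-1 *: (((fun y : 'rV[R]_d => y ord0 j) \o shift x) (h *: e_ i) - x ord0 j))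
   = (fun h : R => h^-1 * h * (j == i)%:R).
  by apply/funext => h /=; rewrite !mxE eqxx/= addrK [LHS]mulrA.
have C : (h^-1 * h * (j == i)%:R) @[h --> (0 : R)^'] --> ((j == i)%:R : R).
  have : cst (j == i)%:R @ (0 : R)^' --> ((j == i)%:R : R) by exact: cvg_cst.
  apply: cvg_trans; apply: near_eq_cvg; near=> h; rewrite /cst mulVf ?mul1r//.
  by near: h; exact: nbhs_dnbhs_neq.
split; first by rewrite /derivable E; apply/cvg_ex; exists ((j == i)%:R).
by rewrite /derive E; apply: cvg_lim.
Unshelve. all: by end_near. Qed.

Lemma Ck_coord k j : Ck k (fun y : 'rV[R]_d => y ord0 j).
Proof.
case: k => [|k]; first by split => // x _; exact: coord_continuous.
split; first by move=> x _; exact: coord_continuous.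
split => [x i _|i]; first exact: (is_derive_coord i j x).(ex_derive).
apply: Ck_eq (Ck_cst k (j == i)%:R) => x _.
by rewrite (@derive_val _ _ _ _ _ _ _ (is_derive_coord i j x)).
Qed.

Lemma CkD k F G : Ck k F -> Ck k G -> Ck k (fun x => F x + G x).
Proof.
elim: k F G => [|k IH] F G.
  by move=> [cF _] [cG _]; split => // x x0; exact: (continuousD (cF x x0) (cG x x0)).
move=> [cF [dF DF]] [cG [dG DG]]; split; last split.
- by move=> x x0; exact: (continuousD (cF x x0) (cG x x0)).
- by move=> x i x0; exact: (derivableD (dF x i x0) (dG x i x0)).
- move=> i; apply: Ck_eq (IH _ _ (DF i) (DG i)) => x x0.
  by rewrite -[RHS]/('D_(e_ i) (F + G) x) deriveD//; [exact: dF|exact: dG].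
Qed.

Lemma CkM k F G : Ck k F -> Ck k G -> Ck k (fun x => F x * G x).
Proof.
elim: k F G => [|k IH] F G.
  by move=> [cF _] [cG _]; split => // x x0; exact: (continuousM (cF x x0) (cG x x0)).
move=> CF CG; have [cF [dF DF]] := CF; have [cG [dG DG]] := CG; split; last split.
- by move=> x x0; exact: (continuousM (cF x x0) (cG x x0)).
- by move=> x i x0; exact: (derivableM (dF x i x0) (dG x i x0)).
- move=> i; apply: Ck_eq (CkD (IH _ _ (CkW CF) (DG i)) (IH _ _ (CkW CG) (DF i))) => x x0.
  by rewrite -[RHS]/('D_(e_ i) (F * G) x) deriveM//; [exact: dF|exact: dG].
Qed.

Lemma CkZ k a F : Ck k F -> Ck k (fun x => a * F x).
Proof. exact/CkM/Ck_cst. Qed.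

Lemma CkB k F G : Ck k F -> Ck k G -> Ck k (fun x => F x - G x).
Proof.
move=> CF CG; apply: Ck_eq (CkD CF (CkZ (-1) CG)) => x _.
by rewrite mulN1r.
Qed.

Lemma Ck_sum k (I : Type) (s : seq I) (F : I -> 'rV[R]_d -> R) :
  (forall i, Ck k (F i)) -> Ck k (fun x => \sum_(i <- s) F i x).
Proof.
move=> CF; elim: s => [|i s IH].
  by apply: Ck_eq (Ck_cst k 0) => x _; rewrite big_nil.
by apply: Ck_eq (CkD (CF i) IH) => x _; rewrite big_cons.
Qed.

Lemma is_derive_comp_along F (phi : R -> R) x v (p : R) :
  derivable F x v -> is_derive (F x) 1 phi p ->
  is_derive x v (phi \o F) (p * 'D_v F x).
Proof.
move=> dF dphi.
have dl : is_derive (0 : R) 1 (fun u : R => F (x + u *: v)) ('D_v F x).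
  by have := @is_derive_line _ _ F x v 0; rewrite scale0r addr0; exact.
have dphi' : is_derive (F (x + 0 *: v)) 1 phi p by rewrite scale0r addr0.
have dc := @is_derive1_comp _ phi (fun u : R => F (x + u *: v)) 0 _ _ dphi' dl.
have E : (fun h : R => h^-1 *: (((phi \o F) \o shift x) (h *: v) - (phi \o F) x)) =
  (fun h : R => h^-1 *: (((phi \o (fun u : R => F (x + u *: v))) \o shift 0) (h *: 1)
    - (phi \o (fun u : R => F (x + u *: v))) 0)).
  by apply/funext => h /=; rewrite scale0r !addr0 [_%:A]mulr1 (addrC x).
split; first by rewrite /derivable E; exact: dc.(ex_derive).
by rewrite /derive E; exact: (@derive_val _ _ _ _ _ _ _ dc).
Qed.

Lemma Ck_expR k F : Ck k F -> Ck k (fun x => expR (F x)).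
Proof.
have cexp G x : {for x, continuous G} -> {for x, continuous (fun x => expR (G x))}.
  by move=> cG; apply: continuous_comp => //; exact: continuous_expR.
elim: k F => [|k IH] F CF.
  by split => // x x0; apply: cexp; exact: Ck_continuous CF x0.
have [cF [dF DF]] := CF; split; last split.
- by move=> x x0; apply: cexp; exact: (cF x x0).
- by move=> x i x0; exact: (is_derive_comp_along (dF x i x0) (is_derive_expR _)).(ex_derive).
- move=> i; apply: Ck_eq (CkM (IH _ (CkW CF)) (DF i)) => x x0.
  by rewrite (@derive_val _ _ _ _ _ _ _ (is_derive_comp_along (dF x i x0) (is_derive_expR _))).
Qed.

Lemma Ck_inv k F : (forall x, x != 0 -> F x != 0) -> Ck k F -> Ck k (fun x => (F x)^-1).
Proof.
move=> F0; elim: k => [|k IH] CF.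
  by split => // x x0; exact: (continuousV (F0 x x0) (Ck_continuous CF x0)).
have [cF [dF DF]] := CF; split; last split.
- by move=> x x0; exact: (continuousV (F0 x x0) (cF x x0)).
- by move=> x i x0; exact: (derivableV (F0 x x0) (dF x i x0)).
- move=> i; have CI := IH (CkW CF).
  apply: Ck_eq (CkZ (-1) (CkM (CkM CI CI) (DF i))) => x x0.
  rewrite deriveV//; [|exact: F0|exact: dF].
  by rewrite -[RHS]/(- (F x) ^- 2 * 'D_(e_ i) F x) expr2 invfM; ring.
Qed.

Lemma Ck_ln k F : (forall x, x != 0 -> 0 < F x) -> Ck k F -> Ck k (fun x => ln (F x)).
Proof.
move=> F0.
have cln x : x != 0 -> {for x, continuous F} -> {for x, continuous (fun x => ln (F x))}.
  by move=> x0 cG; apply: continuous_comp => //; apply: continuous_ln; exact: F0.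
case: k => [|k] CF.
  by split => // x x0; apply: cln => //; exact: Ck_continuous CF x0.
have [cF [dF DF]] := CF; split; last split.
- by move=> x x0; apply: cln => //; exact: (cF x x0).
- by move=> x i x0; exact: (is_derive_comp_along (dF x i x0) (is_derive1_ln (F0 x x0))).(ex_derive).
- move=> i.
  have CI : Ck k (fun x => (F x)^-1) by apply: Ck_inv (CkW CF) => x /F0; rewrite lt0r => /andP[].
  apply: Ck_eq (CkM CI (DF i)) => x x0.
  by rewrite (@derive_val _ _ _ _ _ _ _ (is_derive_comp_along (dF x i x0) (is_derive1_ln (F0 x x0)))).
Qed.

Lemma sphere_smooth_Ck f k : sphere_smooth f -> Ck k (f \o sproj).
Proof.
move=> sf; rewrite -[f \o sproj]/(iter_partial [::] (f \o sproj)).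
elim: k [::] => [|k IH] l; first by split => // x x0; exact: (sf l x x0).1.
split; first by move=> x x0; exact: (sf l x x0).1.
split; first by move=> x i x0; exact: (sf l x x0).2.
by move=> i; exact: (IH (i :: l)).
Qed.

Lemma Ck_is_derive_curve F (c : R -> 'rV[R]_d) (c' : 'rV[R]_d) (t : R) :
  Ck 1 F -> c t != 0 ->
  (forall i, is_derive t 1 (fun u => c u ord0 i) (c' ord0 i)) ->
  is_derive t 1 (F \o c) (\sum_i c' ord0 i * 'D_(e_ i) F (c t)).
Proof.
move=> CF ct0 dc; apply: is_derive_comp_curve => //.
  apply: filterS (near_neq0 ct0) => y y0 i; exact: Ck_derivable CF y0.
by move=> i; exact: Ck_continuous (Ck_derive i CF) ct0.
Qed.

Lemma Ck_measurable k F : Ck k F -> measurable_fun [set x : 'rV[R]_d | x != 0] F.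
Proof. by move=> CF; apply: continuous_neq0_measurable => x x0; exact: (Ck_continuous CF x0). Qed.

End smooth_away_from_0.

(** The mean value theorem, first for u |-> f u + f (- u) on [0, 1], then for f1 on [- xi, xi], an
    interval of length at most 2. *)
Lemma second_difference_le (R : realType) (f f1 f2 : R -> R) (B : R) :
  (forall u : R, `|u| <= 1 -> is_derive u 1 f (f1 u)) ->
  (forall u : R, `|u| <= 1 -> is_derive u 1 f1 (f2 u)) ->
  (forall u : R, `|u| <= 1 -> `|f2 u| <= B) ->
  `|f 1 + f (- 1) - 2 * f 0| <= 2 * B.
Proof.
move=> df df1 f2B.
pose g u := f u + f (- u).
have dg (u : R) : `|u| <= 1 -> is_derive u 1 g (f1 u - f1 (- u)).
  move=> u1; have d1 := df u u1.
  have d2 : is_derive (- u) 1 f (f1 (- u)) by apply: df; rewrite normrN.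
  have d3 : is_derive u 1 (-%R : R -> R) (- 1) by exact: is_deriveNid.
  have d4 := @is_derive1_comp _ f -%R u _ _ d2 d3.
  have := is_deriveD d1 d4; rewrite mulrN1; exact.
have dom (u : R) : u \in `[0, 1] -> `|u| <= 1.
  by rewrite in_itv/= => /andP[u0 u1]; rewrite ger0_norm.
have [||xi xi01 E] := @MVT_segment R g (fun u : R => f1 u - f1 (- u)) 0 1 ler01.
- by move=> u ua; apply/dg/dom/subset_itv_oo_cc.
- by apply: derivable_within_continuous => u /dom ua; exact: (dg u ua).(ex_derive).
move: (xi01); rewrite in_itv/= => /andP[xi0 xi1].
have dom2 (u : R) : u \in `[- xi, xi] -> `|u| <= 1.
  rewrite in_itv/= => /andP[u0 u1]; rewrite ler_norml; apply/andP; split.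
    by apply: le_trans u0; rewrite lerN2.
  exact: le_trans xi1.
have xixi : - xi <= xi by rewrite (le_trans _ xi0)// oppr_le0.
have [||eta etaxi E2] := @MVT_segment R f1 f2 (- xi) xi xixi.
- by move=> u ua; apply/df1/dom2/subset_itv_oo_cc.
- by apply: derivable_within_continuous => u /dom2 ua; exact: (df1 u ua).(ex_derive).
have -> : f 1 + f (- 1) - 2 * f 0 = f2 eta * (2 * xi).
  transitivity (g 1 - g 0); first by rewrite /g oppr0; ring.
  rewrite E E2; ring.
have B0 : 0 <= B by apply: le_trans (f2B 0 _); rewrite ?normr0.
rewrite normrM mulrC ler_pM// ?(f2B _ (dom2 _ etaxi))//.
by rewrite ger0_norm ?mulr_ge0// ler_piMr.
Qed.

(** * Uniform second-difference bounds for functions constant along rays *)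

Section annulus.
Context (R : realType) (d : nat).
Implicit Types (F H : 'rV[R]_d -> R) (x y s v : 'rV[R]_d).
Local Notation e_ i := (delta_mx (0 : 'I_1) i : 'rV[R]_d).

(** A compact set off the origin, with norms between 1/2 and 1: it contains the sphere and every
    chord from x to [half_turn s x] with x . s >= 1/2. *)
Definition annulus : set 'rV[R]_d := [set x | 4^-1 <= dotv x x <= 1].

Lemma continuous_dotv : continuous (fun x : 'rV[R]_d => dotv x x).
Proof.
move=> x; apply: (@cvg_sumr R _ (nbhs x) _ _ (fun i (y : 'rV[R]_d) => y ord0 i * y ord0 i) _ (nbhs_filter x)) => i.
by apply: cvgM; exact: coord_continuous.
Qed.

Lemma compact_annulus : compact annulus.
Proof.
apply: bounded_closed_compact.
  exists 1; split => // M M1 x /andP[_ x1]; apply: le_trans (ltW M1).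
  rewrite [leLHS]/Num.Def.normr/= mx_normrE; apply: bigmax_le => // -[i j] _ /=.
  rewrite (ord1 i); apply: (@unit_ball_sub_cube R d x).
  by rewrite /unit_ball/= -sqrtr1 ler_wsqrtr.
have -> : annulus = (fun x => dotv x x) @^-1` `[4^-1, 1].
  by apply/seteqP; split => x; rewrite /annulus/= in_itv.
apply: closed_comp; last exact: itv_closed.
by move=> x _; exact: continuous_dotv.
Qed.

Lemma annulus_neq0 x : annulus x -> x != 0.
Proof.
by move=> /andP[h _]; rewrite -dotv_eq0 gt_eqF// (lt_le_trans _ h)// invr_gt0.
Qed.

Lemma sphere_annulus x : sphere R d x -> annulus x.
Proof.
by move=> /sphereP h; rewrite /annulus/= h lexx andbT invf_le1// ler1n.
Qed.

Lemma Ck_bounded k F : Ck k F -> exists2 M : R, 0 <= M & forall x, annulus x -> `|F x| <= M.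
Proof.
move=> CF; have cF : {within annulus, continuous F}.
  apply: continuous_in_subspaceT => x /[!inE] /annulus_neq0 x0.
  exact: (Ck_continuous CF x0).
have [M [_ HM]] := compact_bounded (continuous_compact cF compact_annulus).
exists (`|M| + 1); first by rewrite addr_ge0.
move=> x Zx; apply: (HM (`|M| + 1)); last by exists x.
by rewrite ltr_pwDr// ler_norm.
Qed.

Lemma fin_bound (I : finType) (P : I -> R -> Prop) :
  (forall i M N, M <= N -> P i M -> P i N) ->
  (forall i, exists2 M : R, 0 <= M & P i M) -> exists2 M : R, 0 <= M & forall i, P i M.
Proof.
move=> Pm /(_ _)/cid2-/all_sig2[M M0 PM].
exists (\sum_i M i); first by apply: sumr_ge0.
move=> i; apply: Pm (PM i); rewrite (bigD1 i)//= lerDl sumr_ge0//.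
Qed.

Definition zhom F := forall a x, 0 < a -> x != 0 -> F (a *: x) = F x.
Definition even_away F := forall x, x != 0 -> F (- x) = F x.

Lemma half_turnE s x : half_turn s x = dotv x s *: s - (x - dotv x s *: s).
Proof.
by rewrite /half_turn opprB addrA -scalerDl; congr (_ *: _ - _); ring.
Qed.

(** With t = x . s and w = x - t s, the points x and [half_turn s x] are t s + w and t s - w. The
    midpoint t s has the same value as s by homogeneity, and |w|^2 = 1 - t^2, so the second
    difference along this chord is bounded by second derivatives times 1 - t^2. *)
Lemma second_difference_bound F : Ck 2 F -> zhom F -> even_away F ->
  exists2 C : R, 0 <= C & forall s x, sphere R d s -> sphere R d x ->
    `|F x + F (half_turn s x) - 2 * F s| <= C * (1 - dotv x s ^+ 2).
Proof.
move=> CF hF eF.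
have [M0 M00 HM0] := Ck_bounded CF.
have [M1 M10 HM1] : exists2 M : R, 0 <= M & forall ij : 'I_d * 'I_d, forall x, annulus x ->
    `|'D_(e_ ij.1) ('D_(e_ ij.2) F) x| <= M.
  apply: (fin_bound (P := fun (ij : 'I_d * 'I_d) M => forall x, annulus x ->
    `|'D_(e_ ij.1) ('D_(e_ ij.2) F) x| <= M)).
    by move=> ij M N MN h x Zx; exact: le_trans (h x Zx) MN.
  by move=> ij; exact: Ck_bounded (Ck_derive _ (Ck_derive _ CF)).
exists (8 * M0 + 2 * (M1 * (d%:R * d%:R))); first by rewrite addr_ge0// !mulr_ge0.
have main s x : sphere R d s -> sphere R d x -> 0 <= dotv x s ->
    `|F x + F (half_turn s x) - 2 * F s| <= (8 * M0 + 2 * (M1 * (d%:R * d%:R))) * (1 - dotv x s ^+ 2).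
  move=> Ss Sx; set t := dotv x s => t0.
  have q : 4^-1 = 2^-1 * 2^-1 :> R by field.
  have ss : dotv s s = 1 by apply/sphereP.
  have xx : dotv x x = 1 by apply/sphereP.
  have t1 : t ^+ 2 <= 1 by exact: sphere_dotv_le1.
  have Z0 : 0 <= M1 * (d%:R * d%:R) by rewrite !mulr_ge0.
  (* For t < 1/2 the chord may come too close to 0, but then 1 - t^2 >= 3/4 and the crude bound 4 M0
     suffices, which accounts for the term 8 M0. *)
  have [t2|t2] := leP (2^-1) t; last first.
    apply: (@le_trans _ _ (4 * M0)).
      apply: le_trans (ler_normB _ _) _.
      have := HM0 _ (sphere_annulus Sx); have := HM0 _ (sphere_annulus Ss).
      have := HM0 (half_turn s x) (sphere_annulus ((isometry_sphere _ (half_turn_isometry ss)).2 Sx)).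
      have := ler_normD (F x) (F (half_turn s x)).
      rewrite (normrM 2) (ger0_norm (ler0n R 2)); lra.
    have : t ^+ 2 <= 4^-1.
      by rewrite expr2 q ler_pM// ltW.
    nra.
  pose w := x - t *: s.
  have ws : dotv w s = 0 by rewrite /w dotvDl dotvNl dotvZl ss mulr1 subrr.
  have ww : dotv w w = 1 - t ^+ 2.
    rewrite /w !dotvDl !dotvDr !dotvNl !dotvNr !dotvZl !dotvZr ss xx (dotvC s x) -/t; ring.
  pose p (u : R) := t *: s + u *: w.
  have pZ (u : R) : `|u| <= 1 -> annulus (p u).
    move=> u1; rewrite /annulus/= /p !dotvDl !dotvDr !dotvZl !dotvZr ss ws (dotvC s w) ws ww.
    have : u ^+ 2 <= 1 by rewrite -real_normK ?num_real// exprn_ile1.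
    have : 4^-1 <= t ^+ 2.
      by rewrite expr2 q ler_pM.
    have := sqr_ge0 u; rewrite !expr2 in t1 *; move=> *; apply/andP; split; nra.
  pose F1 y := \sum_i w ord0 i * 'D_(e_ i) F y.
  pose F2 y := \sum_j w ord0 j * 'D_(e_ j) F1 y.
  have CF1 : Ck 1 F1 by apply: Ck_sum => i; apply: CkZ; exact: Ck_derive.
  have dp i (u : R) : is_derive u 1 (fun u => p u ord0 i) (w ord0 i).
    have -> : (fun u => p u ord0 i) = (fun u : R => t * s ord0 i + w ord0 i * u).
      by apply/funext => r; rewrite /p !mxE (mulrC r).
    have h1 : is_derive u 1 (fun _ : R => t * s ord0 i) 0 by exact: is_derive_cst.
    have h2 := is_deriveZ (w ord0 i) (is_derive_id u (1 : R)).
    have := is_deriveD h1 h2; rewrite add0r [_ *: 1]mulr1; exact.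
  have dF2 y : y != 0 -> F2 y = \sum_j \sum_i w ord0 j * (w ord0 i * 'D_(e_ j) ('D_(e_ i) F) y).
    move=> y0; apply: eq_bigr => j _; rewrite -mulr_sumr; congr (_ * _).
    rewrite /F1 (_ : (fun y => _) = \sum_(i < d) (fun y => w ord0 i * 'D_(e_ i) F y)); last first.
      by apply/funext => z; rewrite fct_sumE.
    rewrite derive_sum; last first.
      by move=> i; exact: (Ck_derivable (CkZ (w ord0 i) (Ck_derive i CF)) y0).
    apply: eq_bigr => i _.
    by rewrite -deriveMl//; exact: (Ck_derivable (Ck_derive i CF) y0).
  have B (u : R) : `|u| <= 1 -> `|F2 (p u)| <= M1 * (d%:R * d%:R) * (1 - t ^+ 2).
    move=> u1; rewrite dF2 ?annulus_neq0//; last exact: pZ.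
    have b j i : `|w ord0 j * (w ord0 i * 'D_(e_ j) ('D_(e_ i) F) (p u))| <= M1 * (1 - t ^+ 2).
      rewrite mulrA normrM mulrC ler_pM//; first exact: (HM1 (j, i) _ (pZ _ u1)).
      rewrite normrM.
      have wi k : `|w ord0 k| ^+ 2 <= 1 - t ^+ 2.
        rewrite -ww real_normK ?num_real// /dotv (bigD1 k)//= expr2 lerDl.
        by apply: sumr_ge0 => l _; rewrite -expr2 sqr_ge0.
      have := wi i; have := wi j; have := sqr_ge0 (`|w ord0 i| - `|w ord0 j|).
      rewrite !expr2; nra.
    apply: (@le_trans _ _ (\sum_(j < d) \sum_(i < d) (M1 * (1 - t ^+ 2)))); last first.
      rewrite !sumr_const !card_ord -(mulr_natr (M1 * (1 - t ^+ 2)) d) -(mulr_natr (_ * d%:R) d).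
      by rewrite le_eqVlt; apply/orP; left; apply/eqP; ring.
    apply: le_trans (ler_norm_sum _ _ _) _.
    by apply: (@ler_sum R) => j _; apply: le_trans (ler_norm_sum _ _ _) _; apply: (@ler_sum R).
  have := @second_difference_le R (F \o p) (F1 \o p) (F2 \o p) _
    (fun u u1 => Ck_is_derive_curve (CkW CF) (annulus_neq0 (pZ u u1)) (fun i => dp i u))
    (fun u u1 => Ck_is_derive_curve CF1 (annulus_neq0 (pZ u u1)) (fun i => dp i u)) B.
  have p1 : p 1 = x by rewrite /p /w scale1r addrC subrK.
  have pN1 : p (-1) = half_turn s x by rewrite half_turnE /p /w scaleN1r.
  have p0 : p 0 = t *: s by rewrite /p scale0r addr0.
  rewrite /comp p1 pN1 p0 hF ?sphere_neq0//; last by rewrite (lt_le_trans _ t2).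
  move=> h; apply: le_trans h _; rewrite [leRHS]mulrDl -[X in _ <= _ + X]mulrA lerDr.
  by rewrite mulr_ge0 ?mulr_ge0// subr_ge0.
(* If x . s < 0, replace x by - x: the half-turn is linear and F is even, so no value changes. *)
move=> s x Ss Sx; have [t0|t0] := leP 0 (dotv x s); first exact: main.
have := main s (- x) Ss (sphereN Sx); rewrite dotvNl oppr_ge0 sqrrN => /(_ (ltW t0)).
have ss : dotv s s = 1 by apply/sphereP.
rewrite (isometryN x (half_turn_isometry ss)) !eF ?sphere_neq0//.
by apply/isometry_sphere => //; exact: half_turn_isometry.
Qed.

End annulus.

(** * The operator B and rotations *)

Section rotation_field.
Context (R : realType) (d : nat).
Implicit Types (F H : 'rV[R]_d -> R) (x y s v : 'rV[R]_d).
Local Notation e_ i := (delta_mx (0 : 'I_1) i : 'rV[R]_d).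

Definition grad H x : 'rV[R]_d := \row_i 'D_(e_ i) H x.

(* The derivative of H along the infinitesimal rotation in the plane of s, v,
   y |-> (y . s) v - (y . v) s. *)
Definition rot_field s v H y := dotv y s * dotv (grad H y) v - dotv y v * dotv (grad H y) s.

Lemma dotv_gradE H x v : dotv (grad H x) v = \sum_i v ord0 i * 'D_(e_ i) H x.
Proof. by apply: eq_bigr => i _; rewrite mxE mulrC. Qed.

Lemma Ck_dotv k v : Ck k (fun y => dotv y v).
Proof.
rewrite /dotv; apply: Ck_sum => i; apply: CkM; [exact: Ck_coord|exact: Ck_cst].
Qed.

Lemma Ck_rot_field k s v H : Ck k.+1 H -> Ck k (rot_field s v H).
Proof.
move=> CH; have Cg w : Ck k (fun y => dotv (grad H y) w).
  apply: (@Ck_eq _ _ _ (fun y => \sum_i w ord0 i * 'D_(e_ i) H y)).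
    by move=> x _; rewrite dotv_gradE.
  by apply: Ck_sum => i; apply: CkZ; exact: Ck_derive.
by apply: CkB; apply: CkM => //; exact: Ck_dotv.
Qed.

(** Used with a > 0 for functions constant along rays and with a = -1 for even functions: in both
    cases the factor a of the coordinates cancels that of the gradient in [rot_field]. *)
Lemma grad_scale H a x : Ck 1 H -> a != 0 -> (forall y, y != 0 -> H (a *: y) = H y) ->
  x != 0 -> a *: grad H (a *: x) = grad H x.
Proof.
move=> CH a0 Ha x0; apply/rowP => k; rewrite !mxE.
pose c (u : R) := a *: (x + u *: e_ k).
have dc i : is_derive (0 : R) 1 (fun u => c u ord0 i) ((a *: e_ k) ord0 i).
  have -> : (fun u => c u ord0 i) = (fun u : R => a * x ord0 i + (a * e_ k ord0 i) * u).
    by apply/funext => r; rewrite /c !mxE; ring.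
  have h1 : is_derive (0 : R) 1 (fun _ : R => a * x ord0 i) 0 by exact: is_derive_cst.
  have h2 := is_deriveZ (a * e_ k ord0 i) (is_derive_id (0 : R) (1 : R)).
  have -> : (a *: e_ k) ord0 i = a * e_ k ord0 i by rewrite mxE.
  by have := is_deriveD h1 h2; rewrite add0r [_ *: 1]mulr1; exact.
have c0 : c 0 = a *: x by rewrite /c scale0r addr0.
have c00 : c 0 != 0 by rewrite c0 scaler_eq0 negb_or a0.
have := Ck_is_derive_curve CH c00 dc.
rewrite (bigD1 k)//= big1 ?addr0; last first.
  by move=> i ik; rewrite !mxE (negPf ik) andbF mulr0 mul0r.
rewrite !mxE !eqxx mulr1 c0 => d1.
have d2 : is_derive (0 : R) 1 (fun u : R => H (x + u *: e_ k)) ('D_(e_ k) H x).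
  have := @is_derive_line _ _ H x (e_ k) 0; rewrite scale0r addr0; apply.
  exact: (Ck_derivable CH).
rewrite -(@derive_val _ _ _ _ _ _ _ d1) -(@derive_val _ _ _ _ _ _ _ d2).
apply: near_eq_derive.
have : \forall u \near (0 : R), x + u *: e_ k != 0.
  have cl : {for (0 : R), continuous (fun u : R => x + u *: e_ k)}.
    apply: cvgD; first exact: cvg_cst.
    by apply: cvgZr_tmp; exact: cvg_id.
  have h : nbhs (x + 0 *: e_ k) [set y | y != 0].
    by rewrite scale0r addr0; exact: near_neq0.
  exact: (cl _ h).
by apply: filterS => u u0; rewrite /= /c Ha.
Qed.

Lemma rot_field_zhom s v H : Ck 1 H -> zhom H -> zhom (rot_field s v H).
Proof.
move=> CH hH a x a0 x0; rewrite /rot_field !dotvZl.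
have := @grad_scale H a x CH (lt0r_neq0 a0) _ x0.
move=> /(_ (fun y => hH a y a0)).
by move=> <-; rewrite !dotvZl; ring.
Qed.

Lemma rot_field_even s v H : Ck 1 H -> even_away H -> even_away (rot_field s v H).
Proof.
move=> CH eH x x0; rewrite /rot_field !dotvNl.
have N0 : -1 != 0 :> R by rewrite oppr_eq0 oner_neq0.
have HN y : y != 0 -> H (-1 *: y) = H y by rewrite scaleN1r; exact: eH.
have := @grad_scale H (-1) x CH N0 HN x0.
by rewrite !scaleN1r => <-; rewrite !dotvNl; ring.
Qed.

Lemma euler_zhom H x : Ck 1 H -> zhom H -> x != 0 -> dotv (grad H x) x = 0.
Proof.
move=> CH hH x0; rewrite dotv_gradE.
pose c (u : R) := x + u *: x.
have dc i : is_derive (0 : R) 1 (fun u => c u ord0 i) (x ord0 i).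
  have -> : (fun u => c u ord0 i) = (fun u : R => x ord0 i + x ord0 i * u).
    by apply/funext => r; rewrite /c !mxE; ring.
  have h1 : is_derive (0 : R) 1 (fun _ : R => x ord0 i) 0 by exact: is_derive_cst.
  have h2 := is_deriveZ (x ord0 i) (is_derive_id (0 : R) (1 : R)).
  by have := is_deriveD h1 h2; rewrite add0r [_ *: 1]mulr1; exact.
have c0 : c 0 = x by rewrite /c scale0r addr0.
have c00 : c 0 != 0 by rewrite c0.
have := Ck_is_derive_curve CH c00 dc; rewrite c0 => d1.
rewrite -(@derive_val _ _ _ _ _ _ _ d1).
rewrite (near_eq_derive (g := fun _ : R => H x)); first exact: derive_cst.
have : \forall u \near (0 : R), `|u| < 1 by exact: (nbhs0_lt ltr01).
apply: filterS => u u1; rewrite /= /c -[x in x + _]scale1r -scalerDl hH//.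
by move: u1; rewrite ltr_norml => /andP[h _]; lra.
Qed.

Definition rot s v (t : R) := rotation s v (cos t) (sin t).

Lemma rot_isometry s v t : dotv s s = 1 -> dotv v v = 1 -> dotv s v = 0 ->
  isometry (rot s v t).
Proof. by move=> ss vv sv; apply: rotation_isometry => //; exact: cos2Dsin2. Qed.

Lemma rot0 s v x : rot s v 0 x = x.
Proof.
by rewrite /rot /rotation cos0 sin0 subrr !mul0r subrr addr0 !scale0r !addr0.
Qed.

(** The rotations in a fixed plane form a one-parameter group, so the velocity at time t is the same
    linear field evaluated at the moved point. *)
Lemma is_derive_rot s v H x (t : R) : dotv s s = 1 -> dotv v v = 1 -> dotv s v = 0 ->
  Ck 1 H -> x != 0 ->
  is_derive t 1 (fun u => H (rot s v u x)) (rot_field s v H (rot s v t x)).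
Proof.
move=> ss vv sv CH x0.
have ri u := rot_isometry u ss vv sv.
have rx0 : rot s v t x != 0.
  by rewrite -dotv_eq0 (ri t).2 dotv_eq0.
set a := dotv x s; set b := dotv x v.
have rs : dotv (rot s v t x) s = cos t * a - sin t * b.
  rewrite /rot /rotation !dotvDl !dotvZl ss (dotvC v s) sv -/a -/b; ring.
have rv : dotv (rot s v t x) v = sin t * a + cos t * b.
  rewrite /rot /rotation !dotvDl !dotvZl vv sv -/a -/b; ring.
pose c' : 'rV[R]_d := (cos t * a - sin t * b) *: v - (sin t * a + cos t * b) *: s.
have -> : rot_field s v H (rot s v t x) = \sum_i c' ord0 i * 'D_(e_ i) H (rot s v t x).
  rewrite /rot_field rs rv -dotv_gradE /c' dotvDr dotvNr !dotvZr; ring.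
apply: Ck_is_derive_curve => // i.
have -> : (fun u => rot s v u x ord0 i) = (fun u : R =>
    x ord0 i - a * s ord0 i - b * v ord0 i + (a * s ord0 i + b * v ord0 i) * cos u
    + (a * v ord0 i - b * s ord0 i) * sin u).
  by apply/funext => u; rewrite /rot /rotation !mxE -/a -/b; ring.
have h1 : is_derive t 1 (fun _ : R => x ord0 i - a * s ord0 i - b * v ord0 i) 0 by exact: is_derive_cst.
have h2 := is_deriveZ (a * s ord0 i + b * v ord0 i) (is_derive_cos t).
have h3 := is_deriveZ (a * v ord0 i - b * s ord0 i) (is_derive_sin t).
have := is_deriveD (is_deriveD h1 h2) h3.
rewrite (_ : 0 + _ + _ = c' ord0 i); first by exact.
rewrite /c' !mxE add0r.
by rewrite -[_ *: - sin t]/(_ * _) -[_ *: cos t]/(_ * _); ring.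
Qed.

End rotation_field.

(** [fine] sends +oo to 0; [integral_kernel] shows that this leaves unchanged every integral whose
    kernel is O(1 - t^2). *)
Definition bfin (R : realType) (b : R -> \bar R) t : R := fine (b t).

(* The half-turn about s preserves b (s' . s) and the caps removed in [Bop], so
   the principal value may be averaged over it; for even C^2 functions the
   averaged difference is O(1 - (s' . s)^2) and the integral converges. *)
Definition sym_diff (R : realType) d (u : 'rV[R]_d -> R) s x : R :=
  2^-1 * (u x + u (half_turn s x) - 2 * u s).

(** * The principal value as an absolutely convergent integral *)

Section collision_kernel.
Context (R : realType) (d : nat) (b : R -> \bar R).
Hypothesis b_meas : measurable_fun (`[-1, 1]%classic : set R) b.
Hypothesis b_ge0 : forall t, -1 <= t <= 1 -> (0 <= b t)%E.
Hypothesis b_int : forall s : 'rV[R]_d, sphere R d s ->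
      (\int[surface_measure]_(s' in sphere R d)
         ((1 - dotv s s' ^+ 2)%:E * b (dotv s s')) < +oo)%E.
Implicit Types (s x y v : 'rV[R]_d) (u F H : 'rV[R]_d -> R).
Local Notation mu := (@surface_measure R d).
Local Notation S := (sphere R d).

Lemma dotv_itv s x : S s -> S x -> -1 <= dotv x s <= 1.
Proof.
move=> Ss Sx; rewrite -ler_norml -(ler_pXn2r (ltn0Sn 1)) ?nnegrE//.
by rewrite expr1n real_normK ?num_real//; exact: sphere_dotv_le1.
Qed.

Lemma bfin_ge0 t : -1 <= t <= 1 -> 0 <= bfin b t.
Proof. by move=> h; rewrite fine_ge0// b_ge0. Qed.

Lemma measurable_dotv_fix s (D : set 'rV[R]_d) : measurable_fun D (fun x => dotv x s).
Proof.
apply: measurable_dotv => i; first by apply: measurable_funTS; exact: measurable_coord.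
exact: measurable_cst.
Qed.

Lemma measurable_b_dotv s : S s -> measurable_fun S (fun x => b (dotv x s)).
Proof.
move=> Ss; apply: (measurable_comp (measurable_itv `[-1, 1]) _ b_meas (measurable_dotv_fix s (D := S))).
by move=> _ [x Sx <-]; rewrite /= in_itv/= dotv_itv.
Qed.

Definition weight s x : \bar R := ((1 - dotv x s ^+ 2)%:E * b (dotv x s))%E.

Lemma weight_ge0 s x : S s -> S x -> (0 <= weight s x)%E.
Proof.
move=> Ss Sx; apply: mule_ge0; last by rewrite b_ge0// dotv_itv.
by rewrite lee_fin subr_ge0 sphere_dotv_le1.
Qed.

Lemma measurable_weight s : S s -> measurable_fun S (weight s).
Proof.
move=> Ss; apply: emeasurable_funM; last exact: measurable_b_dotv.
apply/measurable_EFinP; apply: measurable_funB; first exact: measurable_cst.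
by apply: measurable_funX; exact: measurable_dotv_fix.
Qed.

Lemma integrable_weight s : S s -> mu.-integrable S (weight s).
Proof.
move=> Ss; apply/integrableP; split; first exact: measurable_weight.
rewrite (_ : (\int[mu]_(x in S) _)%E = (\int[mu]_(s' in S)
         ((1 - dotv s s' ^+ 2)%:E * b (dotv s s')))%E); first exact: b_int.
apply: eq_integral => x /[!inE] Sx.
by rewrite gee0_abs ?weight_ge0// /weight dotvC.
Qed.

Lemma measurable_bfin s : S s -> measurable_fun S (fun x => bfin b (dotv x s)).
Proof. by move=> Ss; exact: (measurableT_comp (@fine_measurable R _ measurableT) (measurable_b_dotv Ss)). Qed.

Section dominated_kernel.
Context (k : 'rV[R]_d -> R) (s : 'rV[R]_d) (D : set 'rV[R]_d) (C : R).
Hypothesis Ss : S s.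
Hypothesis mD : measurable D.
Hypothesis DS : D `<=` S.
Hypothesis mk : measurable_fun D k.
Hypothesis kC : forall x, D x -> `|k x| <= C * (1 - dotv x s ^+ 2).

Lemma measurable_kernel : measurable_fun D (fun x => k x * bfin b (dotv x s)).
Proof.
apply: measurable_funM => //.
by apply: measurable_funS DS (measurable_bfin Ss); exact: measurable_sphere.
Qed.

Lemma integrable_kernel :
  mu.-integrable D (EFin \o (fun x => k x * bfin b (dotv x s))).
Proof.
have iw := integrableS (@measurable_sphere R d) mD DS (integrable_weight Ss).
apply: (le_integrable mD _ _ (integrableZl mD C iw)).
  by apply/measurable_EFinP; exact: measurable_kernel.
move=> x Dx /=; have Sx := DS Dx.
have b0 : (0 <= b (dotv x s))%E by rewrite b_ge0// dotv_itv.
rewrite abseM (gee0_abs (weight_ge0 Ss Sx)) /bfin /weight.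
case: (b (dotv x s)) b0 => [r| |]// r0 /=.
  rewrite lee_fin normrM mulrA ler_pM//.
    by apply: le_trans (kC Dx) _; rewrite ler_wpM2r ?ler_norm// subr_ge0 sphere_dotv_le1.
  by rewrite ger0_norm// -lee_fin.
by rewrite mulr0 normr0 mule_ge0// mule_ge0// lee_fin subr_ge0 sphere_dotv_le1.
Qed.

(** The weight (1 - t^2) b is integrable, hence finite almost everywhere; where it is finite and b =
    +oo, necessarily 1 - t^2 = 0, so k vanishes there and both integrands are 0. *)
Lemma integral_kernel :
  (\int[mu]_(x in D) ((k x)%:E * b (dotv x s)) =
   \int[mu]_(x in D) (k x * bfin b (dotv x s))%:E)%E.
Proof.
apply: ae_eq_integral => //.
- apply: emeasurable_funM; first exact/measurable_EFinP.
  by apply: measurable_funS DS (measurable_b_dotv Ss); exact: measurable_sphere.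
- by apply/measurable_EFinP; exact: measurable_kernel.
have := integrable_ae (@measurable_sphere R d) (integrable_weight Ss).
apply: filterS => x wx Dx; have Sx := DS Dx; move: (wx Sx).
have b0 : (0 <= b (dotv x s))%E by rewrite b_ge0// dotv_itv.
rewrite /bfin /weight; case: (b (dotv x s)) b0 => [r| |]//= _.
have [t0|t0] := eqVneq (1 - dotv x s ^+ 2) 0.
  have := kC Dx; rewrite t0 mulr0 normr_le0 => /eqP ->.
  by rewrite mul0e mul0r.
rewrite mulry; have : 0 < 1 - dotv x s ^+ 2.
  by rewrite lt0r t0 subr_ge0 sphere_dotv_le1.
by move=> /gtr0_sg ->; rewrite mul1e.
Qed.

End dominated_kernel.

Lemma measurable_off_caps (e : R) s : measurable (off_caps e s).
Proof.
apply: measurableI; first exact: measurable_sphere.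
have -> : [set s' | `|dotv s' s| < 1 - e] = (fun x => `|dotv x s|) @^-1` `]-oo, 1 - e[.
  by apply/seteqP; split => x; rewrite /= in_itv.
rewrite -[X in measurable X]setTI; apply: measurableT_comp => //.
exact: measurable_dotv_fix.
Qed.

Lemma off_caps_sphere (e : R) s : off_caps e s `<=` S.
Proof. by move=> x []. Qed.

Lemma off_caps_half_turn (e : R) s : S s -> half_turn s @^-1` off_caps e s = off_caps e s.
Proof.
move=> /sphereP ss; have hi := half_turn_isometry ss.
apply/seteqP; split => x; rewrite /off_caps/= dotv_half_turn// => -[h1 h2]; split => //.
  exact/(isometry_sphere x hi).
exact/(isometry_sphere x hi).
Qed.

Lemma Ck_measurable_sphere k F : Ck k F -> measurable_fun S F.
Proof.
move=> /Ck_measurable; apply: measurable_funS; last by move=> x /sphere_neq0.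
have -> : [set x : 'rV[R]_d | x != 0] = ~` [set 0].
  by apply/seteqP; split => y /= /eqP.
apply: open_measurable_rV; apply: closed_openC; apply: accessible_closed_set1.
by apply: hausdorff_accessible; exact: norm_hausdorff.
Qed.

Definition sym_op u s : R := (\int[mu]_(x in S) (sym_diff u s x * bfin b (dotv x s)))%R.

Lemma measurable_comp_isometry (f : 'rV[R]_d -> 'rV[R]_d) F :
  isometry f -> measurable_fun S F -> measurable_fun S (F \o f).
Proof.
move=> fi mF; apply: (measurable_comp (@measurable_sphere R d) _ mF).
- by move=> _ [x Sx <-]; exact/(isometry_sphere x fi).
- by apply: measurable_funTS; exact: measurable_isometry.
Qed.

Lemma measurable_sym_diff k F s : Ck k F -> S s -> measurable_fun S (sym_diff F s).
Proof.
move=> CF Ss; have mF := Ck_measurable_sphere CF.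
have hi := half_turn_isometry ((sphereP s).1 Ss).
apply: measurable_funM; first exact: measurable_cst.
apply: measurable_funB; last exact: measurable_cst.
by apply: measurable_funD => //; exact: (measurable_comp_isometry hi mF).
Qed.

Lemma sym_diff_bound F : Ck 2 F -> zhom F -> even_away F ->
  exists2 C : R, 0 <= C & forall s x, S s -> S x -> `|sym_diff F s x| <= C * (1 - dotv x s ^+ 2).
Proof.
move=> CF hF eF; have [C C0 HC] := second_difference_bound CF hF eF.
exists C => // s x Ss Sx; rewrite /sym_diff normrM ger0_norm ?invr_ge0//.
apply: le_trans (HC s x Ss Sx); rewrite ler_piMl// invf_le1// ler1n//.
Qed.

Lemma integrable_sym_op F s : Ck 2 F -> zhom F -> even_away F -> S s ->
  mu.-integrable S (EFin \o (fun x => sym_diff F s x * bfin b (dotv x s))).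
Proof.
move=> CF hF eF Ss; have [C C0 HC] := sym_diff_bound CF hF eF.
apply: (@integrable_kernel _ _ _ C) => //.
- exact: measurable_sphere.
- exact: measurable_sym_diff CF Ss.
- by move=> x Sx; exact: HC.
Qed.

(** Off the caps 1 - t^2 exceeds e, so the bounded difference F x - F s is at most (2 M / e) (1 -
    t^2). It is thus integrable without symmetrization, and invariance under the half-turn allows
    the two integrals to be averaged. *)
Lemma truncated_op F s (e : R) : Ck 2 F -> zhom F -> even_away F -> S s -> 0 < e ->
  fine (\int[mu]_(x in off_caps e s) ((F x - F s)%:E * b (dotv x s)))%E =
  (\int[mu]_(x in off_caps e s) (sym_diff F s x * bfin b (dotv x s)))%R.
Proof.
move=> CF hF eF Ss e0.
have ss := (sphereP s).1 Ss; have hi := half_turn_isometry ss.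
have mO := measurable_off_caps e s.
have mF := Ck_measurable_sphere CF.
have mOF f : isometry f -> measurable_fun (off_caps e s) (fun x => F (f x) - F s).
  move=> fi; apply: measurable_funB; last exact: measurable_cst.
  apply: measurable_funS (@off_caps_sphere e s) (measurable_comp_isometry fi mF).
  exact: measurable_sphere.
have idi : isometry (@id 'rV[R]_d) by split.
have [M M0 HM] := Ck_bounded CF.
have bd f x : isometry f -> off_caps e s x ->
    `|F (f x) - F s| <= (2 * M / e) * (1 - dotv x s ^+ 2).
  move=> fi [Sx /= xs].
  have h1 : `|F (f x) - F s| <= 2 * M.
    apply: le_trans (ler_normB _ _) _; rewrite mulr2n mulrDl mul1r lerD ?HM//.
      by apply/sphere_annulus/isometry_sphere.
    exact: sphere_annulus.
  apply: le_trans h1 _; rewrite -mulrA ler_peMr ?mulr_ge0//.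
  rewrite -ler_pdivrMl ?invr_gt0// invrK mulr1.
  have := sphere_dotv_le1 Sx Ss; rewrite -(real_normK (num_real (dotv x s))).
  have := normr_ge0 (dotv x s); move: (`|dotv x s|) xs => t; rewrite expr2; nra.
have if1 f : isometry f -> mu.-integrable (off_caps e s)
    (EFin \o (fun x => (F (f x) - F s) * bfin b (dotv x s))).
  move=> fi; apply: (@integrable_kernel _ _ _ (2 * M / e)) => //.
  - exact: off_caps_sphere.
  - exact: (mOF f fi).
  - by move=> x; exact: (bd f x fi).
rewrite (@integral_kernel _ _ _ (2 * M / e))//; last 3 first.
- exact: off_caps_sphere.
- exact: (mOF id idi).
- by move=> x; exact: (bd id x idi).
rewrite -/(Rintegral mu _ _).
have E : (\int[mu]_(x in off_caps e s) ((F (half_turn s x) - F s) * bfin b (dotv x s)))%R =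
  (\int[mu]_(x in off_caps e s) ((F x - F s) * bfin b (dotv x s)))%R.
  rewrite /Rintegral; congr fine.
  rewrite -(@surface_integral_isometry_on _ _ _ (half_turn s) (fun x => ((F x - F s) * bfin b (dotv x s))%:E))//.
  - by apply: eq_integral => x _; rewrite dotv_half_turn.
  - exact: off_caps_half_turn.
  - exact: measurable_int (if1 id idi).
transitivity (2^-1 * ((\int[mu]_(x in off_caps e s) ((F x - F s) * bfin b (dotv x s)))%R +
   (\int[mu]_(x in off_caps e s) ((F (half_turn s x) - F s) * bfin b (dotv x s)))%R)).
  by rewrite E; field.
rewrite -RintegralD//; [|exact: (if1 id idi)|exact: (if1 (half_turn s) hi)].
rewrite -RintegralZl//; last first.
  have := integrableD mO (if1 id idi) (if1 _ hi).
  by apply: eq_integrable => // x _; rewrite /= EFinD.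
apply: eq_Rintegral => x _; rewrite /sym_diff; ring.
Qed.

Lemma truncated_op_cvg F s : Ck 2 F -> zhom F -> even_away F -> S s ->
  (\int[mu]_(x in off_caps e s) (sym_diff F s x * bfin b (dotv x s)))%R @[e --> (0:R)^'+]
    --> sym_op F s.
Proof.
move=> CF hF eF Ss; apply/cvg_at_rightP => e [e0 ecvg].
have ig := integrable_sym_op CF hF eF Ss.
have [C C0 HC] := sym_diff_bound CF hF eF.
set g := fun x => sym_diff F s x * bfin b (dotv x s).
rewrite /sym_op /Rintegral; apply: fine_cvg; rewrite fineK; last exact: (integrable_fin_num (@measurable_sphere R d) ig).
have mS := @measurable_sphere R d.
have E n : (\int[mu]_(x in off_caps (e n) s) (g x)%:E = \int[mu]_(x in S) ((EFin \o g) \_ (off_caps (e n) s)) x)%E.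
  by rewrite -integral_mkcondr setIidr//; exact: off_caps_sphere.
under eq_fun do rewrite E.
apply: (@dominated_cvg _ _ R mu S mS (fun n => (EFin \o g) \_ (off_caps (e n) s)) (EFin \o g) (fun x => `|(g x)%:E|%E)).
- move=> n; apply/(measurable_restrict _ _ _).1 => //.
    exact: measurable_off_caps.
  apply: measurable_funS (measurable_int _ ig) => //.
- move=> x Sx.
  (* The points with |x . s| = 1 lie in every removed cap, but [sym_diff] vanishes there; any other
     point is outside the caps for small e. *)
  have [t1|t1] := ltP `|dotv x s| 1; last first.
    have gx : g x = 0.
      rewrite /g; have := HC s x Ss Sx.
      have t2 : 1 - dotv x s ^+ 2 <= 0.
        by rewrite subr_le0 -(real_normK (num_real _)) exprn_ege1.
      move=> h; have : `|sym_diff F s x| <= 0.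
        by apply: le_trans h _; rewrite mulr_ge0_le0.
      by rewrite normr_le0 => /eqP ->; rewrite mul0r.
    rewrite (_ : (fun n => _) = (fun=> (EFin \o g) x)); first exact: cvg_cst.
    by apply/funext => n; rewrite patchE /= gx; case: ifP.
  have : cst ((EFin \o g) x) @ \oo --> (EFin \o g) x by exact: cvg_cst.
  apply: cvg_trans; apply: near_eq_cvg.
  have d0 : 0 < 1 - `|dotv x s| by rewrite subr_gt0.
  have [N _ HN] := (cvgrPdist_lt _ _).1 ecvg _ d0.
  exists N => // n Nn; have := HN n Nn.
  rewrite /= sub0r normrN gtr0_norm// => en.
  by rewrite patchE mem_set//; split => //=; rewrite ltrBrDl -ltrBrDr.
- by move=> x Sx.
- exact: integrable_abse ig.
- move=> n x Sx /=; rewrite patchE; case: ifP => //= _.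
  by rewrite normr0 lee_fin.
Qed.

Theorem Bop_sym_op F s : Ck 2 F -> zhom F -> even_away F -> S s ->
  Bop b F s = sym_op F s.
Proof.
move=> CF hF eF Ss; rewrite /Bop; apply: cvg_lim => //.
apply: cvg_trans (truncated_op_cvg CF hF eF Ss).
by apply: near_eq_cvg; near=> e; rewrite truncated_op.
Unshelve. all: by end_near. Qed.

Lemma eq_Bop f g s : S s -> (forall x, S x -> f x = g x) -> Bop b f s = Bop b g s.
Proof.
move=> Ss fg; rewrite /Bop; under eq_fun => e.
  rewrite (eq_integral (fun x => ((g x - g s)%:E * b (dotv x s))%E)); last first.
    by move=> x /[!inE] -[Sx _]; rewrite !fg.
  over.
by [].
Qed.

End collision_kernel.

(** The two conditions form a matrix of rank at most 2, whose kernel is nonzero as soon as d >=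
    3. *)
Lemma exists_unit_orthogonal (R : realType) d (x y : 'rV[R]_d) : (3 <= d)%N ->
  exists v : 'rV[R]_d, [/\ dotv v v = 1, dotv v x = 0 & dotv v y = 0].
Proof.
move=> d3; pose A : 'M[R]_(d, 1 + 1) := row_mx x^T y^T.
have : kermx A != 0.
  rewrite -mxrank_eq0 mxrank_ker subn_eq0 -ltnNge.
  by apply: leq_ltn_trans (rank_leq_col A) _.
move=> /rowV0Pn[w /sub_kermxP wA w0].
have [wx wy] : w *m x^T = 0 /\ w *m y^T = 0.
  by move: wA; rewrite mul_mx_row -row_mx0 => /eq_row_mx.
exists (sproj w); split; first exact/sphereP/sproj_sphere.
  by rewrite dotvZl dotvE wx mxE mulr0.
by rewrite dotvZl dotvE wy mxE mulr0.
Qed.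

(** Turns straight lines through s into rotation orbits of s, so that partial derivatives of
    [f \o sproj] can be computed along rotations. *)
Lemma sproj_rot (R : realType) d (s v : 'rV[R]_d) (a c : R) : 0 < a ->
  dotv s s = 1 -> dotv v v = 1 -> dotv s v = 0 ->
  sproj (a *: s + c *: v) = rot s v (atan (c / a)) s.
Proof.
move=> a0 ss vv sv; set t := atan _.
have ct : 0 < cos t by apply: cos_gt0_pihalf; rewrite atan_gtNpi2 atan_ltpi2.
have tt : sin t = cos t * (c / a).
  by rewrite -(atanK (c / a)) -/t /tan mulrC divfK// gt_eqF.
have E : rot s v t s = cos t *: s + sin t *: v.
  rewrite /rot /rotation ss sv; apply/rowP => i; rewrite !mxE; ring.
have Ss : sphere R d (rot s v t s).
  by apply/(isometry_sphere s (rot_isometry t ss vv sv))/sphereP.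
have -> : a *: s + c *: v = (a / cos t) *: rot s v t s.
  rewrite E tt scalerDr !scalerA; congr (_ *: _ + _ *: _); field; rewrite ?gt_eqF//.
by rewrite sprojZ ?divr_gt0// sproj_id.
Qed.

(** * Differentiation of the operator along rotations *)

Section derivative_of_the_operator.
Context (R : realType) (d : nat) (b : R -> \bar R).
Hypothesis b_meas : measurable_fun (`[-1, 1]%classic : set R) b.
Hypothesis b_ge0 : forall t, -1 <= t <= 1 -> (0 <= b t)%E.
Hypothesis b_int : forall s : 'rV[R]_d, sphere R d s ->
      (\int[surface_measure]_(s' in sphere R d)
         ((1 - dotv s s' ^+ 2)%:E * b (dotv s s')) < +oo)%E.
Implicit Types (s x y v : 'rV[R]_d) (u F H : 'rV[R]_d -> R).
Local Notation mu := (@surface_measure R d).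
Local Notation S := (sphere R d).
Local Notation e_ i := (delta_mx (0 : 'I_1) i : 'rV[R]_d).

(** Rotating the integration variable along with s leaves b (x . s) independent of t: only F, which
    is smooth, remains to be differentiated. *)
Lemma sym_op_rot F s v (t : R) : Ck 2 F -> S s -> S v -> dotv s v = 0 ->
  sym_op b F (rot s v t s) =
  (\int[mu]_(x in S) (sym_diff F (rot s v t s) (rot s v t x) * bfin b (dotv x s)))%R.
Proof.
move=> CF Ss /sphereP vv sv; have ss := (sphereP s).1 Ss.
have ri := rot_isometry t ss vv sv.
have Sr : S (rot s v t s) by exact/(isometry_sphere s ri).
rewrite /sym_op /Rintegral; congr fine.
rewrite -(surface_integral_isometry (f := rot s v t)
  (F := fun x => (sym_diff F (rot s v t s) x * bfin b (dotv x (rot s v t s)))%:E))//.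
  by apply: eq_integral => x _; rewrite ri.2.
apply/measurable_EFinP; apply: measurable_funM.
  exact: measurable_sym_diff CF Sr.
exact: measurable_bfin.
Qed.

(** The t-derivative of the symmetrized difference of H is that of the rotation field of H, which is
    again even and constant along rays. It is of class C^2 because H is C^3, hence bounded by C (1 -
    t^2) uniformly in the angle, and this dominates the integrals. *)
Lemma is_derive_sym_op_rot H s v : Ck 3 H -> zhom H -> even_away H -> S s -> S v ->
  dotv s v = 0 ->
  is_derive (0 : R) 1 (fun t : R => sym_op b H (rot s v t s)) (sym_op b (rot_field s v H) s).
Proof.
move=> CH hH eH Ss Sv sv; have ss := (sphereP s).1 Ss; have vv := (sphereP v).1 Sv.
have CH2 := CkW CH; have CH1 := CkW CH2.
pose X := rot_field s v H.
have CX : Ck 2 X by exact: Ck_rot_field.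
have hX : zhom X by exact: rot_field_zhom.
have eX : even_away X by exact: rot_field_even.
have mS := @measurable_sphere R d.
have ri t := rot_isometry t ss vv sv.
have Sr t x : S x -> S (rot s v t x) by move=> Sx; exact/(isometry_sphere x (ri t)).
have [C C0 HC] := sym_diff_bound CX hX eX.
have [C' C'0 HC'] := sym_diff_bound CH2 hH eH.
pose f t x := sym_diff H (rot s v t s) (rot s v t x) * bfin b (dotv x s).
have E : (fun t : R => sym_op b H (rot s v t s)) = (fun t : R => (\int[mu]_(x in S) f t x)%R).
  by apply/funext => t; exact: sym_op_rot.
have df (t : R) x : S x -> is_derive t 1 (f ^~ x)
    (sym_diff X (rot s v t s) (rot s v t x) * bfin b (dotv x s)).
  move=> Sx.
  have x0 := sphere_neq0 Sx; have s0 := sphere_neq0 Ss.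
  have h0 : half_turn s x != 0.
    exact/sphere_neq0/(isometry_sphere x (half_turn_isometry ss)).
  have d1 := is_derive_rot t ss vv sv CH1 x0.
  have d2 := is_derive_rot t ss vv sv CH1 h0.
  have d3 := is_derive_rot t ss vv sv CH1 s0.
  have -> : f ^~ x = (fun t : R => (2^-1 * bfin b (dotv x s)) *
     (H (rot s v t x) + H (rot s v t (half_turn s x)) - 2 * H (rot s v t s))).
    apply/funext => r; rewrite /f /sym_diff (isometry_half_turn _ _ (ri r)); ring.
  have := is_deriveZ (2^-1 * bfin b (dotv x s)) (is_deriveB (is_deriveD d1 d2) (is_deriveZ 2 d3)).
  rewrite (_ : _ *: _ = sym_diff X (rot s v t s) (rot s v t x) * bfin b (dotv x s)); first by exact.
  rewrite /sym_diff (isometry_half_turn _ _ (ri t)) -/X -[_ *: _]/(_ * (_ - 2 * _)).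
  move: (X (rot s v t x)) (X (rot s v t (half_turn s x))) (X (rot s v t s)) (bfin b _) => p q r w; ring.
pose G x := `|C * (1 - dotv x s ^+ 2) * bfin b (dotv x s)|.
have dfE (t : R) x : S x -> partial1of2 f t x = sym_diff X (rot s v t s) (rot s v t x) * bfin b (dotv x s).
  by move=> Sx; rewrite partial1of2E (@derive_val _ _ _ _ _ _ _ (df t x Sx)).
have mw : measurable_fun S (fun x => 1 - dotv x s ^+ 2).
  apply: measurable_funB; first exact: measurable_cst.
  by apply: measurable_funX; exact: measurable_dotv_fix.
have iG : mu.-integrable S (EFin \o G).
  have : mu.-integrable S (EFin \o (fun x => C * (1 - dotv x s ^+ 2) * bfin b (dotv x s))).
    apply: (@integrable_kernel _ _ b b_meas b_ge0 b_int _ s S C) => //.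
      by apply: measurable_funM => //; exact: measurable_cst.
    move=> x Sx; rewrite ger0_norm// mulr_ge0// subr_ge0; exact: sphere_dotv_le1.
  by move/integrable_abse.
have if_ (t : R) : mu.-integrable S (EFin \o f t).
  apply: (@integrable_kernel _ _ b b_meas b_ge0 b_int _ s S C') => //.
    exact: (measurable_comp_isometry (ri t) (measurable_sym_diff CH2 (Sr t s Ss))).
  move=> x Sx; rewrite -[dotv x s](ri t).2; apply: HC'; exact: Sr.
have I0 : (`](-1), 1[%classic : set R) 0 by rewrite /= in_itv/= ltr01 ltrN10.
have G0 y : 0 <= G y by exact: normr_ge0.
have GB (t : R) y : (`](-1), 1[%classic : set R) t -> S y -> `|partial1of2 f t y| <= G y.
  move=> _ Sy; rewrite dfE// /G normrM [leRHS]normrM; apply: ler_wpM2r => //.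
  rewrite [leRHS]ger0_norm; last by rewrite mulr_ge0// subr_ge0; exact: sphere_dotv_le1.
  by rewrite -[dotv y s](ri t).2; apply: HC; exact: Sr.
rewrite E; split.
  exact: (derivable_under_integral mS I0 (fun t _ => if_ t) (fun t y _ Sy => (df t y Sy).(ex_derive)) G0 iG GB).
rewrite -derive1E (differentiation_under_integral mS I0 (fun t _ => if_ t) (fun t y _ Sy => (df t y Sy).(ex_derive)) G0 iG GB).
by apply: eq_Rintegral => x /[!inE] Sx; have := dfE 0 x Sx; rewrite !rot0.
Qed.

Lemma sym_op_lincomb (I : Type) (r : seq I) (a : I -> R) (F : I -> 'rV[R]_d -> R) s :
  (forall i, [/\ Ck 2 (F i), zhom (F i) & even_away (F i)]) -> S s ->
  sym_op b (fun y => \sum_(i <- r) a i * F i y) s = \sum_(i <- r) a i * sym_op b (F i) s.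
Proof.
move=> hF Ss; rewrite /sym_op.
transitivity (\int[mu]_(x in S) (\sum_(i <- r) a i * (sym_diff (F i) s x * bfin b (dotv x s))))%R.
  apply: eq_Rintegral => x _; rewrite /sym_diff.
  rewrite (mulr_sumr _ _ _ 2) -!big_split/= -sumrB mulr_sumr mulr_suml.
  by apply: eq_bigr => i _; ring.
have iF i : mu.-integrable S (EFin \o (fun x => sym_diff (F i) s x * bfin b (dotv x s))).
  by have [h1 h2 h3] := hF i; exact: integrable_sym_op.
have mS := @measurable_sphere R d.
have iaF i : mu.-integrable S (EFin \o (fun x => a i * (sym_diff (F i) s x * bfin b (dotv x s)))).
  by have := integrableZl mS (a i) (iF i); apply: eq_integrable.
elim: r => [|i r IH].
  rewrite big_nil /Rintegral; under eq_integral do rewrite big_nil.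
  by rewrite integral0.
rewrite big_cons -IH -RintegralZl// -RintegralD//.
  by apply: eq_Rintegral => x _; rewrite big_cons.
have := integrable_sum mS r (P := xpredT) (fun i _ => iaF i).
by apply: eq_integrable => // x _; rewrite /= sumEFin.
Qed.

Lemma rot_field_sum s v H y : 
  rot_field s v H y = \sum_i v ord0 i * rot_field s (e_ i) H y.
Proof.
have dc (w : 'rV[R]_d) i : dotv w (e_ i) = w ord0 i.
  rewrite /dotv (bigD1 i)//= big1 ?addr0 ?mxE ?eqxx ?mulr1// => j ji.
  by rewrite mxE (negPf ji) andbF mulr0.
transitivity (\sum_i (dotv y s * (grad H y ord0 i * v ord0 i) - (y ord0 i * v ord0 i) * dotv (grad H y) s)).
  by rewrite sumrB -mulr_sumr -mulr_suml.
by apply: eq_bigr => i _; rewrite /rot_field !dc; ring.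
Qed.

(** Decompose e_i = si s + rho v with v a unit tangent vector. The line s + t e_i projects to the
    rotation of s by the angle atan (rho t / (1 + si t)), whose derivative at 0 is rho.
    Differentiability of [Bop b h] is obtained here, not assumed. *)
Lemma is_derive_Bop h s i : (3 <= d)%N -> Ck 3 (h \o sproj) ->
  (forall s, S s -> h (- s) = h s) -> S s ->
  is_derive s (e_ i) (Bop b h \o sproj) (sym_op b (rot_field s (e_ i) (h \o sproj)) s).
Proof.
move=> d3 CH eh Ss; set H := h \o sproj.
have hH : zhom H by move=> a x a0 _; rewrite /H/= sprojZ.
have eH : even_away H.
  by move=> x x0; rewrite /H/= sprojN eh//; exact: sproj_sphere.
have ss := (sphereP s).1 Ss.
pose si := s ord0 i; pose p : 'rV[R]_d := e_ i - si *: s.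
have ei : dotv (e_ i) s = si.
  rewrite dotvC /dotv (bigD1 i)//= big1 ?addr0 ?mxE ?eqxx ?mulr1// => j ji.
  by rewrite mxE (negPf ji) andbF mulr0.
have ps : dotv p s = 0 by rewrite /p dotvDl dotvNl dotvZl ss ei mulr1 subrr.
(* When e_i is normal to the sphere at s, any unit tangent v will do, with rho = 0. *)
have [v [vv vs [rho pE]]] : exists v, [/\ dotv v v = 1, dotv v s = 0 & exists rho : R, p = rho *: v].
  have [p0|p0] := eqVneq p 0.
    have [v [vv vs _]] := exists_unit_orthogonal s s d3.
    by exists v; split => //; exists 0; rewrite scale0r.
  exists (sproj p); split; first exact/sphereP/sproj_sphere.
    by rewrite dotvZl ps mulr0.
  by exists (enorm p); rewrite /sproj scalerA divff ?scale1r// enorm_eq0.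
have sv : dotv s v = 0 by rewrite dotvC.
have Sv : S v by apply/sphereP.
pose th (t : R) := atan (rho * t / (1 + si * t)).
have dth : is_derive (0 : R) 1 th rho.
  have q1 : is_derive (0 : R) 1 (fun t : R => rho * t) rho.
    by have := is_deriveZ rho (is_derive_id (0 : R) (1 : R)); rewrite [_ *: 1]mulr1; exact.
  pose k (t : R) := 1 + si * t.
  have k1 : k 0 = 1 by rewrite /k mulr0 addr0.
  have q2 : is_derive (0 : R) 1 k si.
    have q : is_derive (0 : R) 1 (fun t : R => si * t) si.
      by have := is_deriveZ si (is_derive_id (0 : R) (1 : R)); rewrite [_ *: 1]mulr1; exact.
    by have := is_deriveD (is_derive_cst (1 : R) (0 : R) (1 : R)) q; rewrite add0r; exact.
  have q0 : k 0 != 0 by rewrite k1 oner_neq0.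
  have q3 : is_derive (0 : R) 1 (fun t : R => (k t)^-1) (- si).
    split; first exact: derivableV q0 q2.(ex_derive).
    apply: etrans (deriveV q0 q2.(ex_derive)) _.
    by rewrite (@derive_val _ _ _ _ _ _ _ q2) k1 expr1n invr1 [_ *: _]mulN1r.
  pose m (t : R) := rho * t / k t.
  have m0 : m 0 = 0 by rewrite /m mulr0 mul0r.
  have q4 : is_derive (0 : R) 1 m rho.
    have := is_deriveM q1 q3.
    rewrite k1 invr1 scale1r (_ : rho * 0 *: - si = 0) ?add0r; first by exact.
    by rewrite mulr0 scale0r.
  have q5 := is_derive1_atan (m 0).
  have := is_derive1_comp q5 q4.
  by rewrite m0 expr0n addr0 invr1 mul1r; exact.
have th0 : th 0 = 0 by rewrite /th mulr0 mul0r atan0.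
have ds := is_derive_sym_op_rot CH hH eH Ss Sv sv; rewrite -th0 in ds.
have dc := is_derive1_comp ds dth.
(* [rot_field] is linear in its second vector and vanishes when that vector is s, so only the
   tangential part rho v of e_i contributes. The one-term sum lets [sym_op_lincomb] take out the
   scalar. *)
have val : sym_op b (rot_field s v H) s * rho = sym_op b (rot_field s (e_ i) H) s.
  have -> : rot_field s (e_ i) H = fun y => \sum_(k <- [:: tt]) rho * rot_field s v H y.
    apply/funext => y; rewrite big_seq1.
    have -> : e_ i = rho *: v + si *: s by rewrite -pE /p subrK.
    rewrite /rot_field !dotvDr !dotvZr; ring.
  rewrite (@sym_op_lincomb unit _ (fun=> rho) (fun=> rot_field s v H) s _ Ss).
    by rewrite big_seq1 mulrC.
  move=> _; split; first exact: Ck_rot_field.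
    by apply: rot_field_zhom => //; exact: CkW (CkW CH).
  by apply: rot_field_even => //; exact: CkW (CkW CH).
rewrite -val.
have E : \forall t \near (0 : R), ((fun u : R => sym_op b H (rot s v u s)) \o th) t =
    (Bop b h \o sproj) (s + t *: e_ i).
  have : \forall t \near (0 : R), 0 < 1 + si * t.
    have c : {for (0 : R), continuous (fun t : R => 1 + si * t)}.
      by apply: cvgD; [exact: cvg_cst|apply: cvgMr; exact: cvg_id].
    have cl := (cvgrPdist_lt _ _).1 c 1 ltr01.
    near=> t; have : `|1 + si * 0 - (1 + si * t)| < 1 by near: t; exact: cl.
    by rewrite mulr0 addr0 ltr_distlC => /andP[+ _]; rewrite subrr.
  apply: filterS => t t0 /=.
  have -> : s + t *: e_ i = (1 + si * t) *: s + (rho * t) *: v.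
    have -> : e_ i = rho *: v + si *: s by rewrite -pE /p subrK.
    by apply/rowP => k; rewrite !mxE; ring.
  rewrite sproj_rot// -/(th t).
  have Sr : S (rot s v (th t) s) by exact/(isometry_sphere s (rot_isometry (th t) ss vv sv)).
  rewrite (@eq_Bop _ _ _ _ H)//; first by rewrite Bop_sym_op//; exact: CkW.
  by move=> x Sx; rewrite /H/= sproj_id.
have dB := near_eq_is_derive E dc.
have EE : (fun k : R => k^-1 *: (((Bop b h \o sproj) \o shift s) (k *: e_ i) - (Bop b h \o sproj) s)) =
  (fun k : R => k^-1 *: (((fun t : R => (Bop b h \o sproj) (s + t *: e_ i)) \o shift 0) (k *: 1)
    - (fun t : R => (Bop b h \o sproj) (s + t *: e_ i)) 0)).
  by apply/funext => k /=; rewrite scale0r !addr0 [_%:A]mulr1 (addrC s).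
split; first by rewrite /derivable EE; exact: dB.(ex_derive).
by rewrite /derive EE; exact: (@derive_val _ _ _ _ _ _ _ dB).
Unshelve. all: by end_near. Qed.

End derivative_of_the_operator.

(** * The pointwise lower bound for Gamma_2 *)

Section pointwise_curvature.
Context (R : realType) (d : nat) (b : R -> \bar R).
Hypothesis b_meas : measurable_fun (`[-1, 1]%classic : set R) b.
Hypothesis b_ge0 : forall t, -1 <= t <= 1 -> (0 <= b t)%E.
Hypothesis b_int : forall s : 'rV[R]_d, sphere R d s ->
      (\int[surface_measure]_(s' in sphere R d)
         ((1 - dotv s s' ^+ 2)%:E * b (dotv s s')) < +oo)%E.
Implicit Types (s x y v w q : 'rV[R]_d) (u F H : 'rV[R]_d -> R).
Local Notation mu := (@surface_measure R d).
Local Notation S := (sphere R d).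
Local Notation e_ i := (delta_mx (0 : 'I_1) i : 'rV[R]_d).

Definition moment s : R := (\int[mu]_(x in S) ((1 - dotv x s ^+ 2) * bfin b (dotv x s)))%R.

Lemma measurable_sin2 s : measurable_fun S (fun x => 1 - dotv x s ^+ 2).
Proof.
apply: measurable_funB; first exact: measurable_cst.
by apply: measurable_funX; exact: measurable_dotv_fix.
Qed.

Lemma integrable_moment s : S s ->
  mu.-integrable S (EFin \o (fun x => (1 - dotv x s ^+ 2) * bfin b (dotv x s))).
Proof.
move=> Ss; apply: (@integrable_kernel _ _ b b_meas b_ge0 b_int _ s S 1) => //.
- exact: measurable_sphere.
- exact: measurable_sin2.
- by move=> x Sx; rewrite mul1r ger0_norm// subr_ge0 sphere_dotv_le1.
Qed.

Lemma moment_ge0 s : S s -> 0 <= moment s.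
Proof.
move=> Ss; apply: Rintegral_ge0 => x Sx; rewrite mulr_ge0 ?subr_ge0 ?sphere_dotv_le1//.
by rewrite bfin_ge0// dotv_itv.
Qed.

Lemma moment_const s s' : S s -> S s' -> moment s = moment s'.
Proof.
move=> Ss Ss'; have ss' : dotv s s = dotv s' s'.
  by rewrite (sphereP s).1// (sphereP s').1.
have ri := reflection_isometry (s - s').
have dv x : dotv (reflection (s - s') x) s' = dotv x s.
  by have := ri.2 x s; rewrite (reflection_swap ss').
rewrite /moment /Rintegral; congr fine.
rewrite -(surface_integral_isometry (f := reflection (s - s'))
  (F := fun x => ((1 - dotv x s' ^+ 2) * bfin b (dotv x s'))%:E))//.
  by apply: eq_integral => x _; rewrite dv.
exact: measurable_int (integrable_moment Ss').
Qed.

Lemma sqr_dotv_tangent_le s v x : S s -> dotv v s = 0 -> S x ->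
  dotv x v ^+ 2 <= dotv v v * (1 - dotv x s ^+ 2).
Proof.
move=> /sphereP ss vs /sphereP xx.
have := cauchy_schwarz (x - dotv x s *: s) v.
rewrite !dotvDl !dotvDr !dotvNl !dotvNr !dotvZl !dotvZr ss xx (dotvC s v) vs (dotvC s x).
rewrite mulr0 subr0 => h; apply: le_trans h _.
by rewrite le_eqVlt; apply/orP; left; apply/eqP; ring.
Qed.

Definition moment2 s v : R := (\int[mu]_(x in S) (dotv x v ^+ 2 * bfin b (dotv x s)))%R.

Lemma integrable_moment2 s v : S s -> dotv v s = 0 ->
  mu.-integrable S (EFin \o (fun x => dotv x v ^+ 2 * bfin b (dotv x s))).
Proof.
move=> Ss vs; apply: (@integrable_kernel _ _ b b_meas b_ge0 b_int _ s S (dotv v v)) => //.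
- exact: measurable_sphere.
- by apply: measurable_funX; exact: measurable_dotv_fix.
- by move=> x Sx; rewrite ger0_norm ?sqr_ge0// sqr_dotv_tangent_le.
Qed.

Lemma moment2_swap s v w : S s -> dotv v s = 0 -> dotv w s = 0 ->
  dotv v v = dotv w w -> moment2 s v = moment2 s w.
Proof.
move=> Ss vs ws vw; have ri := reflection_isometry (v - w).
have rs : reflection (v - w) s = s.
  by apply: reflection_id; rewrite dotvDr dotvNr !(dotvC s) vs ws subrr.
have dw x : dotv (reflection (v - w) x) w = dotv x v.
  by have := ri.2 x v; rewrite (reflection_swap vw).
have ds x : dotv (reflection (v - w) x) s = dotv x s.
  by have := ri.2 x s; rewrite rs.
rewrite /moment2 /Rintegral; congr fine.
rewrite -(surface_integral_isometry (f := reflection (v - w))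
  (F := fun x => (dotv x w ^+ 2 * bfin b (dotv x s))%:E))//.
  by apply: eq_integral => x _; rewrite dw ds.
exact: measurable_int (integrable_moment2 Ss ws).
Qed.

Lemma moment2Z s v a : S s -> dotv v s = 0 -> moment2 s (a *: v) = a ^+ 2 * moment2 s v.
Proof.
move=> Ss vs; rewrite /moment2 -RintegralZl//; last 2 first.
- exact: measurable_sphere.
- exact: integrable_moment2.
by apply: eq_Rintegral => x _; rewrite dotvZr; ring.
Qed.

(** Scaling each vector by the norm of the other makes the norms equal without a division, so zero
    vectors need no separate treatment. *)
Lemma moment2_proportional s v w : S s -> dotv v s = 0 -> dotv w s = 0 ->
  dotv w w * moment2 s v = dotv v v * moment2 s w.
Proof.
move=> Ss vs ws; rewrite -!sqr_enorm -!moment2Z//.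
apply: moment2_swap => //; rewrite ?dotvZl ?dotvZr ?vs ?ws ?mulr0// -!sqr_enorm; ring.
Qed.

Lemma dotv_delta w i : dotv w (e_ i) = w ord0 i.
Proof.
rewrite /dotv (bigD1 i)//= big1 ?addr0 ?mxE ?eqxx ?mulr1// => j ji.
by rewrite mxE (negPf ji) andbF mulr0.
Qed.

(** Parseval for the tangential projections of the standard basis: they form a tight frame of the
    tangent space at s, and are used in place of an orthonormal tangent basis. *)
Lemma sum_sqr_proj s x : S s ->
  \sum_(i < d) dotv x (e_ i - s ord0 i *: s) ^+ 2 = dotv x x - dotv x s ^+ 2.
Proof.
move=> /sphereP ss.
transitivity (\sum_(i < d) (x ord0 i * x ord0 i + dotv x s ^+ 2 * (s ord0 i * s ord0 i)
   + - 2 * dotv x s * (x ord0 i * s ord0 i))).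
  by apply: eq_bigr => i _; rewrite dotvDr dotvNr dotvZr dotv_delta; ring.
rewrite !big_split/= -!mulr_sumr -/(dotv x x) -/(dotv s s) -/(dotv x s) ss; ring.
Qed.

Lemma sum_dotv_proj s : S s ->
  \sum_(i < d) dotv (e_ i - s ord0 i *: s) (e_ i - s ord0 i *: s) = d%:R - 1.
Proof.
move=> /sphereP ss.
transitivity (\sum_(i < d) (1 - s ord0 i * s ord0 i)).
  apply: eq_bigr => i _; rewrite !dotvDl !dotvDr !dotvNl !dotvNr !dotvZl !dotvZr !dotv_delta ss.
  rewrite (dotvC (e_ i) s) dotv_delta mxE !eqxx/=; ring.
by rewrite sumrB sumr_const card_ord -/(dotv s s) ss.
Qed.

(** By symmetry about s, [moment2] depends on the tangent vector only through its squared norm.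
    Summing over the projected basis gives total squared norm d - 1 on one side and, by Parseval,
    the weight 1 - t^2 on the other. *)
Lemma moment2E s v : S s -> dotv v s = 0 ->
  (d%:R - 1) * moment2 s v = dotv v v * moment s.
Proof.
move=> Ss vs; have ss := (sphereP s).1 Ss.
have ps i : dotv (e_ i - s ord0 i *: s) s = 0.
  by rewrite dotvDl dotvNl dotvZl ss mulr1 dotvC dotv_delta subrr.
rewrite -(sum_dotv_proj Ss) mulr_suml.
under eq_bigr do rewrite (moment2_proportional Ss vs (ps _)).
rewrite -mulr_sumr; congr (_ * _).
have mS := @measurable_sphere R d.
transitivity (\int[mu]_(x in S) (\sum_(i < d) dotv x (e_ i - s ord0 i *: s) ^+ 2 * bfin b (dotv x s)))%R; last first.
  by apply: eq_Rintegral => x /[!inE] Sx; rewrite -mulr_suml sum_sqr_proj// (sphereP x).1.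
have im i := integrable_moment2 Ss (ps i).
elim: (index_enum _) => [|i r IH].
  rewrite big_nil /Rintegral; under eq_integral do rewrite big_nil.
  by rewrite integral0.
rewrite big_cons IH -RintegralD//.
  by apply: eq_Rintegral => x _; rewrite big_cons.
have := integrable_sum mS r (P := xpredT) (fun i _ => im i).
by apply: eq_integrable => // x _; rewrite /= sumEFin.
Qed.

(** The gradient has degree -1 when H is constant along rays; the factor |y|^2 restores degree 0
    without changing the values on the sphere. *)
Lemma Ck_grad_norm k H : Ck k.+1 H -> Ck k (fun y => dotv y y * dotv (grad H y) (grad H y)).
Proof.
move=> CH; apply: CkM; first by apply: Ck_sum => i; apply: CkM; exact: Ck_coord.
apply: (@Ck_eq _ _ _ (fun y => \sum_i 'D_(e_ i) H y * 'D_(e_ i) H y)).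
  by move=> x _; apply: eq_bigr => i _; rewrite !mxE.
by apply: Ck_sum => i; apply: CkM; exact: Ck_derive.
Qed.

(** Completion of the square. Let w = (x . s) q - (x . q) s, the value at x of the infinitesimal
    rotation taking s in the direction q. The left side is |g|^2 - 2 g . w + |q|^2, that is |g -
    w|^2 + |q|^2 - |w|^2, with |w|^2 = (x . s)^2 |q|^2 + (x . q)^2. *)
Lemma curvature_identity (s q x g : 'rV[R]_d) : dotv s s = 1 -> dotv x x = 1 ->
  dotv q s = 0 -> dotv g x = 0 ->
  dotv g g - dotv q q - 2 * ((dotv x s * dotv g q - dotv x q * dotv g s) - dotv q q) =
  dotv q q * (1 - dotv x s ^+ 2) - dotv x q ^+ 2
  + dotv (g - dotv x s *: q + dotv x q *: s) (g - dotv x s *: q + dotv x q *: s).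
Proof.
move=> ss xx qs gx.
rewrite !dotvDl !dotvDr !dotvNl !dotvNr !dotvZl !dotvZr (dotvC q g) (dotvC s g) (dotvC s q) ss qs.
move: (dotv g g) (dotv q q) (dotv x s) (dotv g q) (dotv x q) (dotv g s) => *; ring.
Qed.

(** Freezing q, the gradient at s, gathers all tangential derivatives of [Bop b h] into one rotation
    field X. Then 2 Gamma_2 is the operator applied to N - 2 X at s, where N extends |grad h|^2, and
    [curvature_identity] bounds its integrand. *)
Theorem Gamma2_ge h s : (3 <= d)%N -> Ck 3 (h \o sproj) ->
  (forall s, S s -> h (- s) = h s) -> S s ->
  2^-1 * ((d%:R - 2) / (d%:R - 1)) * moment s * Gamma_Delta h h s <= Gamma2_B_Delta b h h s.
Proof.
move=> d3 CH eh Ss; pose H := h \o sproj; pose q := grad H s.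
have ss := (sphereP s).1 Ss.
have hH : zhom H by move=> a x a0 _; rewrite /H/= sprojZ.
have eH : even_away H.
  by move=> x x0; rewrite /H/= sprojN eh//; exact: sproj_sphere.
have CH2 : Ck 2 H := CkW CH; have CH1 := CkW CH2.
have qs : dotv q s = 0 by apply: euler_zhom => //; exact: sphere_neq0.
pose N y := dotv y y * dotv (grad H y) (grad H y).
have CN : Ck 2 N by exact: Ck_grad_norm.
have gs a x : a != 0 -> (forall y, y != 0 -> H (a *: y) = H y) -> x != 0 -> N (a *: x) = N x.
  move=> a0 Ha x0; rewrite /N -(grad_scale CH1 a0 Ha x0) !dotvZl !dotvZr; ring.
have hN : zhom N by move=> a x a0 x0; apply: gs => //; [exact: lt0r_neq0|move=> y; exact: hH].
have eN : even_away N.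
  move=> x x0; rewrite -[- x]scaleN1r; apply: gs => //.
  by move=> y y0; rewrite scaleN1r eH.
pose X := rot_field s q H.
have CX : Ck 2 X by exact: Ck_rot_field.
have hX : zhom X by exact: rot_field_zhom.
have eX : even_away X by exact: rot_field_even.
have GE x : Gamma_Delta h h x = dotv (grad H x) (grad H x) by [].
have B1 : Bop b (Gamma_Delta h h) s = sym_op b N s.
  apply: etrans (Bop_sym_op b_meas b_ge0 b_int CN hN eN Ss).
  by apply: eq_Bop => // x /sphereP xx; rewrite GE /N xx mul1r.
have hF i : [/\ Ck 2 (rot_field s (e_ i) H), zhom (rot_field s (e_ i) H)
    & even_away (rot_field s (e_ i) H)].
  by split; [exact: Ck_rot_field|exact: rot_field_zhom|exact: rot_field_even].
have XE : X = fun y => \sum_i q ord0 i * rot_field s (e_ i) H y.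
  by apply/funext => y; exact: rot_field_sum.
have B2 : Gamma_Delta (Bop b h) h s = sym_op b X s.
  rewrite XE.
  apply: etrans (esym (sym_op_lincomb b_meas b_ge0 b_int (index_enum _) (fun i => q ord0 i) hF Ss)).
  rewrite /Gamma_Delta /dotv; apply: eq_bigr => i _.
  have D := is_derive_Bop b_meas b_ge0 b_int i d3 CH eh Ss.
  have -> : sphere_grad (Bop b h) s ord0 i = sym_op b (rot_field s (e_ i) H) s.
    by rewrite mxE; exact: (@derive_val _ _ _ _ _ _ _ D).
  by rewrite mulrC.
have B3 : Gamma_Delta h (Bop b h) s = sym_op b X s by rewrite -B2 /Gamma_Delta dotvC.
have mS := @measurable_sphere R d.
have iN := integrable_sym_op b_meas b_ge0 b_int CN hN eN Ss.
have iX := integrable_sym_op b_meas b_ge0 b_int CX hX eX Ss.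
have iX2 : mu.-integrable S (EFin \o (fun x => 2 * (sym_diff X s x * bfin b (dotv x s)))).
  by have := integrableZl mS 2 iX; apply: eq_integrable.
have qq : Gamma_Delta h h s = dotv q q by [].
have E : Gamma2_B_Delta b h h s =
    2^-1 * (\int[mu]_(x in S) (sym_diff N s x * bfin b (dotv x s) - 2 * (sym_diff X s x * bfin b (dotv x s))))%R.
  rewrite (RintegralB mS iN iX2) (RintegralZl _ mS iX) -/(sym_op b N s) -/(sym_op b X s) /Gamma2_B_Delta B1 B2 B3; ring.
have iM := integrable_moment Ss.
have iM2 := integrable_moment2 Ss qs.
have iMq : mu.-integrable S (EFin \o (fun x => dotv q q * ((1 - dotv x s ^+ 2) * bfin b (dotv x s)))).
  by have := integrableZl mS (dotv q q) iM; apply: eq_integrable.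
have d1 : d%:R - 1 != 0 :> R.
  by rewrite subr_eq0 (eqr_nat _ d 1); case: (d) d3 => [|[|]].
rewrite E -mulrA -mulrA ler_wpM2l ?invr_ge0// qq.
(* The second moment in the direction q is K |q|^2 / (d - 1), and 1 - 1 / (d - 1) = (d - 2) / (d -
   1). *)
have -> : (d%:R - 2) / (d%:R - 1) * (moment s * dotv q q) =
   (\int[mu]_(x in S) (dotv q q * ((1 - dotv x s ^+ 2) * bfin b (dotv x s)) - dotv x q ^+ 2 * bfin b (dotv x s)))%R.
  rewrite (RintegralB mS iMq iM2) (RintegralZl _ mS iM) -/(moment s) -/(moment2 s q).
  apply: (mulfI d1); rewrite mulrBr (moment2E Ss qs); field.
  exact: d1.
apply: le_Rintegral => //.
- have := integrableB mS iMq iM2; apply: eq_integrable => // x _.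
- have := integrableB mS iN iX2; apply: eq_integrable => // x _.
move=> x Sx; have xx := (sphereP x).1 Sx.
have b0 : 0 <= bfin b (dotv x s) by rewrite bfin_ge0// dotv_itv.
rewrite [leLHS](_ : _ = (dotv q q * (1 - dotv x s ^+ 2) - dotv x q ^+ 2) * bfin b (dotv x s)); last by ring.
rewrite [leRHS](_ : _ = (sym_diff N s x - 2 * sym_diff X s x) * bfin b (dotv x s)); last by ring.
apply: ler_wpM2r => //.
have key y : S y -> dotv q q * (1 - dotv y s ^+ 2) - dotv y q ^+ 2 <= N y - N s - 2 * (X y - X s).
  move=> Sy; have yy := (sphereP y).1 Sy.
  have gy : dotv (grad H y) y = 0 by apply: euler_zhom => //; exact: sphere_neq0.
  have := curvature_identity ss yy qs gy.
  rewrite /N /X /rot_field -/q ss yy !mul1r (dotvC s q) qs mul0r subr0 => ->.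
  by rewrite lerDl dotv_ge0.
(* The symmetrized differences average the inequality [key] at x and at its half-turn; there x . q
   changes sign, but it enters only squared. *)
have hi := half_turn_isometry ss.
have Sr : S (half_turn s x) by exact/(isometry_sphere x hi).
have := key x Sx; have := key _ Sr.
rewrite dotv_half_turn//.
have -> : dotv (half_turn s x) q = - dotv x q.
  by rewrite /half_turn dotvDl dotvNl dotvZl (dotvC s q) qs mulr0 add0r.
rewrite sqrrN /sym_diff.
move: (N x) (N (half_turn s x)) (N s) (X x) (X (half_turn s x)) (X s) => *; lra.
Qed.

End pointwise_curvature.

(** * Random orthonormal frames *)

Section gram_schmidt.
Context (R : realType) (d : nat).
Implicit Types (v : nat -> 'rV[R]_d) (x y : 'rV[R]_d).

Definition gs_step (l : seq 'rV[R]_d) x := sproj (x - \sum_(e <- l) dotv x e *: e).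

Fixpoint gs_seq v n :=
  if n is n'.+1 then rcons (gs_seq v n') (gs_step (gs_seq v n') (v n')) else [::].

Definition gs v k := gs_step (gs_seq v k) (v k).

Lemma gs_seqE v n : gs_seq v n = [seq gs v k | k <- iota 0 n].
Proof.
elim: n => // n IH.
by rewrite -(addn1 n) iotaD map_cat -IH cats1 add0n addn1.
Qed.

Definition gs_residual v k := v k - \sum_(j < k) dotv (v k) (gs v j) *: gs v j.

Lemma gsE v k : gs v k = sproj (gs_residual v k).
Proof.
rewrite {1}/gs /gs_step gs_seqE big_map /gs_residual.
by rewrite -(big_mkord xpredT (fun j => dotv (v k) (gs v j) *: gs v j)) /index_iota subn0.
Qed.

(** Gram-Schmidt uses only linear operations and inner products, so it commutes with linear
    isometries. *)
Lemma gs_isometry f v k : isometry f -> gs (fun j => f (v j)) k = f (gs v k).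
Proof.
move=> fi; elim/ltn_ind: k => k IH; rewrite !gsE -isometry_sproj//; congr sproj.
rewrite /gs_residual (isometryD fi) (isometryN _ fi); congr (_ - _).
rewrite (big_morph f (isometryD fi) (isometry0 fi)); apply: eq_bigr => j _.
by rewrite IH// fi.2 isometryZ.
Qed.

Lemma gs_orthonormal v n : (forall k, (k < n)%N -> gs_residual v k != 0) ->
  forall j k, (j < n)%N -> (k < n)%N -> dotv (gs v j) (gs v k) = (j == k)%:R.
Proof.
move=> v0.
have lt k : (k < n)%N -> forall j, (j < k)%N -> dotv (gs v k) (gs v j) = 0.
  elim/ltn_ind: k => k IH kn j jk.
  have jn := ltn_trans jk kn.
  rewrite [in gs v k]gsE dotvZl /gs_residual dotvDl dotvNl.
  rewrite (_ : dotv (\sum_(_ < _) _) _ = dotv (v k) (gs v j)) ?subrr ?mulr0//.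
  rewrite (big_morph (fun x => dotv x (gs v j)) (fun x y => dotvDl x y _) (dotv0l _)).
  rewrite (bigD1 (Ordinal jk))//= big1 ?addr0 => [|i ij].
    have /sphereP gj : sphere R d (gs v j) by rewrite gsE; apply: sproj_sphere; exact: v0.
    by rewrite dotvZl gj mulr1.
  rewrite dotvZl; have [ji|ij'|ijE] := ltngtP i j.
  - by rewrite (dotvC (gs v i)) (IH _ jk jn _ ji) mulr0.
  - by rewrite (IH _ (ltn_ord i) (ltn_trans (ltn_ord i) kn) _ ij') mulr0.
  - by move: ij; rewrite -val_eqE/= ijE eqxx.
move=> j k jn kn; have [jk|kj|->] := ltngtP j k.
- by rewrite dotvC lt.
- by rewrite lt.
- have /sphereP -> // : sphere R d (gs v k).
  by rewrite gsE; apply: sproj_sphere; exact: v0.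
Qed.

(** Extended by 0 beyond the last row, so that Gram-Schmidt can be indexed by natural numbers. *)
Definition rows (V : 'M[R]_d) (k : nat) : 'rV[R]_d := if insub k is Some i then row i V else 0.

Lemma rowsE V (i : 'I_d) : rows V i = row i V.
Proof. by rewrite /rows valK. Qed.

(** Triangularity: the residual is c V with coefficient 1 on row k and 0 on later rows. Were it
    zero, invertibility of V would force c = 0. *)
Lemma gs_residual_neq0 V k : V \in unitmx -> (k < d)%N -> gs_residual (rows V) k != 0.
Proof.
move=> Vu kd.
have res : forall k, (k < d)%N -> (forall j, (j < k)%N -> exists c : 'rV[R]_d,
      gs (rows V) j = c *m V /\ forall i : 'I_d, (j < i)%N -> c ord0 i = 0) ->
    exists c : 'rV[R]_d, [/\ gs_residual (rows V) k = c *m V, forall i : 'I_d, (k < i)%N -> c ord0 i = 0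
      & forall i : 'I_d, (i : nat) = k -> c ord0 i = 1].
  move=> {}k {}kd H.
  have /choice[c cP] : forall j : 'I_k, exists c : 'rV[R]_d,
      gs (rows V) j = c *m V /\ forall i : 'I_d, (j < i)%N -> c ord0 i = 0.
    by move=> j; exact: H.
  exists (delta_mx 0 (Ordinal kd) - \sum_(j < k) dotv (rows V k) (gs (rows V) j) *: c j); split.
  - rewrite /gs_residual mulmxBl -rowE (rowsE V (Ordinal kd)); congr (_ - _).
    rewrite mulmx_suml; apply: eq_bigr => j _.
    by rewrite -scalemxAl -(cP j).1.
  - move=> i ki; rewrite !mxE summxE big1 ?subr0.
      rewrite (_ : (i == Ordinal kd) = false) ?andbF//.
      by apply/eqP => ik; move: ki; rewrite ik ltnn.
    by move=> j _; rewrite mxE (cP j).2 ?mulr0// (ltn_trans (ltn_ord j)).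
  - move=> i ik; rewrite !mxE summxE big1 ?subr0.
      by rewrite (_ : i = Ordinal kd) ?eqxx//; exact: val_inj.
    by move=> j _; rewrite mxE (cP j).2 ?mulr0// ik.
have span : forall j, (j < d)%N -> exists c : 'rV[R]_d,
    gs (rows V) j = c *m V /\ forall i : 'I_d, (j < i)%N -> c ord0 i = 0.
  elim/ltn_ind => j IH jd.
  have [|c [cE c0 _]] := res j jd; first by move=> l lj; apply: IH => //; exact: ltn_trans jd.
  exists ((enorm (gs_residual (rows V) j))^-1 *: c); split.
    by rewrite gsE /sproj cE scalemxAl.
  by move=> i ji; rewrite mxE c0 ?mulr0.
have [|c [cE _ c1]] := res k kd; first by move=> j jk; apply: span; exact: ltn_trans kd.
apply/eqP => r0; have c0 : c = 0.
  by rewrite -[c](mulmxK Vu) -cE r0 mul0mx.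
have := c1 (Ordinal kd) erefl; rewrite c0 mxE => /esym/eqP.
by rewrite oner_eq0.
Qed.

Definition frame (V : 'M[R]_d) x : 'rV[R]_d := \row_(k < d) dotv x (gs (rows V) k).

Lemma frame_isometry V : V \in unitmx -> isometry (frame V).
Proof.
move=> Vu; pose E : 'M[R]_d := \matrix_(k < d) gs (rows V) k.
have -> : frame V = mulmx^~ E^T.
  apply/funext => x; apply/rowP => k; rewrite !mxE.
  by apply: eq_bigr => i _; rewrite !mxE.
apply: mulmx_isometry; rewrite trmxK; apply: mulmx1C.
apply/matrixP => i j; rewrite !mxE -val_eqE/=.
rewrite -(gs_orthonormal (v := rows V) (n := d))// => [|k kd].
  by apply: eq_bigr => l _; rewrite !mxE.
exact: gs_residual_neq0.
Qed.

(** A fixed rotation composed before the frame is absorbed into a right multiplication of the random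
    matrix; this is the source of all invariance of the random rotation. *)
Lemma frame_mulmx (A V : 'M[R]_d) x : A *m A^T = 1%:M ->
  frame V (x *m A) = frame (V *m A^T) x.
Proof.
move=> AA; apply/rowP => k; rewrite !mxE.
have fi : isometry (mulmx^~ A^T : 'rV[R]_d -> 'rV[R]_d).
  by apply: mulmx_isometry; rewrite trmxK; exact: mulmx1C.
have -> : rows (V *m A^T) = fun j => rows V j *m A^T.
  apply/funext => j; rewrite /rows; case: insub => [i|]; first by rewrite row_mul.
  by rewrite mul0mx.
rewrite (gs_isometry _ _ fi) -[LHS]fi.2 -mulmxA AA mulmx1//.
Qed.

End gram_schmidt.

Section frame_measurability.
Context (R : realType) (d : nat).
Local Notation Om := 'rV[R]_(d * d).

Lemma measurable_rows k i : measurable_fun setT (fun w : Om => rows (vec_mx w) k ord0 i).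
Proof.
rewrite /rows; case: insub => [j|]; last first.
  by under eq_fun do rewrite mxE; exact: measurable_cst.
under eq_fun do rewrite !mxE.
exact: measurable_coord.
Qed.

Lemma measurable_gs k : measurable_fun setT (fun w : Om => gs (rows (vec_mx w)) k).
Proof.
elim/ltn_ind: k => k IH.
under eq_fun do rewrite gsE.
apply: (measurableT_comp (@measurable_sproj R d)).
apply/measurable_fun_rVP => i.
have E : (fun w : Om => gs_residual (rows (vec_mx w)) k ord0 i) = (fun w : Om =>
   rows (vec_mx w) k ord0 i - \sum_(j < k) dotv (rows (vec_mx w) k) (gs (rows (vec_mx w)) j)
     * gs (rows (vec_mx w)) j ord0 i).
  apply/funext => w; rewrite /gs_residual [LHS]mxE [X in _ + X]mxE summxE; congr (_ - _).
  by apply: eq_bigr => j _; rewrite mxE.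
have mgs (j : 'I_k) i' : measurable_fun setT (fun w : Om => gs (rows (vec_mx w)) j ord0 i').
  exact: (measurableT_comp (measurable_coord i') (IH j (ltn_ord j))).
rewrite E; apply: measurable_funB; first exact: measurable_rows.
apply: measurable_sum => j; apply: measurable_funM; last exact: mgs.
by apply: measurable_dotv => i'; [exact: measurable_rows|exact: mgs].
Qed.

Lemma measurable_frame x : measurable_fun setT (fun w : Om => frame (vec_mx w) x).
Proof.
apply/measurable_fun_rVP => i; under eq_fun do rewrite mxE.
apply: measurable_dotv => j; first exact: measurable_cst.
exact: (measurableT_comp (measurable_coord j) (measurable_gs i)).
Qed.

(* Lebesgue measure on this set stands in for Haar measure: it is invariant under
   right multiplication by orthogonal matrices, which rotates the frame. *)
Definition good : set Om := @unit_ball R (d * d) `&` [set w | vec_mx w \in unitmx].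

Lemma measurable_good : measurable good.
Proof.
apply: measurableI; first exact: measurable_unit_ball.
have -> : [set w : Om | vec_mx w \in unitmx] = (fun w : Om => \det (vec_mx w : 'M[R]_d)) @^-1` (~` [set 0]).
  by apply/seteqP; split => w /=; rewrite unitmxE unitfE => /eqP.
have md : measurable_fun setT (fun w : Om => \det (vec_mx w : 'M[R]_d)).
  apply: measurable_sum => s; apply: measurable_funM; first exact: measurable_cst.
  apply: measurable_prod => i _; under eq_fun do rewrite mxE.
  exact: measurable_coord.
rewrite -[X in measurable X]setTI; apply: md => //.
by apply: measurableC; exact: measurable_set1.
Qed.

Definition act (A : 'M[R]_d) (w : Om) : Om := mxvec (vec_mx w *m A).

Lemma dotv_mxvec (M N : 'M[R]_d) : dotv (mxvec M) (mxvec N) = \sum_i dotv (row i M) (row i N).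
Proof.
rewrite /dotv (reindex _ (curry_mxvec_bij d d))/=.
rewrite pair_bigA/=; apply: eq_bigr => -[i j] _ /=.
by rewrite !mxvecE !mxE.
Qed.

Lemma act_isometry A : A *m A^T = 1%:M -> isometry (act A).
Proof.
move=> AA; split => [a x y|x y].
  by rewrite /act linearP/= mulmxDl -scalemxAl linearP.
have fi := mulmx_isometry AA.
rewrite /act -{2}(vec_mxK x) -{2}(vec_mxK y) !dotv_mxvec; apply: eq_bigr => i _.
by rewrite !row_mul fi.2.
Qed.

Lemma act_good A : A *m A^T = 1%:M -> act A @^-1` good = good.
Proof.
move=> AA; have Au : A \in unitmx by case/mulmx1_unit: AA.
have ai := act_isometry AA.
by apply/seteqP; split => w; rewrite /good/= /unit_ball/= isometry_enorm// /act mxvecK unitmx_mul Au andbT.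
Qed.

Lemma lebesgue_good_lty : (lebesgue_rV good < +oo)%E.
Proof.
apply: le_lt_trans (lebesgue_unit_ball_lty R (d * d)).
apply: le_measure; rewrite ?inE; last by move=> w [].
- exact: measurable_good.
- exact: measurable_unit_ball.
Qed.

(** If x V = 0, the column at which |x| is attained gives c |x| <= d e |x|, which forces x = 0. *)
Lemma diag_dominant_unitmx (V : 'M[R]_d) (c e : R) : 0 < c -> d%:R * e < c ->
  (forall i j, `|V i j - c * (i == j)%:R| <= e) -> V \in unitmx.
Proof.
move=> c0 dec Ve; rewrite -row_free_unit -kermx_eq0; apply/rowV0P => x /sub_kermxP xV.
apply/eqP; rewrite -normr_le0; apply/negPn/negP; rewrite -ltNge => x0.
have [m mE] := mx_norm_neq0 (lt0r_neq0 x0).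
have xm : `|x| = `|x ord0 m.2| by rewrite [LHS]mE (ord1 m.1).
have xi i : `|x ord0 i| <= `|x|.
  rewrite [leRHS]/Num.Def.normr/= mx_normrE.
  by apply: le_trans; last exact: (le_bigmax _ _ (ord0, i)).
have : `|c * x ord0 m.2| <= d%:R * e * `|x|.
  have -> : c * x ord0 m.2 = - \sum_i x ord0 i * (V i m.2 - c * (i == m.2)%:R).
    have xV0 : \sum_i x ord0 i * V i m.2 = 0 by have : (x *m V) ord0 m.2 = 0; [rewrite xV mxE|rewrite mxE].
    under [in RHS]eq_bigr do rewrite mulrBr.
    rewrite sumrB xV0 sub0r opprK (bigD1 m.2)//= big1 ?addr0.
      by rewrite eqxx mulr1 mulrC.
    by move=> i im; rewrite (negPf im) !mulr0.
  rewrite normrN; apply: le_trans (ler_norm_sum _ _ _) _.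
  apply: (@le_trans _ _ (\sum_(i < d) (`|x| * e))).
    by apply: (@ler_sum R) => i _; rewrite normrM ler_pM.
  by rewrite sumr_const card_ord -(mulr_natl (_ * e)) mulrAC mulrA.
by rewrite normrM (gtr0_norm c0) -xm ler_pM2r// leNgt dec.
Qed.

(** A box of half-width e around (r / 2) times the identity lies in the good set: its entries are at
    most r / 2 + e <= r = 1 / (d^2 + 1), which keeps it in the unit ball, and d e < r / 2 makes the
    matrices diagonally dominant. *)
Lemma lebesgue_good_gt0 : (0 < lebesgue_rV good)%E.
Proof.
pose r : R := (d * d).+1%:R^-1.
have r0 : 0 < r by rewrite invr_gt0.
pose e := r / (4 * d.+1%:R).
have e0 : 0 < e by rewrite divr_gt0// mulr_gt0.
have d1 : 1 <= d.+1%:R :> R by rewrite ler1n.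
have e2 : e <= r / 4.
  by rewrite /e ler_pM2l// lef_pV2 ?posrE ?mulr_gt0// ler_peMr.
have de : d%:R * e < r / 2.
  have h : d.+1%:R * e = r / 4 by rewrite /e; field; rewrite gt_eqF// (lt_le_trans ltr01).
  apply: (@le_lt_trans _ _ (d.+1%:R * e)); first by rewrite ler_pM2r// ler_nat.
  by rewrite h; lra.
pose c : Om := mxvec ((r / 2)%:M : 'M[R]_d).
pose B := (fun w : Om => w - c) @^-1` [set w | forall i, `|w ord0 i| <= e].
have mB : measurable B.
  rewrite -[X in measurable X]setTI; apply: measurable_shift => //; exact: measurable_box.
have B0 : (0 < lebesgue_rV B)%E.
  by rewrite /B lebesgue_rV_shift ?lebesgue_rV_box_gt0//; exact: measurable_box.
apply: lt_le_trans B0 _; apply: le_measure; rewrite ?inE//; first exact: measurable_good.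
move=> w Bw.
have wE i j : `|vec_mx w i j - r / 2 * (i == j)%:R| <= e.
  have := Bw (mxvec_index i j); rewrite mxE [X in _ + X]mxE mxvecE !mxE.
  by rewrite mulr_natr.
split => /=.
  apply: box_sub_unit_ball => k; case/mxvec_indexP: k => i j.
  have := wE i j; rewrite mxE => h.
  have : `|r / 2 * (i == j)%:R| <= r / 2.
    by case: (i == j); rewrite ?mulr1 ?mulr0 ?normr0 ?ger0_norm// divr_ge0// ltW.
  have := ler_normD (w ord0 (mxvec_index i j) - r / 2 * (i == j)%:R) (r / 2 * (i == j)%:R).
  rewrite subrK -/r; move: h e2; lra.
by apply: (diag_dominant_unitmx _ de) => //; rewrite divr_gt0.
Qed.

End frame_measurability.

(** * A Poincare inequality for antiperiodic stationary processes *)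

Section antiperiodic.
Context (R : realType) dT (T : measurableType dT) (mu : {measure set T -> \bar R}) (A : set T).
Context (D : R -> T -> R) (D' : T -> R) (M : R).
Hypothesis mA : measurable A.
Hypothesis muA : (mu A < +oo)%E.
Hypothesis mD : forall t, measurable_fun A (D t).
Hypothesis D_bound : forall t x, A x -> `|D t x| <= M.
Hypothesis D_stationary : forall a t u,
  (\int[mu]_(x in A) (D (a + t) x * D (a + u) x))%R = (\int[mu]_(x in A) (D t x * D u x))%R.
Hypothesis D_antiperiodic : forall t x, A x -> D (t + pi) x = - D t x.

Let cor t u : R := (\int[mu]_(x in A) (D t x * D u x))%R.

Lemma bounded_integrable (f : T -> R) (C : R) : measurable_fun A f ->
  (forall x, A x -> `|f x| <= C) -> mu.-integrable A (EFin \o f).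
Proof.
move=> mf fC; apply: measurable_bounded_integrable => //.
exists C; split; first exact: num_real.
by move=> K CK x Ax; apply: le_trans (fC x Ax) (ltW CK).
Qed.

Lemma integrable_cor t u : mu.-integrable A (EFin \o (fun x => D t x * D u x)).
Proof.
apply: (bounded_integrable (C := M * M)); first exact: measurable_funM.
by move=> x Ax; rewrite normrM ler_pM// D_bound.
Qed.

Lemma cor_sym t u : cor t u = cor u t.
Proof. by apply: eq_Rintegral => x _; rewrite mulrC. Qed.

Lemma cor_shift t u : cor t u = cor (t - u) 0.
Proof. by rewrite /cor -(D_stationary u (t - u) 0) addr0 addrC subrK. Qed.

Lemma integrable_lin (a b c e : R) t u v w t' u' v' w' : mu.-integrable A (EFin \o (fun x =>
  a * (D t x * D t' x) + b * (D u x * D u' x) + c * (D v x * D v' x) + e * (D w x * D w' x))).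
Proof.
have i k p q := integrableZl mA k (integrable_cor p q).
have := integrableD mA (integrableD mA (integrableD mA (i a t t') (i b u u')) (i c v v')) (i e w w').
by apply: eq_integrable.
Qed.

Lemma Rintegral_lin (a b c e : R) t u v w t' u' v' w' :
  (\int[mu]_(x in A) (a * (D t x * D t' x) + b * (D u x * D u' x) + c * (D v x * D v' x)
    + e * (D w x * D w' x)))%R =
  a * cor t t' + b * cor u u' + c * cor v v' + e * cor w w'.
Proof.
have i k p q : mu.-integrable A (EFin \o (fun x => k * (D p x * D q x))).
  by have := integrableZl mA k (integrable_cor p q); apply: eq_integrable.
have i2 : mu.-integrable A (EFin \o (fun x => a * (D t x * D t' x) + b * (D u x * D u' x))).
  by have := integrableD mA (i a t t') (i b u u'); apply: eq_integrable.
have i3 : mu.-integrable A (EFin \o (fun x => a * (D t x * D t' x) + b * (D u x * D u' x) + c * (D v x * D v' x))).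
  by have := integrableD mA i2 (i c v v'); apply: eq_integrable.
rewrite (RintegralD mA i3 (i e w w')) (RintegralD mA i2 (i c v v')).
rewrite (RintegralD mA (i a t t') (i b u u')).
by rewrite !RintegralZl//; exact: integrable_cor.
Qed.

(** Shifting by pi / 2, the correlation of the angles pi / 2 and 0 equals that of pi and pi / 2,
    which is its opposite since D pi = - D 0. *)
Lemma cor_pihalf : cor (pi / 2) 0 = 0.
Proof.
have e1 : cor (pi / 2) 0 = cor pi (pi / 2).
  have -> : cor pi (pi / 2) = cor (pi / 2 + pi / 2) (pi / 2 + 0).
    by rewrite addr0 -splitr.
  by rewrite /cor D_stationary.
have e2 : cor pi (pi / 2) = - cor (pi / 2) 0.
  have -> : - cor (pi / 2) 0 = -1 * cor (pi / 2) 0 by rewrite mulN1r.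
  rewrite /cor -RintegralZl//; last exact: integrable_cor.
  apply: eq_Rintegral => x /[!inE] Ax.
  by have := D_antiperiodic 0 Ax; rewrite add0r => ->; ring.
lra.
Qed.

(* If the correlation at angle 2t is at most cos(2t) C(0), expanding the square
   of D(t) + D(-t) and using cos(2t) = 2 cos(t)^2 - 1 bounds the one at angle t. *)
Lemma cor_half t : 0 < cos t -> cor (2 * t) 0 <= cos (2 * t) * cor 0 0 ->
  cor t 0 <= cos t * cor 0 0.
Proof.
move=> c0 h; set c := cos t in c0 *.
have c2 : cos (2 * t) = 2 * c ^+ 2 - 1.
  by rewrite (_ : 2 * t = t *+ 2) ?mulr_natl// cos_mulr2n.
have e1 : cor (- t) 0 = cor t 0.
  by rewrite cor_sym cor_shift sub0r opprK.
have e2 u : cor u u = cor 0 0 by rewrite cor_shift subrr.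
have e3 : cor t (- t) = cor (2 * t) 0.
  by rewrite cor_shift opprK; congr cor; ring.
(* Young: D(0) Z <= c D(0)^2 + Z^2 / (4 c) with Z = D(t) + D(-t). *)
have young x : D t x * D 0 x + D (- t) x * D 0 x <= c * (D 0 x * D 0 x) + (4 * c)^-1 * (D t x * D t x)
    + (4 * c)^-1 * (D (- t) x * D (- t) x) + (2 * (4 * c)^-1) * (D t x * D (- t) x).
  set p := D 0 x; set z := D t x; set z' := D (- t) x.
  rewrite -subr_ge0 (_ : _ - _ = (4 * c)^-1 * (2 * c * p - (z + z')) ^+ 2); last first.
    by field; rewrite gt_eqF.
  by rewrite mulr_ge0 ?sqr_ge0// invr_ge0 mulr_ge0// ltW.
have : 2 * cor t 0 <= c * cor 0 0 + (4 * c)^-1 * cor t t + (4 * c)^-1 * cor (- t) (- t)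
    + (2 * (4 * c)^-1) * cor t (- t).
  rewrite -Rintegral_lin.
  have -> : 2 * cor t 0 = 1 * cor t 0 + 1 * cor (- t) 0 + 0 * cor 0 0 + 0 * cor 0 0.
    rewrite e1; ring.
  rewrite -Rintegral_lin; apply: le_Rintegral => //; [exact: integrable_lin|exact: integrable_lin|].
  move=> x _; rewrite !mul1r !mul0r !addr0; exact: young.
rewrite !e2 e3 => h2.
have : (2 * (4 * c)^-1) * cor (2 * t) 0 <= (2 * (4 * c)^-1) * (cos (2 * t) * cor 0 0).
  by rewrite ler_wpM2l// mulr_ge0// invr_ge0 mulr_ge0// ltW.
rewrite c2 => h3.
have E : c * cor 0 0 + (4 * c)^-1 * cor 0 0 + (4 * c)^-1 * cor 0 0 +
  2 * (4 * c)^-1 * ((2 * c ^+ 2 - 1) * cor 0 0) = 2 * (c * cor 0 0).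
  by field; rewrite gt_eqF.
lra.
Qed.

(** The exponent k + 1 makes the first angle pi / 2, where the correlation is known to vanish. *)
Let ang k : R := pi / 2 ^+ k.+1.

Lemma ang_gt0 k : 0 < ang k.
Proof. by rewrite divr_gt0 ?pi_gt0 ?exprn_gt0. Qed.

Lemma cor_ang k : cor (ang k) 0 <= cos (ang k) * cor 0 0.
Proof.
elim: k => [|k IH]; first by rewrite /ang expr1 cor_pihalf cos_pihalf mul0r.
have a2 : 2 * ang k.+1 = ang k.
  by rewrite /ang [X in _ / X]exprS; field; rewrite expf_neq0// pnatr_eq0.
apply: cor_half; last by rewrite a2.
have a1 : ang k <= pi / 2.
  rewrite /ang ler_pM2l ?pi_gt0// lef_pV2 ?posrE ?exprn_gt0// exprS ler_peMr// exprn_ege1//.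
  by rewrite ler1n.
apply: cos_gt0_pihalf; have := ang_gt0 k.+1; have := pi_gt0 R; move=> p0 p1.
by apply/andP; split; lra.
Qed.

Hypothesis D_derive : forall x, A x -> is_derive (0 : R) 1 (D ^~ x) (D' x).
Hypothesis D_lip : forall t x, A x -> `|D t x - D 0 x| <= M * `|t|.
Hypothesis mD' : measurable_fun A D'.

Lemma ang_cvg0 : ang k @[k --> \oo] --> 0.
Proof.
have -> : ang = fun k => (pi / 2) * (2^-1) ^+ k.
  by apply/funext => k; rewrite /ang exprS exprVn; field; rewrite expf_neq0// pnatr_eq0.
rewrite -[X in _ --> X](mulr0 (pi / 2)); apply: cvgMr; apply: cvg_expr.
by rewrite ger0_norm ?invr_ge0// invf_lt1// ltr1n.
Qed.

Lemma ang_quotient_cvg (f : R -> R) l : is_derive (0 : R) 1 f l ->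
  (f (ang k) - f 0) / ang k @[k --> \oo] --> l.
Proof.
move=> df; have [/cvg_ex[/= l' hl'] dE] := df.
have ll : l' = l by rewrite -dE /derive; apply/esym/cvg_lim.
rewrite ll in hl'.
have := (cvgr_dnbhsP _ _ _).1 hl' ang; rewrite /= => h.
have {}h := h (conj (fun k => lt0r_neq0 (ang_gt0 k)) ang_cvg0).
apply: cvg_trans h; apply: near_eq_cvg; near=> k.
by rewrite addr0 [_%:A]mulr1 [LHS]mulrC.
Unshelve. all: by end_near. Qed.

(** The difference quotient at the angle a = [ang k] has mean square 2 (C(0) - C(a)) / a^2, at least
    2 (1 - cos a) / a^2 times C(0), and this factor tends to 1. The quotients converge to D' and are
    bounded by the Lipschitz constant, so dominated convergence concludes. *)
Theorem antiperiodic_poincare :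
  (\int[mu]_(x in A) (D 0 x ^+ 2))%R <= (\int[mu]_(x in A) (D' x ^+ 2))%R.
Proof.
have E0 : (\int[mu]_(x in A) (D 0 x ^+ 2))%R = cor 0 0 by apply: eq_Rintegral => x _; rewrite expr2.
rewrite E0.
pose q k x := ((D (ang k) x - D 0 x) / ang k) ^+ 2.
have M0 x : A x -> 0 <= M by move=> Ax; apply: le_trans (D_bound 0 Ax).
have mq k : measurable_fun A (q k).
  apply: measurable_funX; apply: measurable_funM; last exact: measurable_cst.
  exact: measurable_funB.
have qM k x : A x -> `|q k x| <= M ^+ 2.
  move=> Ax; rewrite /q normrX lerXn2r ?nnegrE ?(M0 x)//.
  by rewrite normrM normfV ler_pdivrMr ?normr_gt0 ?lt0r_neq0 ?ang_gt0// D_lip.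
have low k : 2 * (1 - cos (ang k)) / (ang k) ^+ 2 * cor 0 0 <= (\int[mu]_(x in A) (q k x))%R.
  have a0 := ang_gt0 k.
  have -> : (\int[mu]_(x in A) (q k x))%R = (ang k)^-2 * cor (ang k) (ang k) + (ang k)^-2 * cor 0 0
     + (-2 * (ang k)^-2) * cor (ang k) 0 + 0 * cor 0 0.
    rewrite -Rintegral_lin; apply: eq_Rintegral => x _; rewrite /q; field.
    by rewrite gt_eqF.
  rewrite (cor_shift (ang k) (ang k)) subrr.
  have := cor_ang k; have : 0 < (ang k)^-2 by rewrite invr_gt0 exprn_gt0.
  move: (cor (ang k) 0) (cor 0 0) (cos (ang k)) ((ang k)^-2) => y z c w w0 h.
  have : w * y <= w * (c * z) by rewrite ler_pM2l.
  lra.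
have q_cvg x : A x -> q k x @[k --> \oo] --> D' x ^+ 2.
  move=> Ax; have h := ang_quotient_cvg (D_derive Ax).
  rewrite [X in _ --> X]expr2; apply: cvg_trans (cvgM h h); apply: near_eq_cvg.
  by apply: nearW => k; rewrite /q expr2.
have up : (\int[mu]_(x in A) (q k x))%R @[k --> \oo] --> (\int[mu]_(x in A) (D' x ^+ 2))%R.
  have iD' : mu.-integrable A (EFin \o (fun x => D' x ^+ 2)).
    apply: (bounded_integrable (C := M ^+ 2)); first exact: measurable_funX.
    move=> x Ax; have qc : `|q k x| @[k --> \oo] --> `|D' x ^+ 2|.
      exact: cvg_norm (q_cvg x Ax).
    apply: (cvgr_to_le qc); apply: nearW => k; exact: qM.
  rewrite /Rintegral; apply: fine_cvg; rewrite fineK; last exact: (integrable_fin_num mA iD').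
  apply: (@dominated_cvg _ _ R mu A mA (fun k x => (q k x)%:E) _ (fun=> (M ^+ 2)%:E)) => //.
  - by move=> k; exact/measurable_EFinP.
  - move=> x Ax; apply: cvg_EFin; first exact: nearW.
    exact: q_cvg.
  - by apply: (bounded_integrable (C := `|M ^+ 2|)) => //.
have lim1 : 2 * (1 - cos (ang k)) / (ang k) ^+ 2 * cor 0 0 @[k --> \oo] --> cor 0 0.
  rewrite -[X in _ --> X]mul1r; apply: cvgMl.
  (* Since [ang k.+1] is half of a = [ang k], the factor 2 (1 - cos a) / a^2 is the square of sin (a
     / 2) / (a / 2). *)
  have sl : sin (ang k.+1) / ang k.+1 @[k --> \oo] --> (1:R).
    have := ang_quotient_cvg (is_derive_sin 0); rewrite cos0 sin0 => h.
    have {}h : sin (ang k) / ang k @[k --> \oo] --> (1:R).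
      by apply: cvg_trans h; apply: near_eq_cvg; apply: nearW => k; rewrite subr0.
    by rewrite (cvg_shiftS (fun k => sin (ang k) / ang k)).
  rewrite -[X in _ --> X](mulr1 (1:R)); apply: cvg_trans (cvgM sl sl).
  apply: near_eq_cvg; apply: nearW => k.
  have -> : ang k = ang k.+1 *+ 2.
    by rewrite /ang [in RHS]exprS -mulr_natl; field; rewrite expf_neq0// pnatr_eq0.
  rewrite cos_mulr2n cos2sin2 -[ang k.+1 *+ 2]mulr_natl.
  rewrite /= -mulr_natl; move: (ang_gt0 k.+1) (sin _) => + sa; move: (ang _) => a a0.
  by field; rewrite gt_eqF.
apply: (ler_cvg_to lim1 up); exact: nearW.
Qed.

End antiperiodic.

(** * The spectral gap of even functions *)

Section rotation_facts.
Context (R : realType) (d : nat).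
Implicit Types (x y s v : 'rV[R]_d) (F : 'rV[R]_d -> R).

Lemma rotD s v (a t : R) x : dotv s s = 1 -> dotv v v = 1 -> dotv s v = 0 ->
  rot s v (a + t) x = rot s v a (rot s v t x).
Proof.
move=> ss vv sv; set xs := dotv x s; set xv := dotv x v.
have rs : dotv (rot s v t x) s = cos t * xs - sin t * xv.
  rewrite /rot /rotation !dotvDl !dotvZl ss (dotvC v s) sv -/xs -/xv; ring.
have rv : dotv (rot s v t x) v = sin t * xs + cos t * xv.
  rewrite /rot /rotation !dotvDl !dotvZl vv sv -/xs -/xv; ring.
rewrite [in RHS]/rot [in RHS]/rotation rs rv /rot /rotation cosD sinD -/xs -/xv.
apply/rowP => i; rewrite !mxE; ring.
Qed.

Lemma isometry_rot f s v (t : R) x : isometry f -> rot (f s) (f v) t (f x) = f (rot s v t x).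
Proof.
by move=> fi; rewrite /rot /rotation !fi.2 !(isometryD fi) !(isometryZ _ _ fi).
Qed.

Lemma reflectionZ (c : R) s x : c != 0 -> reflection (c *: s) x = reflection s x.
Proof.
move=> c0; have [->|s0] := eqVneq s 0; first by rewrite scaler0.
rewrite /reflection scalerA !dotvZl !dotvZr; congr (_ - _ *: _).
by field; rewrite dotv_eq0 s0 c0.
Qed.

(** The half-turn in the plane of s, v changes the sign of both components; for x orthogonal to v
    this is the reflection along s, which can be made to exchange two given points. *)
Lemma rot_pi s v x : dotv s s = 1 -> dotv x v = 0 -> rot s v pi x = reflection s x.
Proof.
move=> ss xv; rewrite /rot /rotation /reflection ss xv cospi sinpi.
by apply/rowP => i; rewrite !mxE; field.
Qed.

Lemma derive_lipschitz (g g' : R -> R) (C : R) : (forall t : R, is_derive t 1 g (g' t)) ->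
  (forall t, `|g' t| <= C) -> forall t, `|g t - g 0| <= C * `|t|.
Proof.
move=> dg gC t.
have cg a b : {within `[a, b], continuous g}.
  by apply: derivable_within_continuous => u _; exact: (dg u).(ex_derive).
have [t0|/ltW t0] := leP 0 t.
  have [|c _ ->] := @MVT_segment R g g' 0 t t0 => //.
  by rewrite subr0 normrM ler_wpM2r.
have [|c _ E] := @MVT_segment R g g' t 0 t0 => //.
by rewrite distrC E sub0r normrM normrN ler_wpM2r.
Qed.

Lemma grad_sqr_bound F : Ck 1 F -> exists2 M : R, 0 <= M &
  forall z, sphere R d z -> dotv (grad F z) (grad F z) <= M.
Proof.
move=> CF; have [M M0 HM] := Ck_bounded (Ck_grad_norm CF); exists M => // z Sz.
by have := HM z (sphere_annulus Sz); rewrite (sphereP z).1// mul1r ger0_norm ?dotv_ge0.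
Qed.

Lemma grad_bound F : Ck 1 F -> exists2 M : R, 0 <= M &
  forall z u, sphere R d z -> dotv u u = 1 -> `|dotv (grad F z) u| <= M.
Proof.
(* M bounds the square, and M <= (1 + M)^2. *)
move=> /grad_sqr_bound[M M0 HM]; exists (1 + M) => [|z u Sz uu]; first exact: addr_ge0.
have := cauchy_schwarz (grad F z) u; rewrite uu mulr1 => h.
rewrite -(ler_pXn2r (ltn0Sn 1)) ?nnegrE ?addr_ge0// real_normK ?num_real//.
apply: le_trans h _; apply: le_trans (HM z Sz) _; rewrite expr2; nra.
Qed.

Lemma dotv_le1 x y : dotv x x = 1 -> dotv y y = 1 -> `|dotv x y| <= 1.
Proof.
move=> xx yy; rewrite -(ler_pXn2r (ltn0Sn 1)) ?nnegrE// expr1n real_normK ?num_real//.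
by rewrite sphere_dotv_le1//; exact/sphereP.
Qed.

End rotation_facts.

Section random_frame.
Context (R : realType) (d : nat).
Implicit Types (x y s v : 'rV[R]_d) (F : 'rV[R]_d -> R).
Local Notation lam := (@lebesgue_rV R (d * d)).
Local Notation G := (@good R d).
Local Notation Psi w := (frame (vec_mx w)).
Local Notation S := (sphere R d).

Lemma frame_integral (K : ('rV[R]_d -> 'rV[R]_d) -> R) f : isometry f ->
  measurable_fun G (fun w => K (Psi w)) ->
  (\int[lam]_(w in G) K (Psi w \o f) = \int[lam]_(w in G) K (Psi w))%R.
Proof.
move=> /isometry_mx[A [AA ->]] mK.
have AA' : A^T *m A^T^T = 1%:M by rewrite trmxK; exact: mulmx1C.
have E w : Psi w \o mulmx^~ A = Psi (act A^T w).
  by apply/funext => x; rewrite /= frame_mulmx// /act mxvecK.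
have ai := act_isometry AA'.
rewrite /Rintegral; congr fine.
have mact : measurable_fun setT (act A^T) := measurable_isometry ai.
have lact B : measurable B -> lam (act A^T @^-1` B) = lam B := fun mB => lebesgue_isometry ai mB.
have mEK : measurable_fun G (fun w => (K (Psi w))%:E) by exact/measurable_EFinP.
have := invariant_integral mact lact (@measurable_good R d) (act_good AA') mEK.
by apply: etrans; apply: eq_integral => w _; rewrite E.
Qed.

Lemma good_isometry w : G w -> isometry (Psi w).
Proof. by move=> [_ Vu]; exact: frame_isometry. Qed.

Lemma frame_sphere w x : G w -> S x -> S (Psi w x).
Proof. by move=> /good_isometry fi Sx; exact/(isometry_sphere x fi). Qed.

Lemma measurable_frame_comp k F x : Ck k F -> S x -> measurable_fun G (fun w => F (Psi w x)).
Proof.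
move=> CF Sx; apply: (measurable_comp (@measurable_sphere R d) _ (Ck_measurable_sphere CF)).
- by move=> _ [w Gw <-]; exact: frame_sphere.
- by apply: measurable_funTS; exact: measurable_frame.
Qed.

Lemma measurable_frame_grad k F x v : Ck k.+1 F -> S x ->
  measurable_fun G (fun w => dotv (grad F (Psi w x)) (Psi w v)).
Proof.
move=> CF Sx; apply: measurable_dotv => i.
  under eq_fun do rewrite mxE.
  exact: (measurable_frame_comp (Ck_derive i CF)).
by apply: measurable_funTS; apply: (measurableT_comp (measurable_coord i)); exact: measurable_frame.
Qed.

(** The half-turn exchanges x and y up to the sign e, invisible to the even function F, so the
    difference process is antiperiodic; it is stationary because the random frame absorbs rotations.
    As x and y are orthogonal to v, only slopes in the direction v remain in its derivative at 0. *)
Lemma frame_rotation_poincare F x y s v e : Ck 1 F -> even_away F -> S x -> S y ->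
  dotv s s = 1 -> dotv v v = 1 -> dotv s v = 0 -> dotv x v = 0 -> dotv y v = 0 ->
  e = 1 \/ e = -1 -> rot s v pi x = e *: y -> rot s v pi y = e *: x ->
  (\int[lam]_(w in G) (F (Psi w x) - F (Psi w y)) ^+ 2 <=
   \int[lam]_(w in G) (dotv x s * dotv (grad F (Psi w x)) (Psi w v)
     - dotv y s * dotv (grad F (Psi w y)) (Psi w v)) ^+ 2)%R.
Proof.
move=> CF eF Sx Sy ss vv sv xv yv e1 rx ry.
have [M1 M10 HM1] := Ck_bounded CF.
have [M2 M20 HM2] := grad_bound CF.
have ri t := rot_isometry t ss vv sv.
have Srot t z : S z -> S (rot s v t z) by move=> Sz; exact/(isometry_sphere z (ri t)).
pose D t (w : 'rV[R]_(d * d)) := F (Psi w (rot s v t x)) - F (Psi w (rot s v t y)).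
pose D' (w : 'rV[R]_(d * d)) := dotv x s * dotv (grad F (Psi w x)) (Psi w v)
     - dotv y s * dotv (grad F (Psi w y)) (Psi w v).
have FN w z : G w -> S z -> F (Psi w (e *: z)) = F (Psi w z).
  move=> Gw Sz; case: e1 => ->; rewrite ?scale1r// scaleN1r (isometryN _ (good_isometry Gw)).
  by rewrite eF//; apply: sphere_neq0; exact: frame_sphere.
have dF w z (t : R) : G w -> S z -> is_derive t 1 (fun u : R => F (Psi w (rot s v u z)))
    (rot_field (Psi w s) (Psi w v) F (Psi w (rot s v t z))).
  move=> Gw Sz; have fi := good_isometry Gw.
  under eq_fun do rewrite -(isometry_rot s v _ z fi).
  rewrite -(isometry_rot s v _ z fi).
  apply: is_derive_rot => //; rewrite ?fi.2//.
  by apply: sphere_neq0; exact: frame_sphere.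
have dFM w z (t : R) : G w -> S z -> `|rot_field (Psi w s) (Psi w v) F (Psi w (rot s v t z))| <= 2 * M2.
  move=> Gw Sz; have fi := good_isometry Gw.
  have Sz' : S (Psi w (rot s v t z)) by apply: frame_sphere => //; exact: Srot.
  have zz := (sphereP _).1 Sz'.
  have bnd u u' : dotv u u = 1 -> dotv u' u' = 1 ->
      `|dotv (Psi w (rot s v t z)) (Psi w u) * dotv (grad F (Psi w (rot s v t z))) (Psi w u')| <= M2.
    move=> uu uu'; rewrite normrM -[leRHS]mul1r; apply: ler_pM => //.
      by apply: dotv_le1 => //; rewrite fi.2.
    by apply: HM2 => //; rewrite fi.2.
  by apply: le_trans (ler_normB _ _) _; rewrite mulr2n mulrDl mul1r lerD// bnd.
have mD t : measurable_fun G (D t).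
  by apply: measurable_funB; apply: measurable_frame_comp CF _; exact: Srot.
(* One constant serves both as a bound and as a Lipschitz constant: the process is bounded by 2 M1,
   and each of its two terms has derivative at most 2 M2. *)
have := @antiperiodic_poincare _ _ _ lam G D D' (2 * M1 + 4 * M2)
  (@measurable_good R d) (lebesgue_good_lty R d) mD.
have E0 : (\int[lam]_(w in G) (D 0 w ^+ 2) = \int[lam]_(w in G) (F (Psi w x) - F (Psi w y)) ^+ 2)%R.
  by apply: eq_Rintegral => w _; rewrite /D !rot0.
rewrite E0; apply.
- move=> t w Gw; apply: le_trans (ler_normB _ _) _.
  have h z : S z -> `|F (Psi w (rot s v t z))| <= M1.
    by move=> Sz; apply/HM1/sphere_annulus/frame_sphere => //; exact: Srot.
  have := h x Sx; have := h y Sy; move: (`|_|) (`|_|) => *; lra.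
- move=> a t u.
  pose K (psi : 'rV[R]_d -> 'rV[R]_d) := (F (psi (rot s v t x)) - F (psi (rot s v t y))) *
    (F (psi (rot s v u x)) - F (psi (rot s v u y))).
  transitivity (\int[lam]_(w in G) K (Psi w \o rot s v a))%R.
    by apply: eq_Rintegral => w _; rewrite /D /K/= !rotD.
  rewrite frame_integral//; exact: measurable_funM (mD t) (mD u).
- move=> t w Gw; rewrite /D (rotD t pi x ss vv sv) (rotD t pi y ss vv sv) rx ry !(isometryZ _ _ (ri t)).
  by rewrite !FN// ?opprB//; exact: Srot.
- move=> w Gw; have h1 := dF w x 0 Gw Sx; have h2 := dF w y 0 Gw Sy.
  have := is_deriveB h1 h2; rewrite (_ : _ - _ = D' w); first by exact.
  rewrite !rot0 /rot_field /D'.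
  have fi := good_isometry Gw.
  by rewrite !fi.2 xv yv !mul0r !subr0.
- move=> t w Gw.
  have h1 := derive_lipschitz (fun u => dF w x u Gw Sx) (fun u => dFM w x u Gw Sx) t.
  have h2 := derive_lipschitz (fun u => dF w y u Gw Sy) (fun u => dFM w y u Gw Sy) t.
  have -> : D t w - D 0 w = (F (Psi w (rot s v t x)) - F (Psi w (rot s v 0 x)))
     - (F (Psi w (rot s v t y)) - F (Psi w (rot s v 0 y))) by rewrite /D; ring.
  apply: le_trans (ler_normB _ _) _; have := normr_ge0 t.
  move: h1 h2; move: (`|_|) (`|_|) (`|t|) => p q r; nra.
- by apply: measurable_funB; apply: measurable_funM; (try exact: measurable_cst);
    exact: measurable_frame_grad CF _.
Qed.

End random_frame.

(** The two bounds on J are averaged with weights (1 + t) / 2 and (1 - t) / 2, of sum 1, chosen so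
    that P and Q get the same factor. *)
Lemma average_bounds (R : realFieldType) (J t P Q : R) : -1 <= t -> t <= 1 ->
  J <= (1 - 1 * t) / 2 * P -> J <= (1 - (-1) * t) / 2 * Q -> J <= (1 - t ^+ 2) / 4 * (P + Q).
Proof.
move=> tm tp hp hm.
have h1 : (1 + t) / 2 * J <= (1 + t) / 2 * ((1 - 1 * t) / 2 * P) by apply: ler_wpM2l => //; lra.
have h2 : (1 - t) / 2 * J <= (1 - t) / 2 * ((1 - (-1) * t) / 2 * Q) by apply: ler_wpM2l => //; lra.
lra.
Qed.

(** * Mean-square increments of a randomly rotated function *)

Section frame_variance.
Context (R : realType) (d : nat) (F : 'rV[R]_d -> R).
Hypothesis CF : Ck 1 F.
Hypothesis hF : zhom F.
Hypothesis eF : even_away F.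
Implicit Types (x y s v : 'rV[R]_d).
Local Notation lam := (@lebesgue_rV R (d * d)).
Local Notation G := (@good R d).
Local Notation Psi w := (frame (vec_mx w)).
Local Notation S := (sphere R d).
Local Notation e_ i := (delta_mx (0 : 'I_1) i : 'rV[R]_d).
Local Notation slope x v w := (dotv (grad F (Psi w x)) (Psi w v)).

Definition frame_energy x : R :=
  (\int[lam]_(w in G) dotv (grad F (Psi w x)) (grad F (Psi w x)))%R.

Definition frame_slope2 x v : R := (\int[lam]_(w in G) (slope x v w ^+ 2))%R.

Definition frame_variance x y : R := (\int[lam]_(w in G) (F (Psi w x) - F (Psi w y)) ^+ 2)%R.

Lemma measurable_frame_energy x : S x ->
  measurable_fun G (fun w => dotv (grad F (Psi w x)) (grad F (Psi w x))).
Proof.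
by move=> Sx; apply: measurable_dotv => i; under eq_fun do rewrite mxE;
  exact: measurable_frame_comp (Ck_derive i CF) Sx.
Qed.

Lemma frame_energy_const x y : S x -> S y -> frame_energy x = frame_energy y.
Proof.
move=> Sx Sy; have xy : dotv x x = dotv y y by rewrite !(sphereP _).1.
pose K (psi : 'rV[R]_d -> 'rV[R]_d) := dotv (grad F (psi x)) (grad F (psi x)).
have := @frame_integral _ _ K _ (reflection_isometry (x - y)) (measurable_frame_energy Sx).
by rewrite /K /= (reflection_swap xy) /frame_energy => <-.
Qed.

Lemma frame_slope2_swap x v v' : S x -> dotv v x = 0 -> dotv v' x = 0 ->
  dotv v v = dotv v' v' -> frame_slope2 x v = frame_slope2 x v'.
Proof.
move=> Sx vx v'x vv'.
pose K (psi : 'rV[R]_d -> 'rV[R]_d) := dotv (grad F (psi x)) (psi v) ^+ 2.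
have mK : measurable_fun G (fun w => K (Psi w)).
  by apply: measurable_funX; exact: measurable_frame_grad CF Sx.
have := frame_integral (reflection_isometry (v - v')) mK.
rewrite /K /= (reflection_swap vv') reflection_id /frame_slope2 => [<-//|].
by rewrite dotvDr dotvNr !(dotvC x) vx v'x subrr.
Qed.

Lemma slope_bound : exists2 M : R, 0 <= M &
  forall x v w, S x -> G w -> slope x v w ^+ 2 <= M * dotv v v.
Proof.
have [M M0 HM] := grad_sqr_bound CF; exists M => // x v w Sx Gw.
apply: le_trans (cauchy_schwarz _ _) _; rewrite (good_isometry Gw).2.
by rewrite ler_wpM2r ?dotv_ge0// HM//; exact: frame_sphere.
Qed.

Lemma integrable_slopes x y v (a c : R) : S x -> S y ->
  lam.-integrable G (EFin \o (fun w => (a * slope x v w + c * slope y v w) ^+ 2)).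
Proof.
move=> Sx Sy; have [M M0 HM] := slope_bound.
apply: (bounded_integrable (@measurable_good R d) (lebesgue_good_lty R d)
   (C := 2 * (a ^+ 2 + c ^+ 2) * (M * dotv v v))).
  apply: measurable_funX; apply: measurable_funD; apply: measurable_funM => //;
    exact: measurable_frame_grad CF _.
move=> w Gw; have := HM x v w Sx Gw; have := HM y v w Sy Gw.
rewrite ger0_norm ?sqr_ge0//; move: (slope x v w) (slope y v w) (M * _) => p q m pm qm.
have ha := sqr_ge0 a; have hc := sqr_ge0 c.
have h1 : a ^+ 2 * p ^+ 2 <= a ^+ 2 * m by rewrite ler_wpM2l.
have h2 : c ^+ 2 * q ^+ 2 <= c ^+ 2 * m by rewrite ler_wpM2l.
have h3 := sqr_ge0 (a * p - c * q).
apply: (@le_trans _ _ (2 * (a ^+ 2 * p ^+ 2) + 2 * (c ^+ 2 * q ^+ 2))); last by lra.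
rewrite -subr_ge0 (_ : _ - _ = (a * p - c * q) ^+ 2)//; ring.
Qed.

Lemma integrable_slope2 x v : S x ->
  lam.-integrable G (EFin \o (fun w => slope x v w ^+ 2)).
Proof.
move=> Sx; have := integrable_slopes v 1 0 Sx Sx; apply: eq_integrable.
  exact: measurable_good.
by move=> w _; rewrite /= mul1r mul0r addr0.
Qed.

Lemma frame_slope2Z x v (a : R) : S x -> frame_slope2 x (a *: v) = a ^+ 2 * frame_slope2 x v.
Proof.
move=> Sx; rewrite /frame_slope2 -RintegralZl//; last 2 first.
- exact: measurable_good.
- exact: integrable_slope2.
apply: eq_Rintegral => w /[!inE] Gw.
by rewrite (isometryZ _ _ (good_isometry Gw)) dotvZr exprMn.
Qed.

Lemma frame_slope2_proportional x v v' : S x -> dotv v x = 0 -> dotv v' x = 0 ->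
  dotv v' v' * frame_slope2 x v = dotv v v * frame_slope2 x v'.
Proof.
move=> Sx vx v'x; rewrite -!sqr_enorm -!frame_slope2Z//.
apply: frame_slope2_swap => //; rewrite ?dotvZl ?dotvZr ?vx ?v'x ?mulr0// -!sqr_enorm; ring.
Qed.

(** As for [moment2E]: the mean squared slope depends on the tangent vector only through its norm,
    and the slopes along the projected basis add up to the squared gradient. *)
Lemma frame_slope2E x v : S x -> dotv v x = 0 ->
  (d%:R - 1) * frame_slope2 x v = dotv v v * frame_energy x.
Proof.
move=> Sx vx; have xx := (sphereP x).1 Sx.
have ps i : dotv (e_ i - x ord0 i *: x) x = 0.
  by rewrite dotvDl dotvNl dotvZl xx mulr1 dotvC dotv_delta subrr.
rewrite -(sum_dotv_proj Sx) mulr_suml.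
under eq_bigr do rewrite (frame_slope2_proportional Sx vx (ps _)).
rewrite -mulr_sumr; congr (_ * _).
have mG := @measurable_good R d.
transitivity (\int[lam]_(w in G) (\sum_(i < d) slope x (e_ i - x ord0 i *: x) w ^+ 2))%R; last first.
  (* Parseval is applied at x to the gradient pulled back by the inverse g of the frame; its normal
     component vanishes by Euler's identity. *)
  apply: eq_Rintegral => w /[!inE] Gw; have fi := good_isometry Gw.
  have [g [gi fK gK]] := isometry_inv fi.
  have gE u : dotv (grad F (Psi w x)) (Psi w u) = dotv (g (grad F (Psi w x))) u.
    by rewrite -{1}(gK (grad F _)) fi.2.
  under eq_bigr do rewrite gE.
  rewrite sum_sqr_proj// -(gE x) euler_zhom// ?gi.2 ?expr0n ?subr0//.
  by apply: sphere_neq0; exact: frame_sphere.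
have im i := integrable_slope2 (e_ i - x ord0 i *: x) Sx.
elim: (index_enum _) => [|i r IH].
  rewrite big_nil /Rintegral; under eq_integral do rewrite big_nil.
  by rewrite integral0.
rewrite big_cons IH -RintegralD//.
  by apply: eq_Rintegral => w _; rewrite big_cons.
have := integrable_sum mG r (P := xpredT) (fun i _ => im i).
by apply: eq_integrable => // w _; rewrite /= sumEFin.
Qed.

(** The rotation plane contains s, the direction of x - e y. Since |x - e y|^2 = 2 (1 - e x . y), (x
    . s)^2 = (1 - e x . y) / 2, and y . s = - e (x . s), so the two slopes combine with signs 1 and
    e. *)
Lemma frame_variance_half x y v e : S x -> S y -> e = 1 \/ e = -1 -> x != e *: y ->
  dotv v v = 1 -> dotv v x = 0 -> dotv v y = 0 ->
  frame_variance x y <= (1 - e * dotv x y) / 2 *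
    (\int[lam]_(w in G) (1 * slope x v w + e * slope y v w) ^+ 2)%R.
Proof.
move=> Sx Sy e1 xey vv vx vy.
have xx := (sphereP x).1 Sx; have yy := (sphereP y).1 Sy.
have e2 : e * e = 1 by case: e1 => ->; rewrite ?mulr1// mulrNN mulr1.
have s0 : x - e *: y != 0 by rewrite subr_eq0.
pose s := sproj (x - e *: y); pose c := enorm (x - e *: y).
have c0 : c != 0 by rewrite enorm_eq0.
have c2 : c ^+ 2 = 2 * (1 - e * dotv x y).
  rewrite sqr_enorm !dotvDl !dotvDr !dotvNl !dotvNr !dotvZl !dotvZr xx yy (dotvC y x).
  have -> : 2 * (1 - e * dotv x y) = 1 + e * e - 2 * e * dotv x y by rewrite e2; ring.
  ring.
have ss : dotv s s = 1 by exact/sphereP/sproj_sphere.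
have sv : dotv s v = 0 by rewrite dotvZl dotvDl dotvNl dotvZl !(dotvC _ v) vx vy !mulr0 subr0 mulr0.
have xs : dotv x s = c^-1 * (1 - e * dotv x y).
  by rewrite dotvZr dotvDr dotvNr dotvZr xx.
have ys : dotv y s = - e * dotv x s.
  rewrite xs dotvZr dotvDr dotvNr dotvZr yy (dotvC y x) -/c.
  transitivity (c^-1 * (e * e * dotv x y - e * 1)); first by rewrite e2 mul1r.
  ring.
have rx : rot s v pi x = e *: y.
  rewrite rot_pi// ?(dotvC x)// reflectionZ ?invr_eq0// reflection_swap//.
  by rewrite dotvZl dotvZr yy xx mulr1 e2.
have ry : rot s v pi y = e *: x.
  (* y - e x is a multiple of x - e y, so one reflection serves for both points. *)
  have yex : y - e *: x = (- e) *: (x - e *: y).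
    by rewrite scalerBr scaleNr scalerA mulNr e2 scaleN1r opprK addrC.
  have Ne0 : - e != 0 by rewrite oppr_eq0; apply/eqP => E; move: e2; rewrite E mul0r => /eqP; rewrite eq_sym oner_eq0.
  rewrite rot_pi// ?(dotvC y)// reflectionZ ?invr_eq0// -(reflectionZ _ _ Ne0) -yex reflection_swap//.
  by rewrite dotvZl dotvZr yy xx mulr1 e2.
have := frame_rotation_poincare CF eF Sx Sy ss vv sv _ _ e1 rx ry.
rewrite !(dotvC _ v) => /(_ vx vy) h; apply: le_trans h _.
rewrite -RintegralZl//; last 2 first.
- exact: measurable_good.
- exact: integrable_slopes.
rewrite le_eqVlt; apply/orP; left; apply/eqP; apply: eq_Rintegral => w _; rewrite ys xs.
rewrite (_ : 1 - e * dotv x y = c ^+ 2 / 2); last by rewrite c2; field.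
by field.
Qed.

(** The cases x = y and x = - y, where one of the planes degenerates, have zero variance because F
    is even. Otherwise both signs of [frame_variance_half] are used with the same v, orthogonal to x
    and y. *)
Theorem frame_variance_le x y : (3 <= d)%N -> S x -> S y ->
  (d%:R - 1) * frame_variance x y <= (1 - dotv x y ^+ 2) * frame_energy x.
Proof.
move=> d3 Sx Sy; have xx := (sphereP x).1 Sx; have yy := (sphereP y).1 Sy.
have V0 : x = y \/ x = - y -> frame_variance x y = 0.
  move=> xy; rewrite /frame_variance.
  transitivity (\int[lam]_(w in G) 0)%R; last by rewrite /Rintegral integral0.
  apply: eq_Rintegral => w /[!inE] Gw; case: xy => ->; first by rewrite subrr expr0n.
  rewrite (isometryN _ (good_isometry Gw)) eF ?subrr ?expr0n//.
  by apply: sphere_neq0; exact: frame_sphere.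
have N0 : 0 <= frame_energy x by apply: Rintegral_ge0 => w _; exact: dotv_ge0.
have t1 : 0 <= 1 - dotv x y ^+ 2 by rewrite subr_ge0; exact: sphere_dotv_le1.
have [xy|xy] := eqVneq x y; first by rewrite V0 ?mulr0 ?mulr_ge0//; left.
have [xNy|xNy] := eqVneq x (- y); first by rewrite V0 ?mulr0 ?mulr_ge0//; right.
have [v [vv vx vy]] := exists_unit_orthogonal x y d3.
have hp : frame_variance x y <= (1 - 1 * dotv x y) / 2 *
    (\int[lam]_(w in G) (1 * slope x v w + 1 * slope y v w) ^+ 2)%R.
  by apply: frame_variance_half => //; [left|rewrite scale1r].
have hm : frame_variance x y <= (1 - (-1) * dotv x y) / 2 *
    (\int[lam]_(w in G) (1 * slope x v w + (-1) * slope y v w) ^+ 2)%R.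
  by apply: frame_variance_half => //; [right|rewrite scaleN1r].
(* Parallelogram identity: the correlation of the slopes at x and y, about which nothing is known,
   cancels. *)
have par : (\int[lam]_(w in G) (1 * slope x v w + 1 * slope y v w) ^+ 2)%R +
    (\int[lam]_(w in G) (1 * slope x v w + (-1) * slope y v w) ^+ 2)%R =
    2 * frame_slope2 x v + 2 * frame_slope2 y v.
  have mG := @measurable_good R d.
  have Z z : S z -> 2 * frame_slope2 z v = (\int[lam]_(w in G) (2 * slope z v w ^+ 2))%R.
    by move=> Sz; rewrite (RintegralZl 2 mG (integrable_slope2 v Sz)).
  apply: etrans (f_equal2 +%R (esym (Z x Sx)) (esym (Z y Sy))).
  have iZ z : S z -> lam.-integrable G (EFin \o (fun w => 2 * slope z v w ^+ 2)).
    by move=> Sz; have := integrableZl mG 2 (integrable_slope2 v Sz); apply: eq_integrable.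
  apply: etrans (RintegralD mG (iZ x Sx) (iZ y Sy)).
  apply: etrans (esym (RintegralD mG (integrable_slopes v 1 1 Sx Sy) (integrable_slopes v 1 (-1) Sx Sy))) _.
  by apply: eq_Rintegral => w _; ring.
have ex := frame_slope2E Sx vx; have ey := frame_slope2E Sy vy.
rewrite -(frame_energy_const Sx Sy) vv !mul1r in ex ey.
have tb := dotv_le1 xx yy; rewrite ler_norml in tb; case/andP: tb => tm tp.
have h3 := average_bounds tm tp hp hm; rewrite par in h3.
have d1 : 0 < d%:R - 1 :> R by rewrite subr_gt0 ltr1n; apply: leq_trans d3.
have -> : (1 - dotv x y ^+ 2) * frame_energy x =
    (d%:R - 1) * ((1 - dotv x y ^+ 2) / 4 * (2 * frame_slope2 x v + 2 * frame_slope2 y v)).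
  move: ex ey; move: (frame_slope2 x v) (frame_slope2 y v) (frame_energy x) (dotv x y) => p q N t ex ey.
  transitivity ((1 - t ^+ 2) / 2 * ((d%:R - 1) * p + (d%:R - 1) * q)); last by field.
  by rewrite ex ey; field.
by rewrite ler_pM2l.
Qed.

End frame_variance.

(** * Tonelli on measurable rectangles *)

Section tonelli_on.
Local Open Scope ereal_scope.
Context d1 d2 (T1 : measurableType d1) (T2 : measurableType d2) (R : realType).
Variables (m1 : {sigma_finite_measure set T1 -> \bar R}) (m2 : {sigma_finite_measure set T2 -> \bar R}).
Variables (A : set T1) (B : set T2) (f : T1 * T2 -> \bar R).
Hypotheses (mA : measurable A) (mB : measurable B).
Hypothesis mf : measurable_fun (A `*` B) f.
Hypothesis f0 : forall x y, A x -> B y -> 0 <= f (x, y).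

Let g := f \_ (A `*` B).

Let mg : measurable_fun setT g.
Proof. by apply/(measurable_restrictT _ _).1 => //; exact: measurableX. Qed.

Let g0 z : 0 <= g z.
Proof.
rewrite /g patchE; case: ifPn => //; rewrite inE => -[]; case: z => x y /=; exact: f0.
Qed.

Let gE1 x : \int[m2]_y g (x, y) = ((fun x => \int[m2]_(y in B) f (x, y)) \_ A) x.
Proof.
rewrite patchE; case: ifPn => xA; last first.
  rewrite integral0_eq// => y _; rewrite /g patchE ifN//.
  by apply: contra xA; rewrite !inE => -[].
rewrite [RHS]integral_mkcond; apply: eq_integral => y _.
by rewrite /g !patchE in_setX xA.
Qed.

Let gE2 y : \int[m1]_x g (x, y) = ((fun y => \int[m1]_(x in A) f (x, y)) \_ B) y.
Proof.
rewrite patchE; case: ifPn => yB; last first.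
  rewrite integral0_eq// => x _; rewrite /g patchE ifN//.
  by apply: contra yB; rewrite !inE => -[].
rewrite [RHS]integral_mkcond; apply: eq_integral => x _.
by rewrite /g !patchE in_setX yB andbT.
Qed.

Lemma measurable_fun_tonelli : measurable_fun A (fun x => \int[m2]_(y in B) f (x, y)).
Proof.
apply/(measurable_restrictT _ mA).2; rewrite -(funext gE1).
exact: measurable_fun_fubini_tonelli_F.
Qed.

Lemma tonelli_on : \int[m1]_(x in A) \int[m2]_(y in B) f (x, y) =
  \int[m2]_(y in B) \int[m1]_(x in A) f (x, y).
Proof.
rewrite integral_mkcond [RHS]integral_mkcond.
rewrite -(funext gE1) -(funext gE2).
exact: fubini_tonelli.
Qed.

End tonelli_on.

(* The final step compares with the integral of the Gamma_2 term, whose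
   measurability [ge0_le_integral] would require. *)
Lemma ge0_integral_mono dT (T : measurableType dT) (R : realType) (mu : {measure set T -> \bar R})
    (D : set T) (f g : T -> \bar R) : (forall x, D x -> (0 <= f x)%E) ->
  (forall x, D x -> (f x <= g x)%E) -> (\int[mu]_(x in D) f x <= \int[mu]_(x in D) g x)%E.
Proof.
move=> f0 fg; rewrite !ge0_integralE//; last by move=> x Dx; apply: le_trans (f0 x Dx) (fg x Dx).
apply: ereal_sup_le => _ [h hf <-].
exists h => // x.
by apply: le_trans (hf x) _; apply: lee_restrict.
Qed.

Section spherical_poincare.
Context (R : realType) (d : nat) (b : R -> \bar R).
Hypothesis b_meas : measurable_fun (`[-1, 1]%classic : set R) b.
Hypothesis b_ge0 : forall t, -1 <= t <= 1 -> (0 <= b t)%E.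
Hypothesis b_int : forall s : 'rV[R]_d, sphere R d s ->
      (\int[surface_measure]_(s' in sphere R d)
         ((1 - dotv s s' ^+ 2)%:E * b (dotv s s')) < +oo)%E.
Context (F : 'rV[R]_d -> R).
Hypothesis CF : Ck 1 F.
Hypothesis hF : zhom F.
Hypothesis eF : even_away F.
Hypothesis d3 : (3 <= d)%N.
Implicit Types (x y s v : 'rV[R]_d).
Local Notation lam := (@lebesgue_rV R (d * d)).
Local Notation mu := (@surface_measure R d).
Local Notation G := (@good R d).
Local Notation S := (sphere R d).
Local Notation Om := 'rV[R]_(d * d).
Local Notation Psi w := (frame (vec_mx w)).

Let mS := @measurable_sphere R d.
Let mG := @measurable_good R d.

Lemma measurable_frame_joint :
  measurable_fun setT (fun p : Om * 'rV[R]_d => Psi p.1 p.2).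
Proof.
apply/measurable_fun_rVP => i; under eq_fun do rewrite mxE.
apply: measurable_dotv => j.
  exact: (measurableT_comp (measurable_coord j) measurable_snd).
apply: (measurableT_comp (measurable_coord j)).
exact: (measurableT_comp (measurable_gs i) measurable_fst).
Qed.

Lemma measurable_frame_comp_joint k H : Ck k H ->
  measurable_fun (G `*` S) (fun p : Om * 'rV[R]_d => H (Psi p.1 p.2)).
Proof.
move=> CH; apply: (measurable_comp mS _ (Ck_measurable_sphere CH)).
- by move=> _ [p [Gp Sp] <-]; exact: frame_sphere.
- by apply: measurable_funTS; exact: measurable_frame_joint.
Qed.

Lemma measurable_b_joint dT (T : measurableType dT) (f g : T -> 'rV[R]_d) (D : set T) :
  measurable_fun setT f -> measurable_fun setT g -> (forall p, D p -> S (f p)) ->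
  (forall p, D p -> S (g p)) -> measurable_fun D (fun p => b (dotv (f p) (g p))).
Proof.
move=> mf mg Df Dg; have mfg : measurable_fun D (fun p => dotv (f p) (g p)).
  by apply: measurable_dotv => i; apply: measurable_funTS;
    apply: (measurableT_comp (measurable_coord i)).
apply: (measurable_comp (measurable_itv `[-1, 1]) _ b_meas mfg).
by move=> _ [p Dp <-]; rewrite /= in_itv/= dotv_itv//; [exact: Dg|exact: Df].
Qed.

Local Notation Q s x := (((F x - F s) ^+ 2)%:E * b (dotv x s))%E.
Local Notation q w s x := (((F (Psi w x) - F (Psi w s)) ^+ 2)%:E * b (dotv x s))%E.

Let Q_ge0 a s x : S s -> S x -> (0 <= (a ^+ 2)%:E * b (dotv x s))%E.
Proof. by move=> Ss Sx; rewrite mule_ge0 ?lee_fin ?sqr_ge0// b_ge0// dotv_itv. Qed.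

Let mQ : measurable_fun (S `*` S) (fun p : 'rV[R]_d * 'rV[R]_d => Q p.1 p.2).
Proof.
have mF1 (pr : 'rV[R]_d * 'rV[R]_d -> 'rV[R]_d) : measurable_fun setT pr ->
    (forall p, (S `*` S) p -> S (pr p)) -> measurable_fun (S `*` S) (F \o pr).
  move=> mpr Dpr; apply: (measurable_comp mS _ (Ck_measurable_sphere CF)).
  - by move=> _ [p Dp <-]; exact: Dpr.
  - exact: measurable_funTS.
apply: emeasurable_funM.
  apply/measurable_EFinP; apply: measurable_funX; apply: measurable_funB.
  - by apply: (mF1 snd) => // p [].
  - by apply: (mF1 fst) => // p [].
by apply: measurable_b_joint => // p [].
Qed.

Let mQ1 s : S s -> measurable_fun S (fun x => Q s x).
Proof.
move=> Ss; apply: emeasurable_funM; last exact: measurable_b_dotv.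
apply/measurable_EFinP; apply: measurable_funX; apply: measurable_funB; last exact: measurable_cst.
exact: Ck_measurable_sphere CF.
Qed.

Let mq : measurable_fun ((G `*` S) `*` S) (fun p : (Om * 'rV[R]_d) * 'rV[R]_d => q p.1.1 p.1.2 p.2).
Proof.
have mF1 (pr : (Om * 'rV[R]_d) * 'rV[R]_d -> Om * 'rV[R]_d) : measurable_fun setT pr ->
    (forall p, ((G `*` S) `*` S) p -> (G `*` S) (pr p)) ->
    measurable_fun ((G `*` S) `*` S) ((fun p => F (Psi p.1 p.2)) \o pr).
  move=> mpr Dpr.
  apply: (measurable_comp (measurableX mG mS) _ (measurable_frame_comp_joint CF)).
  - by move=> _ [p Dp <-]; exact: Dpr.
  - exact: measurable_funTS.
have mfst2 : measurable_fun setT (fun p : (Om * 'rV[R]_d) * 'rV[R]_d => p.1.2).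
  exact: (measurableT_comp measurable_snd measurable_fst).
have mfst1 : measurable_fun setT (fun p : (Om * 'rV[R]_d) * 'rV[R]_d => p.1.1).
  exact: (measurableT_comp measurable_fst measurable_fst).
apply: emeasurable_funM.
  apply/measurable_EFinP; apply: measurable_funX; apply: measurable_funB.
  - apply: (mF1 (fun p => (p.1.1, p.2))) => [|p [[]]//].
    exact: measurable_fun_pair.
  - by apply: (mF1 fst) => // p [].
by apply: measurable_b_joint => // p [[]].
Qed.

Let I := (\int[mu]_(s in S) \int[mu]_(x in S) Q s x)%E.

Let I_frame w : G w -> (\int[mu]_(s in S) \int[mu]_(x in S) q w s x = I)%E.
Proof.
move=> Gw; have fi := good_isometry Gw.
apply: etrans (ge0_surface_integral_isometry (F := fun s => \int[mu]_(x in S) Q s x)%E fi _ _).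
- apply: eq_integral => s /[!inE] Ss; have Sws : S (Psi w s) by exact: frame_sphere.
  apply: etrans (ge0_surface_integral_isometry (F := fun x => Q (Psi w s) x)%E fi _ _).
  + by apply: eq_integral => x _; rewrite fi.2.
  + exact: mQ1.
  + by move=> x Sx; exact: Q_ge0.
- by apply: (measurable_fun_tonelli mu mS mS mQ) => s x Ss Sx; exact: Q_ge0.
- by move=> s Ss; apply: integral_ge0 => x Sx; exact: Q_ge0.
Qed.

Let V s x := frame_variance F x s.

Let int_q s x : S s -> S x -> (\int[lam]_(w in G) q w s x = (V s x)%:E * b (dotv x s))%E.
Proof.
move=> Ss Sx.
have mV : measurable_fun G (fun w => (F (Psi w x) - F (Psi w s)) ^+ 2).
  by apply: measurable_funX; apply: measurable_funB; exact: measurable_frame_comp CF _.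
rewrite ge0_integralZr//; [|exact/measurable_EFinP|by move=> w _; rewrite lee_fin sqr_ge0
  |by rewrite b_ge0// dotv_itv].
congr (_ * _)%E; rewrite /V /frame_variance /Rintegral fineK//.
have [M M0 HM] := Ck_bounded CF.
apply: integrable_fin_num => //.
apply: (bounded_integrable mG (lebesgue_good_lty R d) (C := (M + M) ^+ 2)) => // w Gw.
rewrite normrX lerXn2r ?nnegrE ?addr_ge0//.
by apply: le_trans (ler_normB _ _) _; apply: lerD; apply: HM; apply: sphere_annulus; exact: frame_sphere.
Qed.

(** Each frame is an isometry preserving both the surface measure and s' . s, so replacing F by its
    rotated copy does not change I. Integrating over the frames and exchanging integrals brings in
    the variance of a fixed pair. *)
Lemma frame_average : (lam G * I = \int[mu]_(s in S) \int[mu]_(x in S) ((V s x)%:E * b (dotv x s)))%E.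
Proof.
transitivity (\int[lam]_(w in G) \int[mu]_(s in S) \int[mu]_(x in S) q w s x)%E.
  rewrite (eq_integral (fun=> I)); last by move=> w /[!inE] Gw; exact: I_frame.
  by rewrite integral_cst// muleC.
have q_ge0 w s x : G w -> S s -> S x -> (0 <= q w s x)%E by move=> _ Ss Sx; exact: Q_ge0.
have step1 := tonelli_on lam mu (f := fun p => \int[mu]_(x in S) q p.1 p.2 x)%E mG mS.
apply: etrans (step1 _ _) _.
- apply: (measurable_fun_tonelli mu (measurableX mG mS) mS mq).
  by move=> [w s] x [/= Gw Ss] Sx; exact: q_ge0.
- by move=> w s Gw Ss; apply: integral_ge0 => x Sx; exact: q_ge0.
apply: eq_integral => s /[!inE] Ss.
apply: etrans (tonelli_on lam mu (f := fun p => q p.1 s p.2)%E mG mS _ _) _.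
- have mg : measurable_fun (G `*` S) (fun p : Om * 'rV[R]_d => ((p.1, s), p.2)).
    apply: measurable_funTS; apply: measurable_fun_pair; last exact: measurable_snd.
    by apply: measurable_fun_pair; [exact: measurable_fst|exact: measurable_cst].
  apply: (measurable_comp (measurableX (measurableX mG mS) mS) _ mq mg).
  by move=> _ [p [Gp Sp] <-].
- by move=> w x Gw Sx; exact: q_ge0.
by apply: eq_integral => x /[!inE] Sx; exact: int_q.
Qed.

Lemma EFin_frame_energy s : S s -> (frame_energy F s)%:E =
  (\int[lam]_(w in G) (dotv (grad F (Psi w s)) (grad F (Psi w s)))%:E)%E.
Proof.
move=> Ss; rewrite /frame_energy /Rintegral fineK//.
apply: integrable_fin_num => //; have [M M0 HM] := grad_sqr_bound CF.
apply: (bounded_integrable mG (lebesgue_good_lty R d) (C := M)); first exact: measurable_frame_energy.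
by move=> w Gw; rewrite ger0_norm ?dotv_ge0// HM//; exact: frame_sphere.
Qed.

Lemma frame_energy_average : (\int[mu]_(s in S) (frame_energy F s)%:E =
  lam G * \int[mu]_(s in S) (dotv (grad F s) (grad F s))%:E)%E.
Proof.
have mgg : measurable_fun (G `*` S) (fun p => (dotv (grad F (Psi p.1 p.2)) (grad F (Psi p.1 p.2)))%:E).
  apply/measurable_EFinP; apply: measurable_dotv => i; under eq_fun do rewrite mxE;
    exact: measurable_frame_comp_joint (Ck_derive i CF).
transitivity (\int[mu]_(s in S) \int[lam]_(w in G) (dotv (grad F (Psi w s)) (grad F (Psi w s)))%:E)%E.
  by apply: eq_integral => s /[!inE]; exact: EFin_frame_energy.
apply: etrans (esym (tonelli_on lam mu mG mS mgg _)) _.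
  by move=> w s _ _; rewrite lee_fin dotv_ge0.
set E0 := (\int[mu]_(s in S) _)%E.
rewrite (eq_integral (fun=> E0)); first by rewrite integral_cst// muleC.
move=> w /[!inE] Gw; have fi := good_isometry Gw.
apply: (ge0_surface_integral_isometry (F := fun s => (dotv (grad F s) (grad F s))%:E) fi).
  apply/measurable_EFinP; apply: measurable_dotv => i; under eq_fun do rewrite mxE;
    exact: Ck_measurable_sphere (Ck_derive i CF).
by move=> s _; rewrite lee_fin dotv_ge0.
Qed.

Lemma EFin_moment s : S s ->
  (\int[mu]_(x in S) ((1 - dotv x s ^+ 2)%:E * b (dotv x s)) = (moment b s)%:E)%E.
Proof.
move=> Ss; have sinC x : S x -> `|1 - dotv x s ^+ 2| <= 1 * (1 - dotv x s ^+ 2).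
  by move=> Sx; rewrite mul1r ger0_norm// subr_ge0 sphere_dotv_le1.
have := @integral_kernel _ _ b b_meas b_ge0 b_int (fun x => 1 - dotv x s ^+ 2) s S 1 Ss mS
  (fun _ => id) (measurable_sin2 s) sinC.
move=> ->; rewrite /moment /Rintegral fineK//.
by apply: integrable_fin_num => //; exact: integrable_moment.
Qed.

(** Both sides are multiplied by the positive finite mass of the good set, averaged over frames, and
    compared pair by pair through [frame_variance_le]. The moment at s0 is that at every s, which
    reconstitutes the inner integral of (1 - t^2) b. *)
Theorem spherical_poincare s0 : S s0 ->
  (\int[mu]_(s in S) \int[mu]_(x in S) Q s x <=
   (moment b s0 / (d%:R - 1))%:E * \int[mu]_(s in S) (dotv (grad F s) (grad F s))%:E)%E.
Proof.
move=> Ss0; have G0 := lebesgue_good_gt0 R d; have Goo := lebesgue_good_lty R d.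
have d1 : 0 < d%:R - 1 :> R by rewrite subr_gt0 ltr1n; apply: leq_trans d3.
have Gfin : lam G \is a fin_num by rewrite ge0_fin_numE.
set E0 := (\int[mu]_(s in S) (dotv (grad F s) (grad F s))%:E)%E.
set K := moment b s0.
have K0 : 0 <= K by exact: moment_ge0.
have N0 s : 0 <= frame_energy F s by apply: Rintegral_ge0 => w _; exact: dotv_ge0.
suff : (lam G * I <= lam G * ((K / (d%:R - 1))%:E * E0))%E.
  by rewrite lee_pmul2l.
rewrite frame_average muleCA -frame_energy_average.
rewrite -ge0_integralZl//; last 3 first.
- have : measurable_fun S (fun=> (frame_energy F s0)%:E) by exact: measurable_cst.
  by apply: eq_measurable_fun => s /[!inE] Ss; rewrite (frame_energy_const CF Ss0 Ss).
- by move=> s _; rewrite lee_fin.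
- by rewrite lee_fin divr_ge0// ltW.
apply: ge0_integral_mono.
  move=> s Ss; apply: integral_ge0 => x Sx; rewrite mule_ge0 ?b_ge0 ?dotv_itv// lee_fin.
  by apply: Rintegral_ge0 => w _; exact: sqr_ge0.
move=> s Ss; rewrite /K (moment_const b_meas b_ge0 b_int Ss0 Ss).
have -> : ((moment b s / (d%:R - 1))%:E * (frame_energy F s)%:E =
    (frame_energy F s / (d%:R - 1))%:E * (moment b s)%:E)%E.
  by rewrite -!EFinM; congr EFin; ring.
rewrite -EFin_moment// -ge0_integralZl//; last 3 first.
- exact: measurable_weight.
- by move=> x Sx; exact: weight_ge0.
- by rewrite lee_fin divr_ge0// ltW.
apply: ge0_integral_mono.
  move=> x Sx; rewrite mule_ge0 ?b_ge0 ?dotv_itv// lee_fin.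
  by apply: Rintegral_ge0 => w _; exact: sqr_ge0.
move=> x Sx; rewrite muleA -EFinM lee_wpmul2r ?b_ge0 ?dotv_itv// lee_fin.
rewrite -(ler_pM2l d1) [leRHS](_ : _ = (1 - dotv x s ^+ 2) * frame_energy F x).
  exact: frame_variance_le.
rewrite (frame_energy_const CF Ss Sx); field.
by rewrite gt_eqF.
Qed.

End spherical_poincare.

(* With [f = a^2 / 2], the quotient is [(a - c)^2 (a + c)^2 / (2 (a^2 + c^2))]. *)
Lemma sqr_diff_div_le (R : realFieldType) (a c : R) : 0 < a -> 0 < c ->
  (a ^+ 2 / 2 - c ^+ 2 / 2) ^+ 2 / (a ^+ 2 / 2 + c ^+ 2 / 2) <= (a - c) ^+ 2.
Proof.
move=> a0 c0; have p : 0 < a ^+ 2 / 2 + c ^+ 2 / 2 by rewrite addr_gt0// divr_gt0// exprn_gt0.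
rewrite ler_pdivrMr// -subr_ge0.
rewrite (_ : _ - _ = (a - c) ^+ 2 * (a - c) ^+ 2 / 4); last by field.
by rewrite divr_ge0// mulr_ge0 ?sqr_ge0.
Qed.

(** * From the density to its square root *)

Section sqrt_density.
Context (R : realType) (d : nat) (f : 'rV[R]_d -> R).
Hypothesis f_smooth : sphere_smooth f.
Hypothesis f_gt0 : forall s, sphere R d s -> 0 < f s.
Hypothesis f_even : forall s, sphere R d s -> f (- s) = f s.
Implicit Types x s : 'rV[R]_d.

Local Notation h := (@ln R \o f).
Local Notation S := (sphere R d).

Lemma Ck_log k : Ck k (h \o sproj).
Proof.
apply: (@Ck_ln _ _ _ (f \o sproj)); last exact: sphere_smooth_Ck.
by move=> x x0; apply: f_gt0; exact: sproj_sphere.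
Qed.

(** The function sqrt (2 f) on the sphere, extended along rays; the exponential form makes its
    smoothness and its gradient immediate from those of ln f. *)
Definition root_density x : R := Num.sqrt 2 * expR (2^-1 * (h \o sproj) x).

Lemma Ck_root_density k : Ck k root_density.
Proof. by apply: CkZ; apply: Ck_expR; apply: CkZ; exact: Ck_log. Qed.

Lemma root_density_zhom : zhom root_density.
Proof. by move=> a x a0 x0; rewrite /root_density /= sprojZ. Qed.

Lemma root_density_even : even_away root_density.
Proof. by move=> x x0; rewrite /root_density /= sprojN f_even//; exact: sproj_sphere. Qed.

Lemma root_density_gt0 x : 0 < root_density x.
Proof. by rewrite mulr_gt0 ?expR_gt0// sqrtr_gt0. Qed.

Lemma sqr_root_density s : S s -> root_density s ^+ 2 / 2 = f s.
Proof.
move=> Ss; rewrite /root_density /= sproj_id// exprMn sqr_sqrtr//.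
rewrite -expRM_natl mulrA mulfV ?pnatr_eq0// mul1r lnK ?posrE ?f_gt0//.
by rewrite mulrAC mulfV ?mul1r// pnatr_eq0.
Qed.

Lemma grad_root_density s : S s ->
  dotv (grad root_density s) (grad root_density s) = 2^-1 * f s * Gamma_Delta h h s.
Proof.
move=> Ss; have s0 := sphere_neq0 Ss.
have -> : grad root_density s = (2^-1 * root_density s) *: grad (h \o sproj) s.
  apply/rowP => i; rewrite !mxE.
  have dH : derivable (h \o sproj) s (delta_mx 0 i) by exact: Ck_derivable (Ck_log 1) s0.
  have dphi (u : R) : is_derive u 1 (fun u : R => Num.sqrt 2 * expR (2^-1 * u))
      (2^-1 * (Num.sqrt 2 * expR (2^-1 * u))).
    have h1 := is_deriveZ (2^-1 : R) (is_derive_id u (1 : R)).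
    have h2 := is_deriveZ (Num.sqrt 2 : R) (is_derive1_comp (is_derive_expR (2^-1 *: u)) h1).
    move: h2; rewrite (_ : _ *: _ = 2^-1 * (Num.sqrt 2 * expR (2^-1 * u))); first by exact.
    by rewrite -[LHS]/(_ * (_ * (_ * _))); ring.
  by rewrite (@derive_val _ _ _ _ _ _ _ (is_derive_comp_along dH (dphi _))).
rewrite dotvZl dotvZr /Gamma_Delta -(sqr_root_density Ss).
by move: (root_density s) (dotv _ _) => *; field.
Qed.

End sqrt_density.

Section spectral_gap.
Context (R : realType) (d : nat) (b : R -> \bar R).
Hypothesis b_meas : measurable_fun (`[-1, 1]%classic : set R) b.
Hypothesis b_ge0 : forall t, -1 <= t <= 1 -> (0 <= b t)%E.
Hypothesis b_int : forall s : 'rV[R]_d, sphere R d s ->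
      (\int[surface_measure]_(s' in sphere R d)
         ((1 - dotv s s' ^+ 2)%:E * b (dotv s s')) < +oo)%E.
Local Notation mu := (@surface_measure R d).
Local Notation S := (sphere R d).

(** The quotient is bounded by the squared increment of F, then by its energy; (d - 2) K / (d - 1)
    times |grad F|^2 is pointwise the lower bound of [Gamma2_ge] multiplied by f. *)
Theorem dissipation_ineq_dim : (3 <= d)%N -> dissipation_ineq d b (d%:R - 2).
Proof.
move=> d3 f f_smooth f_gt0 f_even.
have d1 : 0 < d%:R - 1 :> R by rewrite subr_gt0 ltr1n; apply: leq_trans d3.
have d2 : 0 <= d%:R - 2 :> R by rewrite subr_ge0 ler_nat; apply: leq_trans d3.
(* Only a point of the sphere is wanted, at which to evaluate the constant moment K. *)
have [s0 [/sphereP Ss0 _ _]] := exists_unit_orthogonal (0 : 'rV[R]_d) 0 d3.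
pose F := root_density f; pose h := @ln R \o f; set K := moment b s0.
have K0 : 0 <= K by exact: moment_ge0.
have CF k : Ck k F by exact: Ck_root_density.
have F0 := root_density_gt0 f.
have gE s : S s -> dotv (grad F s) (grad F s) = 2^-1 * f s * Gamma_Delta h h s.
  exact: grad_root_density.
have fE s : S s -> f s = F s ^+ 2 / 2 by move=> Ss; rewrite sqr_root_density.
have poincare : (\int[mu]_(s in S) \int[mu]_(s' in S) (((F s' - F s) ^+ 2)%:E * b (dotv s' s)) <=
   (K / (d%:R - 1))%:E * \int[mu]_(s in S) (dotv (grad F s) (grad F s))%:E)%E.
  apply: spherical_poincare => //; first exact: root_density_zhom.
  exact: root_density_even.
apply: (@le_trans _ _ ((d%:R - 2)%:E * ((K / (d%:R - 1))%:E * \int[mu]_(s in S) (dotv (grad F s) (grad F s))%:E))%E).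
  apply: lee_wpmul2l; first by rewrite lee_fin.
  apply: le_trans poincare; apply: ge0_integral_mono.
    move=> s Ss; apply: integral_ge0 => x Sx; rewrite mule_ge0 ?b_ge0 ?dotv_itv// lee_fin.
    by rewrite divr_ge0 ?sqr_ge0// ltW// addr_gt0// f_gt0.
  move=> s Ss; apply: ge0_integral_mono.
    move=> x Sx; rewrite mule_ge0 ?b_ge0 ?dotv_itv// lee_fin.
    by rewrite divr_ge0 ?sqr_ge0// ltW// addr_gt0// f_gt0.
  move=> x Sx; rewrite lee_wpmul2r ?b_ge0 ?dotv_itv// lee_fin (fE x)// (fE s)//.
  exact: sqr_diff_div_le.
rewrite muleA -EFinM -ge0_integralZl//; last 4 first.
- exact: measurable_sphere.
- apply/measurable_EFinP; apply: measurable_dotv => i; under eq_fun do rewrite mxE;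
    exact: Ck_measurable_sphere (Ck_derive i (CF 1)).
- by move=> s _; rewrite lee_fin dotv_ge0.
- by rewrite lee_fin mulr_ge0// divr_ge0// ltW.
apply: ge0_integral_mono => s Ss.
  by rewrite -EFinM lee_fin mulr_ge0 ?dotv_ge0// mulr_ge0// divr_ge0// ltW.
rewrite -EFinM lee_fin gE//.
have := Gamma2_ge b_meas b_ge0 b_int d3 (Ck_log f_smooth f_gt0 3) _ Ss.
have eh s1 : S s1 -> h (- s1) = h s1 by move=> Ss1; rewrite /h /= f_even.
move=> /(_ eh); rewrite -(moment_const b_meas b_ge0 b_int Ss0 Ss) -/K => G2.
rewrite [leLHS](_ : _ = 2^-1 * ((d%:R - 2) / (d%:R - 1)) * K * Gamma_Delta h h s * f s); last by ring.
by rewrite ler_wpM2r// ltW// f_gt0.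
Qed.

End spectral_gap.

Unset Implicit Arguments.

Theorem theorem3 (R : realType) (d : nat) (hd : (3 <= d)%N)
    (b : R -> \bar R)
    (b_meas : measurable_fun (`[-1, 1]%classic : set R) b)
    (b_ge0 : forall t, -1 <= t <= 1 -> (0 <= b t)%E)
    (b_int : forall s : 'rV[R]_d, sphere R d s ->
      (\int[surface_measure]_(s' in sphere R d)
         ((1 - dotv s s' ^+ 2)%:E * b (dotv s s')) < +oo)%E) :
  ((d%:R - 2)%:E <= best_constant d b)%E /\ dissipation_ineq d b (d%:R - 2).
Proof.
have key : dissipation_ineq d b (d%:R - 2) by exact: dissipation_ineq_dim.
by split => //; apply: ereal_sup_ubound; exists (d%:R - 2).
Qed.
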